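(* Let $\mathcal A$ be an $n$-DPDA whose input alphabet $A$ contains $\star$, and let $\phi:A^*\to M$ be a morphism into a finite monoid. For every milestone configuration $c$ of $\mathcal A$ there exists a number $\mathrm{pb}(c)\in\mathbb N$ such that the following holds. Let $k\in\{0,\dots,n\}$ and let $R\circ R'$ be a run starting in $c$ such that $R$ is not $(k-1)$-upper, the word read by $R$ begins with at least $\mathrm{pb}(c)$ stars, and $R'$ is $k$-upper. Then for every $l\in\mathbb N$ there exists a run $S\circ S'$ starting in $c$ such that $\phi(S)=\phi(R)$, the word read by $S$ begins with at least $l$ stars, and $S'$ is $(k,\phi)$-parallel to $R'$.
   Context: Stacks: fix order $n\ge1$, finite stack alphabet $\Gamma$. A $0$-stack is $(\gamma,x)$ with $\gamma\in\Gamma$, $x=(x_n,\dots,x_1)$ a vector of $n$ positive integers (position). For $k\in\{1,\dots,n\}$ a $k$-stack is a finite list $[s_1,\dots,s_m]$ ($m\ge0$) of nonempty $(k-1)$-stacks such that for some $x_n,\dots,x_{k+1}$, every position in $s_i$ has the form $(x_n,\dots,x_{k+1},i,y_{k-1},\dots,y_1)$. The top is at the right; $s^k:s^{k-1}$ appends at the top (right-associative); for $s^r=t^r:t^{r-1}:\dots:t^k$, $\mathrm{top}^k(s^r)=t^k$. Equality of stacks includes positions. $\mathrm{pos}{\downarrow}(s)$ deletes all positions; $s\cong t$ iff $\mathrm{pos}{\downarrow}(s)=\mathrm{pos}{\downarrow}(t)$. For $k<n$, $\mathsf p_{+1}(s^k)$ adds $1$ to the $(n-k)$-th coordinate of all positions.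 Operations of order $k\ge1$: $\mathsf{pop}^k(s^r:\dots:s^k:s^{k-1})=s^r:\dots:s^k$, defined only if the topmost $k$-stack has at least two $(k-1)$-stacks; $\mathsf{push}^k_\gamma(s^r:\dots:s^0)=s^r:\dots:s^{k+1}:(s^k:\dots:s^0):\mathsf p_{+1}(s^{k-1}:\dots:s^1:(\gamma,x))$ where $s^0=(\gamma',x)$. An $n$-DPDA has transitions determined by state and topmost stack symbol, each either $\mathrm{read}(\vec q)$ ($\vec q:A\to Q$ injective; leads to $(\vec q(a),s)$ for $a\in A$, this step reads $a$) or $(q,op)$ with $op$ a stack operation of order $\le n$ (leads to $(q,op(s))$ if defined; reads nothing). Configurations are (state, nonempty $n$-stack). A run is a finite or infinite sequence $R=c_0,c_1,\dots$ with each $c_i$ a successor of $c_{i-1}$; $R(i)=c_i$, $|R|$ length, $R[i,j]=c_i,\dots,c_j$, $\circ$ concatenation. For a finite run $R$, $\phi(R)=\phi(w)$ where $w$ is the word read by $R$. History: for a finite run $R$ and a $0$-stack $s^0$ of $R(|R|)$, $\mathrm{hist}(R,s^0)$ is a $0$-stack of $R(0)$: if $|R|=0$ it is $s^0$; if $R=S\circ T$, $|T|=1$, and the last step is a read or a $\mathsf{pop}$, or a $\mathsf{push}^r_\gamma$ with $s^0$ not in the topmost $(r-1)$-stack of $R(|R|)$, it is $\mathrm{hist}(S,s^0)$; if the last step is $\mathsf{push}^r_\gamma$ and $s^0$ is in the topmost $(r-1)$-stack of $R(|R|)$, it is $\mathrm{hist}(S,t^0)$ with $t^0$ equal to $s^0$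 with the $(n-r+1)$-th position coordinate decreased by $1$. For a $k$-stack $s^k$, $k\ge1$, $\mathrm{hist}(R,s^k)$ is the $k$-stack of $R(0)$ containing $\mathrm{hist}(R,s^0)$ for all $0$-stacks $s^0$ of $s^k$. For $k\in\{0,\dots,n\}$, $R$ is $k$-upper if $\mathrm{hist}(R,\mathrm{top}^k(R(|R|)))=\mathrm{top}^k(R(0))$; by convention no run is $(-1)$-upper. Milestone: a configuration $c$ is a milestone if there exist an infinite run $R$ from $c$ reading only stars and an infinite set $I\subseteq\mathbb N$ with $0\in I$ such that $R[i,j]$ is $0$-upper for all $i,j\in I$ with $i\le j$. Parallel runs: every nonempty $k$-upper run $R$ has a unique decomposition $R=R_1\circ\dots\circ R_r$ into nonempty $k$-upper runs obtained by repeatedly cutting off the shortest nonempty suffix that is $k$-upper (the empty run has $r=0$). Two $k$-upper runs $R=R_1\circ\dots\circ R_r$ and $S=S_1\circ\dots\circ S_s$ (so decomposed) are $(k,\phi)$-parallel if $r=s$, for each $i\in\{1,\dots,r\}$ we have $\phi(R_i)=\phi(S_i)$ and $\mathrm{top}^k(R_i(0))\cong\mathrm{top}^k(S_i(0))$, and $\mathrm{top}^k(R(|R|))\cong\mathrm{top}^k(S(|S|))$. *)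

(* Defs.v *)
From Stdlib Require List.
From mathcomp Require Import all_boot.

Set Implicit Arguments.
Unset Strict Implicit.
Unset Printing Implicit Defensive.

(* Stacks.  A 0-stack is [Leaf gamma x] with x = (x_n,...,x_1) a position   *)
(* (a list of n positive naturals, listed from x_n down to x_1; the j-th   *)
(* coordinate is the entry of 0-based index j-1).  A k-stack (k >= 1) is   *)
(* [Node l]; the top is the LAST element of l.  Validity is [kstack n k].   *)
Inductive stk (G : Type) : Type :=
| Leaf of G & seq nat
| Node of seq (stk G).
Arguments Node {G}.

Section Stacks.
Variable G : Type.
Variable n : nat.

Fixpoint leafpos (s : stk G) : seq (seq nat) :=
  match s with
  | Leaf _ x => [:: x]
  | Node l => flatten (map leafpos l)
  end.

Fixpoint posdown (s : stk G) : stk G :=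
  match s with
  | Leaf g _ => Leaf g [::]
  | Node l => Node (map posdown l)
  end.

Definition stk_cong (s t : stk G) : Prop := posdown s = posdown t.

Fixpoint mappos (f : seq nat -> seq nat) (s : stk G) : stk G :=
  match s with
  | Leaf g x => Leaf g (f x)
  | Node l => Node (map (mappos f) l)
  end.

Definition incr_at (i : nat) (x : seq nat) := set_nth 0 x i (nth 0 x i).+1.
Definition decr_at (i : nat) (x : seq nat) := set_nth 0 x i (nth 0 x i).-1.

Definition stk_nonempty (s : stk G) : Prop :=
  match s with Node [::] => False | _ => True end.

Fixpoint kstack (k : nat) (s : stk G) : Prop :=
  match k, s with
  | 0, Leaf _ x => size x = n /\ all (fun v => 0 < v) x
  | k'.+1, Node l =>
      (forall t, List.In t l -> kstack k' t /\ stk_nonempty t) /\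
      exists p : seq nat, size p = n - k'.+1 /\
        forall i, i < size l -> forall y, y \in leafpos (nth (Node [::]) l i) ->
          take (n - k'.+1) y = p /\ nth 0 y (n - k'.+1) = i.+1
  | _, _ => False
  end.

(* the topmost stack at depth d (d = r - k gives top^k of an r-stack) *)
Fixpoint topd (d : nat) (s : stk G) : stk G :=
  match d, s with
  | d'.+1, Node (t0 :: l) => topd d' (last t0 l)
  | _, _ => s
  end.

Fixpoint modtop (d : nat) (f : stk G -> option (stk G)) (s : stk G)
    : option (stk G) :=
  match d with
  | 0 => f s
  | d'.+1 =>
      match s with
      | Node (t0 :: l) =>
          omap (fun t => Node (rcons (belast t0 l) t)) (modtop d' f (last t0 l))
      | _ => None
      end
  end.

Definition topk (k : nat) (s : stk G) : stk G := topd (n - k) s.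

Definition topsym (s : stk G) : option G :=
  if topd n s is Leaf g _ then Some g else None.

Definition setsym (g : G) (s : stk G) : stk G :=
  match s with Leaf _ x => Leaf g x | _ => s end.

Definition pop (k : nat) (s : stk G) : option (stk G) :=
  modtop (n - k)
    (fun T => match T with
              | Node l => if 1 < size l then Some (Node (take (size l).-1 l))
                          else None
              | _ => None end) s.

(* push^k_gamma: append to the topmost k-stack a copy of its topmost
   (k-1)-stack whose topmost symbol is replaced by gamma, with p_{+1}
   applied (the (n-(k-1))-th coordinate, 0-based index n-k, is increased) *)
Definition push (k : nat) (g : G) (s : stk G) : option (stk G) :=
  modtop (n - k)
    (fun T => match T with
              | Node l =>
                  omap (fun c => Node (rcons l (mappos (incr_at (n - k)) c)))
                       (modtop k.-1 (fun t => Some (setsym g t)) (topd 1 T))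
              | _ => None end) s.

End Stacks.

Inductive sop (G : Type) : Type :=
| Pop of nat
| Push of nat & G.

Inductive trans (Q A G : Type) : Type :=
| Read of (A -> Q)
| Op of Q & sop G.

Definition dpda_wf (n : nat) (Q A G : Type) (delta : Q -> G -> trans Q A G) :=
  forall q g,
    match delta q g with
    | Read f => injective f
    | Op _ (Pop k) => 1 <= k <= n
    | Op _ (Push k _) => 1 <= k <= n
    end.

Section DPDA.
Variable n : nat.
Variables Q A G : finType.
Variable delta : Q -> G -> trans Q A G.

Definition config := (Q * stk G)%type.

Definition valid_config (c : config) : Prop :=
  kstack n n c.2 /\ stk_nonempty c.2.

Definition apply_op (o : sop G) (s : stk G) : option (stk G) :=
  match o with
  | Pop k => pop n k s
  | Push k g => push n k g s
  end.

Definition step (c c' : config) : Prop :=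
  match topsym n c.2 with
  | None => False
  | Some g =>
      match delta c.1 g with
      | Read f => (exists a, f a = c'.1) /\ c'.2 = c.2
      | Op q o => c'.1 = q /\ apply_op o c.2 = Some c'.2
      end
  end.

Definition lab (c c' : config) : option A :=
  match topsym n c.2 with
  | None => None
  | Some g =>
      match delta c.1 g with
      | Read f => [pick a | f a == c'.1]
      | Op _ _ => None
      end
  end.

Fixpoint steps (c : config) (R : seq config) : Prop :=
  match R with
  | [::] => True
  | c' :: R' => step c c' /\ steps c' R'
  end.

Definition is_run (R : seq config) : Prop :=
  (forall c, List.In c R -> valid_config c) /\
  match R with [::] => False | c :: R' => steps c R' end.

Definition rlast (R : seq config) : option config := ohead (rev R).

Definition rlen (R : seq config) : nat := (size R).-1.

Definition sub (R : seq config) (i j : nat) : seq config :=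
  take (j - i).+1 (drop i R).

Definition word (R : seq config) : seq A :=
  match R with [::] => [::] | c :: R' => pmap id (pairmap lab c R') end.

Definition histstep (c c' : config) (x : seq nat) : seq nat :=
  match topsym n c.2 with
  | None => x
  | Some g =>
      match delta c.1 g with
      | Op _ (Push r _) =>
          if x \in leafpos (topk n r.-1 c'.2) then decr_at (n - r) x else x
      | _ => x
      end
  end.

(* hist(R, s^0), with 0-stacks identified by their positions *)
Fixpoint hist (R : seq config) (x : seq nat) : seq nat :=
  match R with
  | c :: ((c' :: _) as R') => histstep c c' (hist R' x)
  | _ => x
  end.

(* R is k-upper: hist(R, top^k(R(|R|))) = top^k(R(0)), i.e. the histories of
   all 0-stacks of top^k(R(|R|)) lie in top^k(R(0)) *)
Definition upper (k : nat) (R : seq config) : Prop :=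
  match R with
  | [::] => True
  | c :: R' =>
      forall x, x \in leafpos (topk n k (last c R').2) ->
        hist R x \in leafpos (topk n k c.2)
  end.

Definition upper_pred (k : nat) (R : seq config) : Prop :=
  match k with 0 => False | k'.+1 => upper k' R end.

Definition milestone (star : A) (c : config) : Prop :=
  exists rho : nat -> config,
    rho 0 = c /\
    (forall i, valid_config (rho i)) /\
    (forall i, step (rho i) (rho i.+1)) /\
    (forall i, lab (rho i) (rho i.+1) = None \/ lab (rho i) (rho i.+1) = Some star) /\
    exists I : nat -> Prop,
      I 0 /\ (forall m, exists i, m <= i /\ I i) /\
      forall i j, I i -> I j -> i <= j ->
        upper 0 (mkseq (fun t => rho (i + t)) (j - i).+1).

Inductive kdecomp (k : nat) : seq config -> seq (seq config) -> Prop :=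
| kd_nil c : kdecomp k [:: c] [::]
| kd_snoc R i parts :
    i < rlen R ->
    upper k (sub R i (rlen R)) ->
    (forall j, i < j < rlen R -> ~ upper k (sub R j (rlen R))) ->
    kdecomp k (sub R 0 i) parts ->
    kdecomp k R (rcons parts (sub R i (rlen R))).

Definition parallel (M : Type) (phi : seq A -> M) (k : nat)
    (R S : seq config) : Prop :=
  upper k R /\ upper k S /\
  exists pR pS,
    kdecomp k R pR /\ kdecomp k S pS /\ size pR = size pS /\
    (forall i, i < size pR ->
       phi (word (nth [::] pR i)) = phi (word (nth [::] pS i)) /\
       omap (fun c : config => posdown (topk n k c.2)) (ohead (nth [::] pR i)) =
       omap (fun c : config => posdown (topk n k c.2)) (ohead (nth [::] pS i))) /\
    omap (fun c : config => posdown (topk n k c.2)) (rlast R) =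
    omap (fun c : config => posdown (topk n k c.2)) (rlast S).

End DPDA.

(* Main.v *)
(* Writing a stack s^n:...:s^1:g as the symbol g together with the list
   s^n,...,s^1, the machine becomes an environment machine without positions:
   a push stores a closure and a pop enters one.  Symbols carry labels that
   pushes copy, so the history of the topmost 0-stack is its label.  If the
   level k component is labelled k initially and g is labelled 0, a run is
   k-upper iff the final topmost label is at most k, and a run whose final label
   is r >= 1 splits into a "return" that exposes the original s^r and an r-upper
   run.  Returns have an inductive description which yields, by intersection
   types in the style of Parys, a finite set of types for k-stacks: every k-upper
   run, and its decomposition, can be simulated from a stack with the same
   topmost k-stack and the same types of the other components.

   For the milestone c, let rho be the infinite run and I the set of its
   milestone times.  For b, i in I consider what can be observed from rho(i) with
   respect to b: the value, the state and the types of the components n,...,x+1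
   whenever the x-stack that is at level x in rho(b) gets exposed.  Observations
   are finitely many, so there are b = p_0 < p_1 < ... < p_{n+1} in I such that
   the observations made at p_{a+1} with respect to p_a (and the value of
   rho[0,p_{a+1}]) recur infinitely often; pb(c) forces R to pass p_{n+1}.  The
   region x of rho(p_a) that contains the history of the end of R does not
   decrease with a, hence agrees for some p_a and p_{a+1}.  Since 0-upper runs put
   on the x-stack only elements of regions below x, R has to expose after p_{a+1}
   the x-stack of rho(p_a), and k <= x because R is not (k-1)-upper.  The same
   observation is possible from arbitrarily late points of rho, and the rest of
   R, R' can be simulated from there.  If rho reads only finitely many stars, no
   run reads more. *)

From Stdlib Require Import Classical ClassicalEpsilon.
From Stdlib Require List.
Require Import Defs.
From mathcomp Require Import all_boot zify.

Set Implicit Arguments.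
Unset Strict Implicit.
Unset Printing Implicit Defensive.

(* [Clo g l [:: s_k; ...; s_1]] is the nonempty k-stack s_k:...:s_1:g, whose
   topmost symbol [g] carries the label [l]; [Base] is an empty stack. *)
Inductive clo (G L : Type) : Type :=
| Base
| Clo of G & L & seq (clo G L).
Arguments Base {G L}.

Arguments Op {Q A G}.
Arguments Read {Q A G}.
Arguments Pop {G}.

(** * Labelled closures *)

Section CloInd.
Variables (G L : Type) (P : clo G L -> Prop).
Hypothesis PB : P Base.
Hypothesis PC : forall g l env, (forall i, P (nth Base env i)) -> P (Clo g l env).

(** The induction hypothesis ranges over all indices: beyond the end of [env] the default [Base] is
    covered by [PB], so no bounds have to be carried in later inductions. *)
Fixpoint clo_nested_ind (v : clo G L) : P v :=
  match v with
  | Base => PB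
  | Clo g l env =>
      PC g l
        ((fix go (e : seq (clo G L)) : forall i, P (nth Base e i) :=
            match e return forall i, P (nth Base e i) with
            | [::] => fun i => match i return P (nth Base [::] i) with
                               | 0 => PB | _.+1 => PB end
            | v :: e' => fun i => match i return P (nth Base (v :: e') i) with
                               | 0 => clo_nested_ind v
                               | i'.+1 => go e' i' end
            end) env)
  end.
End CloInd.

Fixpoint cmap (G L L' : Type) (f : L -> L') (v : clo G L) : clo G L' :=
  match v with
  | Base => Base
  | Clo g l env => Clo g (f l) (map (cmap f) env)
  end.

Definition erase (G L : Type) : clo G L -> clo G unit := cmap (fun=> tt).

Section CloTheory.
Variable G : Type.

Lemma nth_cmap L L' (f : L -> L') (env : seq (clo G L)) i :
  nth Base (map (cmap f) env) i = cmap f (nth Base env i).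
Proof.
case: (ltnP i (size env)) => h; first by rewrite (nth_map Base).
by rewrite !nth_default ?size_map.
Qed.

Lemma eq_env L (e e' : seq (clo G L)) :
  size e = size e' -> (forall i, nth Base e i = nth Base e' i) -> e = e'.
Proof. by move=> hs h; apply: (eq_from_nth (x0 := Base)) => // i _; exact: h. Qed.

Lemma cmap_comp L L' L'' (f : L -> L') (h : L' -> L'') (v : clo G L) :
  cmap h (cmap f v) = cmap (h \o f) v.
Proof.
elim/clo_nested_ind: v => //= g l env IH; congr Clo.
by apply: eq_env => [|i]; rewrite ?size_map // !nth_cmap IH.
Qed.

Lemma erase_cmap L L' (f : L -> L') (v : clo G L) : erase (cmap f v) = erase v.
Proof. exact: cmap_comp. Qed.

Lemma erase_id (v : clo G unit) : erase v = v.
Proof.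
elim/clo_nested_ind: v => //= g [] env IH; congr Clo.
by apply: eq_env => [|i]; rewrite ?size_map // nth_cmap; exact: IH.
Qed.

Lemma map_erase_id (e : seq (clo G unit)) : map (@erase G unit) e = e.
Proof. by rewrite -[RHS]map_id; apply: eq_map => v; rewrite erase_id. Qed.

(** Entry [i] of the environment of a k-stack is the component s_(k-i), hence the level [k - i]; out
    of range it is [Base], which is well formed at every level. *)
Inductive wfc L : nat -> clo G L -> Prop :=
| wfc_base k : wfc k Base
| wfc_clo k g l env :
    size env = k -> (forall i, wfc (k - i) (nth Base env i)) ->
    wfc k (Clo g l env).

Inductive allc L (P : L -> Prop) : clo G L -> Prop :=
| allc_base : allc P Base
| allc_clo g l env :
    P l -> (forall i, allc P (nth Base env i)) -> allc P (Clo g l env).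

Inductive crel L L' (S : L -> L' -> Prop) : clo G L -> clo G L' -> Prop :=
| crel_base : crel S Base Base
| crel_clo g l l' env env' :
    S l l' -> size env = size env' ->
    (forall i, crel S (nth Base env i) (nth Base env' i)) ->
    crel S (Clo g l env) (Clo g l' env').

Lemma wfc_cloE L k (v : clo G L) : wfc k v ->
  if v is Clo g l env then size env = k /\ forall i, wfc (k - i) (nth Base env i)
  else True.
Proof. by case. Qed.

Lemma allc_cloE L (P : L -> Prop) (v : clo G L) : allc P v ->
  if v is Clo g l env then P l /\ forall i, allc P (nth Base env i) else True.
Proof. by case. Qed.

Lemma crel_cloE L L' (S : L -> L' -> Prop) v w : crel S v w ->
  if v is Clo g l env then
    exists l' env', [/\ w = Clo g l' env', S l l', size env = size env' &
      forall i, crel S (nth Base env i) (nth Base env' i)]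
  else w = Base.
Proof. by case=> // g l l' env env' *; exists l', env'. Qed.

Lemma wfc_cmap L L' (f : L -> L') k (v : clo G L) : wfc k v -> wfc k (cmap f v).
Proof.
elim=> [j|j g l env hs _ IH]; first exact: wfc_base.
by apply: wfc_clo => [|i]; rewrite ?size_map // nth_cmap.
Qed.

Lemma wfc_cmap_inv L L' (f : L -> L') k (v : clo G L) :
  wfc k (cmap f v) -> wfc k v.
Proof.
elim/clo_nested_ind: v k => [|g l env IH] k /=; first by constructor.
move=> /wfc_cloE []; rewrite size_map => hs h; apply: wfc_clo => // i; apply: IH.
by move: (h i); rewrite nth_cmap.
Qed.

Lemma allc_imp L (P P' : L -> Prop) (v : clo G L) :
  (forall l, P l -> P' l) -> allc P v -> allc P' v.
Proof. by move=> hP; elim=> [|g l env /hP hl _ IH]; constructor. Qed.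

Lemma allc_const L L' (P : L' -> Prop) k (v : clo G L) :
  P k -> allc P (cmap (fun=> k) v).
Proof.
move=> hk; elim/clo_nested_ind: v => [|g l env IH] /=; constructor => // i.
by rewrite nth_cmap.
Qed.

Lemma crel_imp L L' (S S' : L -> L' -> Prop) v w :
  (forall a b, S a b -> S' a b) -> crel S v w -> crel S' v w.
Proof. by move=> hS; elim=> [|g l l' env env' /hS hl hs _ IH]; constructor. Qed.

Lemma crel_refl L (S : L -> L -> Prop) (P : L -> Prop) (v : clo G L) :
  (forall a, P a -> S a a) -> allc P v -> crel S v v.
Proof. by move=> hS; elim=> [|g l env /hS hl _ IH]; constructor. Qed.

Lemma crel_of_allc L L' (P : L -> Prop) (P' : L' -> Prop) v w :
  erase v = erase w -> allc P v -> allc P' w ->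
  crel (fun a b => P a /\ P' b) v w.
Proof.
elim/clo_nested_ind: v w => [|g l env IH] [|g' l' env'] //=; first by constructor.
rewrite /erase /=; case=> <- he /allc_cloE [hl hv] /allc_cloE [hl' hw].
have hs : size env = size env' by have := congr1 size he; rewrite !size_map.
constructor=> // i; apply: IH => //.
by have := congr1 ((nth Base)^~ i) he; rewrite !nth_cmap.
Qed.

Definition crels L L' (S : L -> L' -> Prop) (e : seq (clo G L)) e' :=
  size e = size e' /\ forall i, crel S (nth Base e i) (nth Base e' i).

Lemma crels_cat L L' (S : L -> L' -> Prop) e1 e1' e2 e2' :
  crels S e1 e1' -> crels S e2 e2' -> crels S (e1 ++ e2) (e1' ++ e2').
Proof.
move=> [s1 h1] [s2 h2]; split=> [|i]; first by rewrite !size_cat s1 s2.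
by rewrite !nth_cat s1; case: ifP.
Qed.

Lemma crels_cons L L' (S : L -> L' -> Prop) v v' e e' :
  crel S v v' -> crels S e e' -> crels S (v :: e) (v' :: e').
Proof. by move=> hv [s h]; split=> [|[|i]] //=; rewrite s. Qed.

Lemma nth_take_base L j (e : seq (clo G L)) i :
  nth Base (take j e) i = if i < j then nth Base e i else Base.
Proof.
case: ifP => h; first by rewrite nth_take.
by rewrite nth_default // size_take_min; lia.
Qed.

Lemma crels_take L L' (S : L -> L' -> Prop) j e e' :
  crels S e e' -> crels S (take j e) (take j e').
Proof.
move=> [s h]; split=> [|i]; first by rewrite !size_take_min s.
by rewrite !nth_take_base; case: ifP => // _; constructor.
Qed.

Lemma crels_drop L L' (S : L -> L' -> Prop) j e e' :
  crels S e e' -> crels S (drop j e) (drop j e').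
Proof.
move=> [s h]; split=> [|i]; first by rewrite !size_drop s.
by rewrite !nth_drop.
Qed.

Lemma crel_Clo L L' (S : L -> L' -> Prop) g l l' e e' :
  S l l' -> crels S e e' -> crel S (Clo g l e) (Clo g l' e').
Proof. by move=> hl [s h]; constructor. Qed.

End CloTheory.

(** * Finite lists as sets, power sets and products *)

Section Lists.

Fixpoint allP (X : Type) (P : X -> Prop) (l : seq X) : Prop :=
  if l is x :: l' then P x /\ allP P l' else True.

Section All2P.
Variables (X Y : Type) (P : X -> Y -> Prop).
Fixpoint all2P (l : seq X) (l' : seq Y) : Prop :=
  match l, l' with
  | [::], [::] => True
  | x :: l1, y :: l1' => P x y /\ all2P l1 l1'
  | _, _ => False
  end.

Lemma all2P_nth x0 y0 l l' : P x0 y0 ->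
  all2P l l' <-> size l = size l' /\ forall i, P (nth x0 l i) (nth y0 l' i).
Proof.
move=> h0; elim: l l' => [|x l IH] [|y l'] //=.
- by split=> // _; split=> // i; rewrite !nth_nil.
- by split=> // -[].
- by split=> // -[].
split=> [[hxy /IH [-> h]]|[[hs] h]]; first by split=> // -[|i] /=.
split; first exact: (h 0).
by apply/IH; split=> // i; exact: (h i.+1).
Qed.
End All2P.

Lemma allP_In (X : Type) (P : X -> Prop) (l : seq X) :
  allP P l <-> forall x, List.In x l -> P x.
Proof.
elim: l => [|x l IH] //=; split=> [[hx /IH h] y [<-|/h]|h] //.
by split; [apply: h; left|apply/IH=> y hy; apply: h; right].
Qed.

Lemma In_mem (T : eqType) (x : T) (s : seq T) : x \in s <-> List.In x s.
Proof.
elim: s => //= y s IH; rewrite inE; split.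
  by case/orP=> [/eqP ->|/IH]; [left|right].
by case=> [->|/IH ->]; rewrite ?eqxx ?orbT.
Qed.

(** Sublists suffice as subsets, because the sets counted later are empty or a [List.filter] of a
    fixed list. *)
Fixpoint powl (T : Type) (s : seq T) : seq (seq T) :=
  if s is x :: s' then map (cons x) (powl s') ++ powl s' else [:: [::]].

Lemma In_powl_nil (T : Type) (s : seq T) : List.In [::] (powl s).
Proof. by elim: s => [|x s IH] /=; [left|apply/List.in_app_iff; right]. Qed.

Lemma In_powl_filter (T : Type) (p : T -> bool) (s : seq T) :
  List.In (List.filter p s) (powl s).
Proof.
elim: s => [|x s IH] /=; first by left.
by apply/List.in_app_iff; case: (p x); [left; apply: List.in_map|right].
Qed.

Fixpoint prods (T : Type) (ls : seq (seq T)) : seq (seq T) :=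
  if ls is l :: ls' then
    List.flat_map (fun x => map (cons x) (prods ls')) l
  else [:: [::]].

Lemma In_prods (T : Type) (x0 : T) xs ls :
  size xs = size ls ->
  (forall i, i < size ls -> List.In (nth x0 xs i) (nth [::] ls i)) ->
  List.In xs (prods ls).
Proof.
elim: ls xs => [|l ls IH] [|x xs] //= hs h; first by left.
apply/List.in_flat_map; exists x; split; first exact: (h 0).
apply: List.in_map; apply: IH => [|i hi]; first lia.
exact: (h i.+1).
Qed.

Definition decb (P : Prop) : bool :=
  if excluded_middle_informative P then true else false.

Lemma decbP (P : Prop) : decb P <-> P.
Proof. by rewrite /decb; case: excluded_middle_informative. Qed.

End Lists.

(** * Encoding of stacks *)

Section Encoding.
Variable G : Type.
Implicit Types (s t : stk G) (l : seq (stk G)) (p x y : seq nat).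

(** The components of the nonempty k-stack acc : v are [acc] followed by those of [v], so appending
    an element at the top conses onto its environment. *)
Definition consf L (acc v : clo G L) : clo G L :=
  if v is Clo g x env then Clo g x (acc :: env) else v.

Fixpoint enc s : clo G (seq nat) :=
  match s with
  | Leaf g x => Clo g x [::]
  | Node l => foldl (@consf _) Base (map enc l)
  end.

Lemma enc_rcons l t : enc (Node (rcons l t)) = consf (enc (Node l)) (enc t).
Proof. by rewrite /= map_rcons foldl_rcons. Qed.

Lemma topd_rcons d l t : topd d.+1 (Node (rcons l t)) = topd d t.
Proof. by case: l => [|t0 l] //=; rewrite last_rcons. Qed.

Lemma modtop_rcons d f l t :
  modtop d.+1 f (Node (rcons l t)) = omap (fun t' => Node (rcons l t')) (modtop d f t).
Proof. by case: l => [|t0 l] //=; rewrite last_rcons belast_rcons. Qed.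

Lemma leafpos_rcons l t : leafpos (Node (rcons l t)) = leafpos (Node l) ++ leafpos t.
Proof. by rewrite /= map_rcons flatten_rcons. Qed.

Lemma mappos_rcons f l t :
  mappos f (Node (rcons l t)) = Node (rcons (map (mappos f) l) (mappos f t)).
Proof. by rewrite /= map_rcons. Qed.

(* A k-stack whose positions are the coordinates of its 0-stacks, below [p]. *)
Fixpoint canon (k : nat) (p : seq nat) (s : stk G) : Prop :=
  match k, s with
  | 0, Leaf _ x => x = p
  | k'.+1, Node l => forall i, i < size l ->
      canon k' (rcons p i.+1) (nth (Node [::]) l i) /\
      stk_nonempty (nth (Node [::]) l i)
  | _, _ => False
  end.

Lemma canon_rcons k p l t : canon k.+1 p (Node (rcons l t)) <->
  [/\ canon k.+1 p (Node l), canon k (rcons p (size l).+1) t & stk_nonempty t].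
Proof.
split=> [h|[h1 h2 h3] i].
  split=> [i hi||].
  - have := h i; rewrite size_rcons nth_rcons hi; apply; lia.
  - have := h (size l); rewrite size_rcons nth_rcons ltnn eqxx; case=> //; lia.
  - have := h (size l); rewrite size_rcons nth_rcons ltnn eqxx; case=> //; lia.
rewrite size_rcons nth_rcons => hi; case: ltngtP => hil; [exact: h1|lia|].
by rewrite hil.
Qed.

Lemma canonS k p s : canon k.+1 p s -> stk_nonempty s ->
  exists l t, [/\ s = Node (rcons l t), canon k.+1 p (Node l),
    canon k (rcons p (size l).+1) t & stk_nonempty t].
Proof.
case: s => // l; case/lastP: l => // l t h _.
by exists l, t; have [] := proj1 (canon_rcons _ _ _ _) h.
Qed.

Fixpoint clabels L (v : clo G L) : seq L :=
  if v is Clo _ x env then rcons (flatten (map (@clabels L) env)) x else [::].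

Lemma In_flatten_nth (T : Type) (ss : seq (seq T)) (y : T) :
  List.In y (flatten ss) <-> exists i, List.In y (nth [::] ss i).
Proof.
elim: ss => [|s ss IH] /=; first by split=> // -[i]; rewrite nth_nil.
split=> [/List.in_app_iff [h|/IH [i h]]|[[|i] h]].
- by exists 0.
- by exists i.+1.
- by apply/List.in_app_iff; left.
- by apply/List.in_app_iff; right; apply/IH; exists i.
Qed.

Lemma allc_clabels L (P : L -> Prop) (v : clo G L) :
  allc P v <-> forall y : L, List.In y (clabels v) -> P y.
Proof.
have hn (env : seq (clo G L)) i :
    nth [::] [seq clabels j | j <- env] i = clabels (nth Base env i).
  case: (ltnP i (size env)) => h; first by rewrite (nth_map Base).
  by rewrite !nth_default ?size_map.
elim/clo_nested_ind: v => [|g x env IH] /=; first by split=> // _; constructor.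
rewrite -cats1; split=> [/allc_cloE [hx he] y /List.in_app_iff [|[<-|//]] //|h].
  by case/In_flatten_nth=> i; rewrite hn; exact: (proj1 (IH i) (he i)).
constructor; first by apply: h; apply/List.in_app_iff; right; left.
move=> i; apply/IH => y hy; apply: h; apply/List.in_app_iff; left.
by apply/In_flatten_nth; exists i; rewrite hn.
Qed.

Lemma enc_Clo k p s : canon k p s -> stk_nonempty s ->
  exists g x env, enc s = Clo g x env /\ size env = k.
Proof.
elim: k p s => [|k IH] p s; first by case: s => // g x _ _; exists g, x, [::].
move=> h hs; have [l [t [-> hl ht htn]]] := canonS h hs.
have [g [x [env [E Es]]]] := IH _ _ ht htn.
by exists g, x, (enc (Node l) :: env); rewrite enc_rcons E /= Es.
Qed.

Lemma leafpos_enc k p s : canon k p s -> leafpos s = clabels (enc s).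
Proof.
elim: k p s => [|k IH] p [g x|l] //=; rewrite -?/(canon k.+1 p (Node l)).
elim/last_ind: l => // l t IHl /canon_rcons [hl ht htn].
have [g [x [env [E _]]]] := enc_Clo ht htn.
move: (IHl hl) (IH _ _ ht) => h1 h2.
have := leafpos_rcons l t; rewrite /= => ->.
by rewrite -/(enc (Node (rcons l t))) enc_rcons h2 h1 E /= rcons_cat.
Qed.

Lemma canon_leaf k p s y : canon k p s -> y \in leafpos s ->
  take (size p) y = p /\ size y = size p + k.
Proof.
elim: k p s => [|k IH] p [g x|l] // h.
  by rewrite inE => /eqP ->; rewrite h take_size addn0.
elim/last_ind: l h => // l t IHl /canon_rcons [hl ht _].
rewrite leafpos_rcons mem_cat => /orP [|/(IH _ _ ht)]; first exact: IHl.
rewrite size_rcons => -[h1 h2]; split; last lia.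
have : take (size p) (take (size p).+1 y) = take (size p) (rcons p (size l).+1).
  by rewrite h1.
by rewrite take_takel // -cats1 takel_cat // take_size.
Qed.

Lemma canon_leaf_coord k p l y : canon k.+1 p (Node l) -> y \in leafpos (Node l) ->
  nth 0 y (size p) <= size l.
Proof.
elim/last_ind: l => // l t IHl /canon_rcons [hl ht _].
rewrite leafpos_rcons mem_cat => /orP [/(IHl hl)|/(canon_leaf ht)].
  by rewrite size_rcons; lia.
rewrite size_rcons => -[h _].
have : nth 0 (take (size p).+1 y) (size p) = (size l).+1 by rewrite h nth_rcons ltnn eqxx.
by rewrite nth_take // => ->; rewrite ?size_rcons.
Qed.

(** Where a 0-stack of the component at index [i] sits relative to the topmost position [x]: the
    first difference is at coordinate [i], and it is smaller there. This recovers the level of a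
    component from positions alone. *)
Definition below (x : seq nat) (i : nat) (y : seq nat) : Prop :=
  take i y = take i x /\ nth 0 y i < nth 0 x i.

Lemma enc_below k p s g x env : canon k p s -> enc s = Clo g x env ->
  [/\ wfc k (enc s), take (size p) x = p, size x = size p + k &
      forall i, allc (below x (size p + i)) (nth Base env i)].
Proof.
move=> + E.
have hmem : x \in leafpos s \/ ~ canon k p s.
  case: (classic (canon k p s)) => h; [left|by right].
  by apply/In_mem; rewrite (leafpos_enc h) E /= -cats1; apply/List.in_app_iff; right; left.
case: hmem => // hmem h; have [h1 h2] := canon_leaf h hmem.
split=> //.
  elim: k p s {E hmem h1 h2 g x env} h => [|k IH] p [g x|l] // h.
    by constructor=> // i; rewrite nth_nil; constructor.
  elim/last_ind: l h => [|l t IHl] h; first by constructor.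
  have [hl ht htn] := proj1 (canon_rcons _ _ _ _) h.
  have [g [x [env [E Es]]]] := enc_Clo ht htn.
  rewrite enc_rcons; move: (IH _ _ ht) (IHl hl); rewrite E => /wfc_cloE [_ hw] hwl.
  by constructor=> [|[|i]] //=; [rewrite Es|exact: hw].
elim: k p s g x env h E {hmem h1} h2 => [|k IH] p s g x env h E hx i.
  by case: s h E => // g' x' _ [_ _ <-]; rewrite nth_nil; constructor.
have hne : stk_nonempty s by case: s h E => // -[].
have [l [t [es hl ht htn]]] := canonS h hne; subst s.
have [g' [x' [env' [Et _]]]] := enc_Clo ht htn.
move: E; rewrite enc_rcons Et /= => -[? ? ?]; subst g' x' env.
case: i => [|i] /=; last first.
  rewrite addnS -addSn -[(size p).+1](size_rcons p (size l).+1).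
  by apply: (IH _ _ _ _ _ ht Et); rewrite size_rcons hx; lia.
apply/allc_clabels => y; rewrite -/(enc (Node l)) -(leafpos_enc hl) => /In_mem hy.
have [hy1 _] := canon_leaf hl hy; have hy2 := canon_leaf_coord hl hy.
have hxt : x \in leafpos t.
  by apply/In_mem; rewrite (leafpos_enc ht) Et /= -cats1; apply/List.in_app_iff; right; left.
have [hx1 _] := canon_leaf ht hxt; rewrite size_rcons in hx1.
rewrite /below addn0 hy1; split.
  by rewrite -(take_takel x (leqnSn (size p))) hx1 -cats1 takel_cat // take_size.
have : nth 0 (take (size p).+1 x) (size p) = (size l).+1 by rewrite hx1 nth_rcons ltnn eqxx.
by rewrite nth_take // => ->.
Qed.

Lemma enc_topd k d p s g x env : canon k p s -> enc s = Clo g x env -> d <= k ->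
  enc (topd d s) = Clo g x (drop d env) /\
  exists p', [/\ size p' = size p + d, canon (k - d) p' (topd d s) & stk_nonempty (topd d s)].
Proof.
have hne s' g' x' e' : enc s' = Clo g' x' e' -> stk_nonempty s' by case: s' => // -[].
elim: d k p s g x env => [|d IH] k p s g x env h E hd.
  rewrite drop0 subn0; case: s h E => [g1 x1|[|t1 l1]] h E; split=> //; by exists p; rewrite addn0.
case: k h hd => // k h hd.
have [l [t [es hl ht htn]]] := canonS h (hne _ _ _ _ E); subst s.
have [g' [x' [env' [Et _]]]] := enc_Clo ht htn.
move: E; rewrite enc_rcons Et /= => -[? ? ?]; subst g' x' env.
have [h1 [p' [h2 h3 h4]]] := IH _ _ _ _ _ _ ht Et hd.
rewrite -/(topd d.+1 (Node (rcons l t))) topd_rcons subSS; split=> //.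
by exists p'; split=> //; rewrite h2 size_rcons addnS.
Qed.

Definition popf (T : stk G) : option (stk G) :=
  match T with
  | Node l => if 1 < size l then Some (Node (take (size l).-1 l)) else None
  | _ => None end.

(** Removing the topmost element of the topmost (k+1)-stack leaves the component at index [d], whose
    own top becomes the top of the whole stack: a pop enters a stored closure. If that component is
    [Base], nothing would remain, and this is the case where the pop is undefined. *)
Lemma modtop_pop d k p s g x env : canon (d + k.+1) p s -> enc s = Clo g x env ->
  match modtop d popf s, nth Base env d with
  | Some s', Clo g' x' env' =>
      [/\ canon (d + k.+1) p s', stk_nonempty s' &
          enc s' = Clo g' x' (take d env ++ env')]
  | None, Base => True
  | _, _ => False
  end.
Proof.
have hne s' g' x' e' : enc s' = Clo g' x' e' -> stk_nonempty s' by case: s' => // -[].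
elim: d p s g x env => [|d IH] p s g x env h E.
all: have [l [t [es hl ht htn]]] := canonS h (hne _ _ _ _ E); subst s;
  have [g' [x' [env' [Et _]]]] := enc_Clo ht htn;
  move: E; rewrite enc_rcons Et /= => -[? ? ?]; subst g' x' env.
  rewrite size_rcons /= -cats1 take_size_cat // ltnS -/(enc (Node l)).
  case: l hl {h ht} => [|t0 l0] hl //=.
  have hl0 : stk_nonempty (Node (t0 :: l0)) by [].
  have [g1 [x1 [env1 [E1 _]]]] := enc_Clo hl hl0.
  by move: E1 => /= ->.
have := IH _ _ _ _ _ ht Et; rewrite -/(modtop d.+1 popf (Node (rcons l t))) modtop_rcons.
case: (modtop d popf t) => [t'|] /=; case: (nth Base env' d) => // g1 x1 env1.
case=> h1 h2 h3; split=> //; first by apply/canon_rcons.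
  by case: (l).
by rewrite -/(enc (Node (rcons l t'))) enc_rcons h3.
Qed.

Lemma modtop_setsym k p t g x env g' : canon k p t -> enc t = Clo g x env ->
  exists t', [/\ modtop k (fun t => Some (setsym g' t)) t = Some t', canon k p t',
    stk_nonempty t' & enc t' = Clo g' x env].
Proof.
have hne s' g1 x' e' : enc s' = Clo g1 x' e' -> stk_nonempty s' by case: s' => // -[].
elim: k p t g x env => [|k IH] p s g x env h E.
  case: s h E => // g1 x1 -> [_ -> <-]; by exists (Leaf g' x).
have [l [t [es hl ht htn]]] := canonS h (hne _ _ _ _ E); subst s.
have [g1 [x1 [env' [Et _]]]] := enc_Clo ht htn.
move: E; rewrite enc_rcons Et /= => -[? ? ?]; subst g1 x1 env.
have [t' [h1 h2 h3 h4]] := IH _ _ _ _ _ ht Et.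
exists (Node (rcons l t')); split.
- by rewrite -/(modtop k.+1 _ (Node (rcons l t))) modtop_rcons h1.
- by apply/canon_rcons.
- by case: (l).
- by rewrite enc_rcons h4.
Qed.

Lemma incr_at_rcons m p j : m < size p -> incr_at m (rcons p j) = rcons (incr_at m p) j.
Proof.
move=> h; rewrite /incr_at nth_rcons h; elim: p m h => // a p IH [|m] //= h.
by rewrite IH.
Qed.

Lemma incr_at_last p j : incr_at (size p) (rcons p j) = rcons p j.+1.
Proof.
rewrite /incr_at nth_rcons ltnn eqxx.
by elim: p => //= a p ->.
Qed.

Lemma decr_incr m x : m < size x -> decr_at m (incr_at m x) = x.
Proof.
move=> h; rewrite /decr_at /incr_at nth_set_nth /= eqxx /=.
by elim: x m h => // a x IH [|m] //= h; rewrite IH.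
Qed.

Lemma canon_mappos k m p t : m < size p -> canon k p t ->
  canon k (incr_at m p) (mappos (incr_at m) t).
Proof.
elim: k p t => [|k IH] p [g x|l] hm //; first by move=> /= ->.
elim/last_ind: l => // l t IHl /canon_rcons [hl ht htn].
rewrite mappos_rcons; apply/canon_rcons; split; first exact: IHl.
  rewrite size_map -incr_at_rcons //; apply: IH => //.
  by rewrite size_rcons; lia.
by case: (t) htn => // -[].
Qed.

Lemma enc_mappos k f p s : canon k p s -> enc (mappos f s) = cmap f (enc s).
Proof.
elim: k p s => [|k IH] p [g x|l] //.
elim/last_ind: l => // l t IHl /canon_rcons [hl ht htn].
rewrite mappos_rcons !enc_rcons (IH _ _ ht) -/(mappos f (Node l)) (IHl hl).
by case: (enc t).
Qed.

(** The local action of [push]. The coordinate [m] is a separate argument since it stays fixed while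
    the induction on the depth descends. *)
Definition pushf (m k : nat) (g : G) (T : stk G) : option (stk G) :=
  match T with
  | Node l => omap (fun c => Node (rcons l (mappos (incr_at m) c)))
                (modtop k.-1 (fun t => Some (setsym g t)) (topd 1 T))
  | _ => None end.

(** The push stores the old topmost (k+1)-stack as a closure at index [d]; the copy above it keeps
    the components of lower level, with coordinate [size p + d] increased. *)
Lemma modtop_push d k p s g x env g' : canon (d + k.+1) p s -> enc s = Clo g x env ->
  exists s', [/\ modtop d (pushf (size p + d) k.+1 g') s = Some s',
    canon (d + k.+1) p s', stk_nonempty s' &
    enc s' = Clo g' (incr_at (size p + d) x)
      (take d env ++ Clo g x (drop d env) ::
       map (cmap (incr_at (size p + d))) (drop d.+1 env))].
Proof.
have hne s' g1 x' e' : enc s' = Clo g1 x' e' -> stk_nonempty s' by case: s' => // -[].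
elim: d p s g x env => [|d IH] p s g x env h E.
all: have [l [t [es hl ht htn]]] := canonS h (hne _ _ _ _ E); subst s;
  have [g1 [x1 [env' [Et _]]]] := enc_Clo ht htn;
  have E0 := E; move: E; rewrite enc_rcons Et => -[? ? ?]; subst g1 x1 env.
  have [t' [h1 h2 h3 h4]] := modtop_setsym g' ht Et.
  rewrite addn0; exists (Node (rcons (rcons l t) (mappos (incr_at (size p)) t'))); split.
  - by rewrite /modtop /pushf topd_rcons [k.+1.-1]/= h1.
  - apply/canon_rcons; split=> //.
      rewrite size_rcons -incr_at_last; apply: canon_mappos h2.
      by rewrite size_rcons.
    by case: (t') h3 => // -[].
  - by case: (rcons l t).
  - by rewrite enc_rcons E0 (enc_mappos _ h2) h4 /= drop0.
have [t' [h1 h2 h3 h4]] := IH _ _ _ _ _ ht Et.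
rewrite size_rcons addSnnS in h1 h4.
exists (Node (rcons l t')); split.
- by rewrite modtop_rcons h1.
- by apply/canon_rcons.
- by case: (l).
- by rewrite enc_rcons h4.
Qed.

Lemma posdown_enc k p p' s s' : canon k p s -> canon k p' s' ->
  erase (enc s) = erase (enc s') -> posdown s = posdown s'.
Proof.
elim: k p p' s s' => [|k IH] p p' [g x|l] [g' x'|l'] //.
  by move=> _ _ [->].
elim/last_ind: l l' => [|l t IHl] l'; case/lastP: l' => [|l' t'] //.
- move=> _ /canon_rcons [_ ht htn]; have [g1 [x1 [env1 [E1 _]]]] := enc_Clo ht htn.
  by rewrite enc_rcons E1.
- move=> /canon_rcons [_ ht htn] _; have [g1 [x1 [env1 [E1 _]]]] := enc_Clo ht htn.
  by rewrite enc_rcons E1.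
move=> /canon_rcons [hl ht htn] /canon_rcons [hl' ht' htn'].
have [g1 [x1 [env1 [E1 _]]]] := enc_Clo ht htn.
have [g2 [x2 [env2 [E2 _]]]] := enc_Clo ht' htn'.
rewrite !enc_rcons E1 E2 /erase /= => -[hg hl0 he].
rewrite map_rcons map_rcons; congr (Node (rcons _ _)).
  by have [] := IHl _ hl hl' hl0.
by apply: IH ht ht' _; rewrite E1 E2 /erase /= hg he.
Qed.

End Encoding.

(** * Validity in terms of canonical coordinates *)

Section Validity.
Variables (G : Type) (n : nat).
Implicit Types (s t : stk G).

Lemma In_nth_stk (l : seq (stk G)) t : List.In t l ->
  exists2 i, i < size l & nth (Node [::]) l i = t.
Proof.
elim: l => //= a l IH [->|/IH [i h1 h2]]; first by exists 0.
by exists i.+1.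
Qed.

Lemma nth_In_stk (l : seq (stk G)) i : i < size l -> List.In (nth (Node [::]) l i) l.
Proof. by elim: l i => // a l IH [|i] /= h; [left|right; exact: IH]. Qed.

Lemma leafpos_nth (l : seq (stk G)) y :
  y \in leafpos (Node l) <->
  exists2 i, i < size l & y \in leafpos (nth (Node [::]) l i).
Proof.
split=> [/flattenP [ys /(nthP [::]) [i]]|[i hi hy]].
  rewrite size_map => hi; rewrite (nth_map (Node [::])) // => <- hy.
  by exists i.
apply/flattenP; exists (leafpos (nth (Node [::]) l i)) => //.
by apply/(nthP [::]); exists i; rewrite ?size_map // (nth_map (Node [::])).
Qed.

Lemma canon_kstack k p s : k <= n -> size p = n - k -> all (fun v => 0 < v) p ->
  canon k p s -> kstack n k s.
Proof.
elim: k p s => [|k IH] p [g x|l] hk hp hpos //.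
  by move=> /= ->; rewrite hp subn0.
move=> h; split=> [t /In_nth_stk [i hi <-]|].
  have [h1 h2] := h i hi; split=> //; apply: IH h1; rewrite ?size_rcons ?all_rcons; lia.
exists p; split=> // i hi y hy; have [h1 _] := h i hi.
have [h2 _] := canon_leaf h1 hy; rewrite size_rcons in h2.
rewrite -hp; split.
  by rewrite -(take_takel y (leqnSn (size p))) h2 -cats1 takel_cat // take_size.
have : nth 0 (take (size p).+1 y) (size p) = i.+1 by rewrite h2 nth_rcons ltnn eqxx.
by rewrite nth_take.
Qed.

Lemma kstack_size k s y : kstack n k s -> y \in leafpos s -> size y = n.
Proof.
elim: k s => [|k IH] [g x|l] // h; first by rewrite inE => /eqP ->; case: h.
case/leafpos_nth=> i hi; have [h1 _] := proj1 h _ (nth_In_stk hi).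
exact: IH.
Qed.

Lemma kstack_canon k p s : k <= n -> size p = n - k -> kstack n k s ->
  (forall y, y \in leafpos s -> take (n - k) y = p) -> canon k p s.
Proof.
elim: k p s => [|k IH] p [g x|l] hk hp // h hy.
  have := hy x; rewrite inE eqxx => /(_ isT) <-; case: h => hs _.
  by rewrite /= take_oversize //; lia.
move=> i hi; have [h1 h2] := proj1 h _ (nth_In_stk hi); split=> //.
have [p' [_ hp']] := proj2 h.
apply: IH => //; first lia.
  by rewrite size_rcons; lia.
move=> y hyi; have hys : y \in leafpos (Node l) by apply/leafpos_nth; exists i.
have hsz := kstack_size h1 hyi.
rewrite (_ : n - k = (n - k.+1).+1); last lia.
rewrite (take_nth 0) ?hsz; last lia.
by rewrite (hy _ hys) (proj2 (hp' i hi y hyi)).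
Qed.

Lemma valid_canon s : kstack n n s <-> canon n [::] s.
Proof.
split=> h; last by apply: canon_kstack h; rewrite ?subnn.
by apply: kstack_canon => //; rewrite subnn // => y _; rewrite take0.
Qed.

End Validity.

(** * Pigeonhole principles *)

(** Induction on the list of values: if its head is not taken infinitely often, restricting [I] to
    late indices removes it from the possible values. *)
Lemma recurrent_value (T : Type) (F : nat -> T) (l : seq T) (I : nat -> Prop) p :
  (forall i, I i -> List.In (F i) l) -> (forall m, exists i, m <= i /\ I i) ->
  exists i, [/\ p <= i, I i & forall m, exists j, [/\ m <= j, I j & F j = F i]].
Proof.
move=> hl hI.
suff [t ht] : exists t, forall m, exists j, [/\ m <= j, I j & F j = t].
  have [i [h1 h2 h3]] := ht p; exists i; split=> // m.
  by rewrite h3; exact: ht.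
elim: l I hl hI => [|t l IH] I hl hI; first by have [i [_ /hl]] := hI 0.
case: (classic (forall m, exists j, [/\ m <= j, I j & F j = t])) => [h|]; first by exists t.
move=> /not_all_ex_not [m0 hm0].
have [||t' ht'] := IH (fun i => I i /\ m0 <= i).
- move=> i [/[dup] hi /hl /= [ht|//] hmi]; case: hm0; exists i; split=> //.
- move=> m; have [i [h1 h2]] := hI (maxn m m0).
  by exists i; split; [|split=> //]; lia.
exists t' => m; have [j [h1 [h2 _] h3]] := ht' m.
by exists j.
Qed.

Lemma nondecreasing_repeats (z : nat -> nat) m : z m.+1 <= m ->
  (forall a, a <= m -> z a <= z a.+1) -> exists2 a, a <= m & z a = z a.+1.
Proof.
move=> hz hmono; apply: NNPP => hno.
suff h a : a <= m.+1 -> a <= z a by have := h _ (leqnn _); lia.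
elim: a => // a IH ha; have h1 := hmono a ltac:(lia); have h2 := IH ltac:(lia).
have h3 : z a <> z a.+1 by move=> h; apply: hno; exists a.
lia.
Qed.

(** * The environment machine *)

Section Machine.
Variable n : nat.
Variables Q A G : finType.
Variable delta : Q -> G -> trans Q A G.
Hypothesis wf_delta : dpda_wf n delta.

Section Exec.
Variable L : Type.
Implicit Types (v w : clo G L) (env : seq (clo G L)) (st : Q * clo G L).

Definition epop (k : nat) v : option (clo G L) :=
  if v is Clo g l env then
    if nth Base env (n - k) is Clo g' l' env' then
      Some (Clo g' l' (take (n - k) env ++ env'))
    else None
  else None.

Definition pushenv (k : nat) (g : G) (l : L) env :=
  take (n - k) env ++ Clo g l (drop (n - k) env) :: drop (n - k).+1 env.

Definition epush (k : nat) (g' : G) v : option (clo G L) :=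
  if v is Clo g l env then Some (Clo g' l (pushenv k g l env)) else None.

Definition eop (o : sop G) v :=
  match o with Pop k => epop k v | Push k g => epush k g v end.

(** A choice is [Some a] for reading [a] and [None] for a stack operation, so a start and a list of
    choices determine a run, and the letters in the list form its word. *)
Definition estep (st : Q * clo G L) (a : option A) : option (Q * clo G L) :=
  if st.2 is Clo g _ _ then
    match delta st.1 g, a with
    | Read f, Some a => Some (f a, st.2)
    | Op q o, None => omap (pair q) (eop o st.2)
    | _, _ => None
    end
  else None.

Fixpoint exec st (cs : seq (option A)) : option (Q * clo G L) :=
  if cs is a :: cs' then obind (exec^~ cs') (estep st a) else Some st.

Lemma exec_cat st cs1 cs2 :
  exec st (cs1 ++ cs2) = obind (exec^~ cs2) (exec st cs1).
Proof. by elim: cs1 st => //= a cs IH st; case: (estep st a) => //=. Qed.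

End Exec.

(** Transitions inspect only the state and the topmost symbol, and operations copy or discard labels
    without creating any, so every relation between labels is carried along. *)
Lemma estep_crel L L' (S : L -> L' -> Prop) q v w a q' v' :
  crel S v w -> estep (q, v) a = Some (q', v') ->
  exists2 w', estep (q, w) a = Some (q', w') & crel S v' w'.
Proof.
case: v => [|g l env] //= /[dup] hvw /crel_cloE [l' [env' [E hl hs he]]]; subst w.
rewrite /estep /=; case: (delta q g) => [f|q1 o]; case: a => [a|] //.
  by case=> <- <-; exists (Clo g l' env').
have hE : crels S env env' by [].
case: o => [k|k g1] /=.
  move: (he (n - k)); case: (nth Base env (n - k)) => [|g2 l2 e2] //.
  case/crel_cloE=> [l2' [e2' [-> h2 hs2 he2]]] /= [<- <-].
  eexists; first by [].
  by apply: crel_Clo => //; apply: crels_cat => //; exact: crels_take.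
case=> <- <-; eexists; first by [].
apply: crel_Clo => //; apply: crels_cat; first exact: crels_take.
apply: crels_cons; last exact: crels_drop.
by apply: crel_Clo => //; exact: crels_drop.
Qed.

Lemma nth_takecat L j (env e : seq (clo G L)) i : j <= size env ->
  nth Base (take j env ++ e) i =
  if i < j then nth Base env i else nth Base e (i - j).
Proof.
move=> h; rewrite nth_cat size_takel // nth_take_base.
by case: ifP => // ->.
Qed.

Lemma nth_pushenv L k g l (env : seq (clo G L)) i :
  size env = n -> 1 <= k <= n ->
  nth Base (pushenv k g l env) i =
  if i == n - k then Clo g l (drop (n - k) env) else nth Base env i.
Proof.
move=> hs hk; rewrite nth_takecat; last lia.
case: ltngtP => h //=; last by rewrite h subnn.
case hi : (i - (n - k)) => [|j] /=; first lia.
by rewrite nth_drop; congr nth; lia.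
Qed.

Lemma size_pushenv L k g l (env : seq (clo G L)) :
  size env = n -> 1 <= k <= n -> size (pushenv k g l env) = n.
Proof. by move=> hs hk; rewrite size_cat /= size_takel ?size_drop; lia. Qed.

Lemma exec_crel L L' (S : L -> L' -> Prop) cs q v w q' v' :
  crel S v w -> exec (q, v) cs = Some (q', v') ->
  exists2 w', exec (q, w) cs = Some (q', w') & crel S v' w'.
Proof.
elim: cs q v w => [|a cs IH] q v w h /=.
  by case=> <- <-; exists w.
case E : estep => [[q1 v1]|] //= H.
have [w1 -> h1 /=] := estep_crel h E; exact: IH H.
Qed.

Lemma estep_cmap L L' (f : L -> L') q v a :
  estep (q, cmap f v) a = omap (fun st => (st.1, cmap f st.2)) (estep (q, v) a).
Proof.
case: v => [|g l env] //=; rewrite /estep /=.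
case: (delta q g) => [h|q1 o]; case: a => [a|] //.
case: o => [k|k g1] //=.
  rewrite nth_cmap; case: (nth _ _ _) => [|g2 l2 e2] //=.
  by rewrite map_cat map_take.
by rewrite /pushenv map_cat map_take /= !map_drop.
Qed.

Lemma exec_cmap L L' (f : L -> L') cs q v :
  exec (q, cmap f v) cs = omap (fun st => (st.1, cmap f st.2)) (exec (q, v) cs).
Proof.
elim: cs q v => [|a cs IH] q v //=.
by rewrite estep_cmap; case: estep => [[q1 v1]|] //=.
Qed.

Lemma op_order q g q' o : delta q g = Op q' o ->
  match o with Pop k => 1 <= k <= n | Push k _ => 1 <= k <= n end.
Proof. by move=> h; have := wf_delta q g; rewrite h; case: o h. Qed.

Lemma estep_wf L q (v : clo G L) a q' v' :
  wfc n v -> estep (q, v) a = Some (q', v') -> wfc n v'.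
Proof.
case: v => [|g l env] //= /[dup] hv /wfc_cloE [hs he]; rewrite /estep /=.
case E : (delta q g) => [f|q1 o]; case: a => [a|] //; first by case=> _ <-.
case: o E => [k|k g1] /op_order hk /=.
  move: (he (n - k)); case: (nth Base env (n - k)) => [|g2 l2 e2] //.
  case/wfc_cloE=> [hs2 he2] /= [_ <-]; constructor.
    by rewrite size_cat size_takel ?hs ?hs2; lia.
  move=> i; rewrite nth_takecat ?hs; last lia.
  case: ifP => h //; move: (he2 (i - (n - k))); congr wfc; lia.
case=> _ <-; constructor; first by rewrite size_pushenv.
move=> i; rewrite nth_pushenv //; case: eqP => [->|_] //.
constructor; first by rewrite size_drop hs.
by move=> j; rewrite nth_drop; move: (he (n - k + j)); congr wfc; lia.
Qed.

Lemma exec_wf L cs q (v : clo G L) q' v' :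
  wfc n v -> exec (q, v) cs = Some (q', v') -> wfc n v'.
Proof.
elim: cs q v => [|a cs IH] q v h /=; first by case=> _ <-.
case E : estep => [[q1 v1]|] //=; apply: IH; exact: estep_wf E.
Qed.

Lemma estep_allc L (P : L -> Prop) q v a q' v' :
  allc P v -> estep (q, v) a = Some (q', v') -> allc P v'.
Proof.
case: v => [|g l env] //= /[dup] hv /allc_cloE [hl he]; rewrite /estep /=.
case: (delta q g) => [f|q1 o]; case: a => [a|] //; first by case=> _ <-.
case: o => [k|k g1] /=.
  move: (he (n - k)); case: (nth Base env (n - k)) => [|g2 l2 e2] //.
  case/allc_cloE=> [hl2 he2] /= [_ <-]; constructor=> // i.
  rewrite nth_cat nth_take_base; case: ifP => // _; case: ifP => // _; constructor.
case=> _ <-; constructor=> // i.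
rewrite nth_cat nth_take_base; case: ifP => [_|_].
  by case: ifP => // _; constructor.
case: (i - _) => [|j] /=; last by rewrite nth_drop.
by constructor=> // j; rewrite nth_drop.
Qed.

Lemma exec_allc L (P : L -> Prop) cs q v q' v' :
  allc P v -> exec (q, v) cs = Some (q', v') -> allc P v'.
Proof.
elim: cs q v => [|a cs IH] q v h /=; first by case=> _ <-.
case E : estep => [[q1 v1]|] //=; apply: IH; exact: estep_allc E.
Qed.

(* [renv] and [ereg] label the components by their levels and the topmost symbol
   by 0; after a run of the relabelled machine, the label [lev] of the topmost
   symbol is the least k for which the run is k-upper. *)
Definition renv L (env : seq (clo G L)) : seq (clo G nat) :=
  mkseq (fun i => cmap (fun=> n - i) (nth Base env i)) (size env).

Definition ereg L (v : clo G L) : clo G nat :=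
  if v is Clo g l env then Clo g 0 (renv env) else Base.

Definition toplab (v : clo G nat) : nat := if v is Clo _ l _ then l else 0.

Definition lev (st : Q * clo G unit) cs : nat :=
  if exec (st.1, ereg st.2) cs is Some st' then toplab st'.2 else 0.

Lemma size_renv L (env : seq (clo G L)) : size (renv env) = size env.
Proof. by rewrite size_mkseq. Qed.

Lemma nth_renv L (env : seq (clo G L)) i :
  nth Base (renv env) i = cmap (fun=> n - i) (nth Base env i).
Proof.
case: (ltnP i (size env)) => h; first by rewrite nth_mkseq.
by rewrite !nth_default // size_renv.
Qed.

Lemma erase_renv L (env : seq (clo G L)) :
  map (@erase G nat) (renv env) = map (@erase G L) env.
Proof.
apply: eq_env => [|i]; first by rewrite !size_map size_iota.
by rewrite !nth_cmap nth_renv; exact: erase_cmap.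
Qed.

Lemma erase_ereg L (v : clo G L) : erase (ereg v) = erase v.
Proof. by case: v => //= g l env; rewrite /erase /=; congr Clo; exact: erase_renv. Qed.

Lemma wfc_erase L L' k (v : clo G L) (w : clo G L') :
  erase v = erase w -> wfc k v -> wfc k w.
Proof. by move=> h /(wfc_cmap (fun=> tt)) hv; apply: (@wfc_cmap_inv _ _ _ (fun=> tt)); rewrite -[cmap _ w]h. Qed.

Lemma exec_erase L L' q (v : clo G L) (w : clo G L') cs q' v' :
  erase v = erase w -> exec (q, v) cs = Some (q', v') ->
  exists2 w', exec (q, w) cs = Some (q', w') & erase w' = erase v'.
Proof.
move=> h E; have := exec_cmap (fun=> tt) cs q v.
rewrite -/(erase v) h E exec_cmap /=.
by case: (exec (q, w) cs) => [[q1 w1]|] //= [<- hw]; exists w1.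
Qed.

Lemma crel_const L (S : nat -> nat -> Prop) a b (v : clo G L) :
  S a b -> crel S (cmap (fun=> a) v) (cmap (fun=> b) v).
Proof.
move=> h; elim/clo_nested_ind: v => [|g l env IH] /=; constructor => //.
  by rewrite !size_map.
by move=> i; rewrite !nth_cmap.
Qed.

Lemma exec_Clo L q g l (env : seq (clo G L)) cs q' v :
  exec (q, Clo g l env) cs = Some (q', v) ->
  exists g' l' env', v = Clo g' l' env'.
Proof.
elim: cs q g l env => [|a cs IH] q g l env /=; first by case=> _ <-; exists g, l, env.
rewrite {1}/estep /=; case: (delta q g) => [f|q1 o]; case: a => [a|] //=; first exact: IH.
case: o => [k|k g1] /=; last exact: IH.
by case: (nth _ _ _) => [|g2 l2 e2] //=; exact: IH.
Qed.

(** The level is the final label under the initial labelling [ereg]. Comparing [ereg] through [S]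
    with another labelling [w] of the same stack relates the level to the label that a run from [w]
    leaves at the top; the facts about levels below come from suitable choices of [S]. *)
Lemma lev_label L (S : nat -> nat -> Prop) q g l (env : seq (clo G L)) w cs q' v' :
  crel S (ereg (Clo g l env)) w ->
  exec (q, Clo g l env) cs = Some (q', v') ->
  exists g' b e', exec (q, w) cs = Some (q', Clo g' b e') /\
    S (lev (q, erase (Clo g l env)) cs) b.
Proof.
move=> hS E.
have E0 : erase (Clo g l env) = erase (ereg (Clo g l env)) by rewrite erase_ereg.
have [x Ex _] := exec_erase E0 E.
have [w' Ew hw] := exec_crel hS Ex.
have [g' [l' [e' def_x]]] := exec_Clo Ex; subst x.
have [b [e2 [def_w' hb _ _]]] := crel_cloE hw; subst w'.
exists g', b, e2; split=> //; rewrite /lev /=.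
suff -> : Clo g 0 (renv (map (@erase G L) env)) = ereg (Clo g l env) by rewrite Ex.
rewrite /=; congr Clo; apply: eq_env => [|i]; first by rewrite !size_renv size_map.
by rewrite !nth_renv nth_cmap cmap_comp.
Qed.

(* The stack grew from [u] by elements whose labels satisfy [P]. *)
Inductive ext (L : Type) (P : L -> Prop) (u : clo G L) : clo G L -> Prop :=
| ext_refl : ext P u u
| ext_clo g l b rest :
    ext P u b -> P l -> (forall i, allc P (nth Base rest i)) ->
    ext P u (Clo g l (b :: rest)).

Lemma ext_trans L (P : L -> Prop) u v w : ext P u v -> ext P v w -> ext P u w.
Proof. by move=> h; elim=> // g l b rest _ IH hl hr; constructor. Qed.

(** * Returns and upper runs *)

(* [ret r q g env cs q' e]: the choices [cs] lead from the state [q] and the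
   stack s^n:...:s^1:g, where [env] = s^n,...,s^1, to the state [q'] and the
   stack e^n:...:e^{r+1}:s^r, which is where the history of the final topmost
   (r-1)-stack is the topmost (r-1)-stack of s^r. *)
Inductive ret : nat -> Q -> G -> seq (clo G unit) -> seq (option A) -> Q ->
    seq (clo G unit) -> Prop :=
| ret_pop r q g env q' :
    delta q g = Op q' (Pop r) -> ret r q g env [:: None] q' (take (n - r) env)
| ret_read r q g env f a cs q' e :
    delta q g = Read f -> ret r (f a) g env cs q' e ->
    ret r q g env (Some a :: cs) q' e
| ret_popc r q g env q1 j g1 env1 cs q' e :
    delta q g = Op q1 (Pop j) -> j < r ->
    nth Base env (n - j) = Clo g1 tt env1 ->
    ret r q1 g1 (take (n - j) env ++ env1) cs q' e ->
    ret r q g env (None :: cs) q' e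
| ret_pusha r q g env q1 j g1 cs q' e :
    delta q g = Op q1 (Push j g1) -> j <> r ->
    ret r q1 g1 (pushenv j g tt env) cs q' e ->
    ret r q g env (None :: cs) q' e
| ret_pushb r q g env q1 j g1 cs1 q2 e2 cs2 q' e :
    delta q g = Op q1 (Push j g1) -> r <= j ->
    ret j q1 g1 (pushenv j g tt env) cs1 q2 e2 ->
    ret r q2 g (e2 ++ drop (n - j) env) cs2 q' e ->
    ret r q g env (None :: cs1 ++ cs2) q' e.

Lemma wfc_catdrop L j g l l' (env e : seq (clo G L)) : j <= n ->
  wfc n (Clo g l env) -> size e = n - j ->
  (forall i, wfc (n - i) (nth Base e i)) ->
  wfc n (Clo g l' (e ++ drop (n - j) env)).
Proof.
move=> hj /wfc_cloE [hs he] hse hwe; constructor.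
  by rewrite size_cat size_drop; lia.
move=> i; rewrite nth_cat; case: ifP => // hi.
by rewrite nth_drop; move: (he (n - j + (i - size e))); congr wfc; lia.
Qed.

Lemma wfc_pushed L j g g' l l' l2 (env : seq (clo G L)) : 1 <= j <= n ->
  wfc n (Clo g l env) -> wfc n (Clo g' l' (pushenv j g l2 env)).
Proof.
move=> hj /wfc_cloE [hs he]; constructor; first by rewrite size_pushenv.
move=> i; rewrite nth_pushenv //; case: eqP => [->|_] //.
constructor; first by rewrite size_drop hs.
by move=> m; rewrite nth_drop; move: (he (n - j + m)); congr wfc; lia.
Qed.

Lemma wfc_popped L j g g' l l' l1 g1 (env env1 : seq (clo G L)) : 1 <= j <= n ->
  wfc n (Clo g l env) -> nth Base env (n - j) = Clo g1 l1 env1 ->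
  wfc n (Clo g' l' (take (n - j) env ++ env1)).
Proof.
move=> hj /wfc_cloE [hs he] E; have := he (n - j); rewrite E => /wfc_cloE [hs1 he1].
constructor; first by rewrite size_cat size_takel ?hs ?hs1; lia.
move=> i; rewrite nth_takecat ?hs; last lia.
by case: ifP => h //; move: (he1 (i - (n - j))); congr wfc; lia.
Qed.

Lemma op_pop q g q1 j : delta q g = Op q1 (Pop j) -> 1 <= j <= n.
Proof. by move/(op_order ). Qed.

Lemma op_push q g q1 j g1 : delta q g = Op q1 (Push j g1) -> 1 <= j <= n.
Proof. by move/(op_order ). Qed.

Lemma ret_wf r q g env cs q' e : ret r q g env cs q' e ->
  wfc n (Clo g tt env) ->
  [/\ 1 <= r <= n, size e = n - r & forall i, wfc (n - i) (nth Base e i)].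
Proof.
elim=> {r q g env cs q' e}.
- move=> r q g env q' /op_pop hr /wfc_cloE [hs he]; split=> //.
    by rewrite size_takel // hs; lia.
  by move=> i; rewrite nth_take_base; case: ifP => // _; constructor.
- by move=> r q g env f a cs q' e _ _ IH.
- move=> r q g env q1 j g1 env1 cs q' e /op_pop hj _ E _ IH h; apply: IH.
  exact: wfc_popped h E.
- move=> r q g env q1 j g1 cs q' e /op_push hj _ _ IH h; apply: IH.
  exact: wfc_pushed h.
- move=> r q g env q1 j g1 cs1 q2 e2 cs2 q' e /op_push hj _ _ IH1 _ IH2 h.
  apply: IH2; have [_ hs hw] := IH1 (wfc_pushed g1 tt tt hj h).
  by apply: wfc_catdrop h _ _; lia || exact: hw.
Qed.

Lemma map_erase_pushenv L j g l (env : seq (clo G L)) :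
  map (@erase G L) (pushenv j g l env) = pushenv j g tt (map (@erase G L) env).
Proof. by rewrite /pushenv map_cat map_take /= /erase /= !map_drop. Qed.

(* Choices accepted by [ret] behave in the same way under every labelling;
   the last two conjuncts say what happens to the components above level [r]. *)
Lemma ret_exec r q g env cs q' e : ret r q g env cs q' e ->
  wfc n (Clo g tt env) ->
  forall L l (wenv : seq (clo G L)), map (@erase G L) wenv = env ->
  forall g' l' env', nth Base wenv (n - r) = Clo g' l' env' ->
  exists e' : seq (clo G L), [/\ exec (q, Clo g l wenv) cs = Some (q', Clo g' l' (e' ++ env')),
    map (@erase G L) e' = e &
    forall (P : L -> Prop) x, r < x <= n -> P l ->
      (forall i, n - x < i -> allc P (nth Base wenv i)) ->
      (forall i, n - x < i < n - r -> allc P (nth Base e' i)) /\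
      ext P (nth Base wenv (n - x)) (nth Base e' (n - x))].
Proof.
elim=> {r q g env cs q' e}.
- move=> r q g env q' E /wfc_cloE [hs he] L l wenv hw g' l' env' E'.
  have hr := op_pop E; exists (take (n - r) wenv).
  rewrite /= {1}/estep /= E /= E'; split=> //; first by rewrite map_take hw.
  move=> P x hx hl hP; split=> [i hi|]; rewrite nth_take; try lia; last by constructor.
  by apply: hP; lia.
- move=> r q g env f a cs q' e E _ IH hwf L l wenv hw g' l' env' E'.
  by rewrite /= {1}/estep /= E /=; exact: IH.
- move=> r q g env q1 j g1 env1 cs q' e E hj E1 hret IH hwf L l wenv hw g' l' env' E'.
  have hjn := op_pop E; have hwf1 := wfc_popped g1 tt hjn hwf E1.
  have [hr _ _] := ret_wf hret hwf1.
  have [hs he] := wfc_cloE hwf.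
  have hsw : size wenv = n by rewrite -hs -hw size_map.
  move: E1; rewrite -hw nth_cmap; case E2 : (nth Base wenv (n - j)) => [|g2 l2 env2] //=.
  rewrite /erase /= => -[hg henv2]; subst g2.
  have := IH hwf1 L l2 (take (n - j) wenv ++ env2) _ g' l' env'.
  rewrite nth_takecat; last lia.
  rewrite (_ : n - r < n - j); last lia.
  rewrite map_cat map_take hw henv2 => /(_ erefl E') [e' [H1 H2 H3]].
  exists e'; split=> //; first by rewrite /= {1}/estep /= E /= E2.
  move=> P x hx hl hP; have := H3 P x hx.
  rewrite nth_takecat; last lia.
  rewrite (_ : n - x < n - j); last lia.
  have : allc P (nth Base wenv (n - j)) by apply: hP; lia.
  rewrite E2 => /allc_cloE [hl2 hP2]; apply=> // i hi.
  rewrite nth_takecat; last lia.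
  by case: ifP => // _; exact: hP.
- move=> r q g env q1 j g1 cs q' e E hj hret IH hwf L l wenv hw g' l' env' E'.
  have hjn := op_push E; have hwf1 := wfc_pushed g1 tt tt hjn hwf.
  have [hr _ _] := ret_wf hret hwf1.
  have [hs he] := wfc_cloE hwf.
  have hsw : size wenv = n by rewrite -hs -hw size_map.
  have := IH hwf1 L l (pushenv j g l wenv) _ g' l' env'.
  rewrite map_erase_pushenv hw nth_pushenv // ifN; last by apply/eqP; lia.
  move=> /(_ erefl E') [e' [H1 H2 H3]]; exists e'; split=> //.
    by rewrite /= {1}/estep /= E.
  move=> P x hx hl hP; have := H3 P x hx hl.
  have hP' i : n - x < i -> allc P (nth Base (pushenv j g l wenv) i).
    move=> hi; rewrite nth_pushenv //; case: eqP => [hij|_]; last exact: hP.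
    by constructor=> // m; rewrite nth_drop; apply: hP; lia.
  move=> /(_ hP') [K1 K2]; split=> //; apply: ext_trans K2.
  rewrite nth_pushenv //; case: eqP => [hxj|_]; last by constructor.
  have hxj' : n - x < size wenv by lia.
  rewrite -hxj (drop_nth Base hxj'); constructor=> //; first by constructor.
  by move=> i; rewrite nth_drop; apply: hP; lia.
- move=> r q g env q1 j g1 cs1 q2 e2 cs2 q' e E hj hret1 IH1 hret2 IH2.
  move=> hwf L l wenv hw g' l' env' E'.
  have hjn := op_push E; have hwf1 := wfc_pushed g1 tt tt hjn hwf.
  have [_ hs2 hwe2] := ret_wf hret1 hwf1.
  have hwf2 : wfc n (Clo g tt (e2 ++ drop (n - j) env)).
    by apply: wfc_catdrop hwf _ _; lia || exact: hwe2.
  have [hr _ _] := ret_wf hret2 hwf2.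
  have [hs he] := wfc_cloE hwf.
  have hsw : size wenv = n by rewrite -hs -hw size_map.
  have := IH1 hwf1 L l (pushenv j g l wenv) _ g l (drop (n - j) wenv).
  rewrite map_erase_pushenv hw nth_pushenv // eqxx.
  move=> /(_ erefl erefl) [e2' [H1 H2 H3]].
  have hse2' : size e2' = n - j by rewrite -hs2 -H2 size_map.
  have hnth i : n - j <= i ->
      nth Base (e2' ++ drop (n - j) wenv) i = nth Base wenv i.
    by move=> hi; rewrite nth_cat hse2' ifN ?nth_drop; [congr nth|]; lia.
  have := IH2 hwf2 L l (e2' ++ drop (n - j) wenv) _ g' l' env'.
  rewrite hnth; last lia.
  rewrite map_cat map_drop hw H2 => /(_ erefl E') [e' [H1' H2' H3']].
  exists e'; split=> //.
    by rewrite /= {1}/estep /= E /= exec_cat H1.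
  move=> P x hx hl hP.
  have hP' i : n - x < i -> allc P (nth Base (pushenv j g l wenv) i).
    move=> hi; rewrite nth_pushenv //; case: eqP => [hij|_]; last exact: hP.
    by constructor=> // m; rewrite nth_drop; apply: hP; lia.
  have := H3' P x hx hl.
  (* For x <= j the components from level x down are restored by the first return, and only the
     second one extends the x-stack. For x > j both returns extend it, one after the other. *)
  case: (leqP x j) => hxj.
    rewrite hnth; last lia.
    by apply=> i hi; rewrite hnth; [exact: hP|lia].
  have hx' : j < x <= n by lia.
  have [K1 K2] := H3 P x hx' hl hP'.
  have hnx : n - x < size e2' by lia.
  rewrite nth_cat hnx => K; have {}K : forall i, n - x < i ->
      allc P (nth Base (e2' ++ drop (n - j) wenv) i).
    move=> i hi; case: (ltnP i (n - j)) => hij; last by rewrite hnth //; exact: hP.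
    by rewrite nth_cat hse2' hij; apply: K1; lia.
  have := H3' P x hx hl K; rewrite nth_cat hnx => -[M1 M2].
  split=> //; apply: ext_trans M2; move: K2; rewrite nth_pushenv // ifN //.
  by apply/eqP; lia.
Qed.

(** * Recursion formulas for levels *)

Lemma allcT L (v : clo G L) : allc (fun=> True) v.
Proof. by elim/clo_nested_ind: v => [|g l env IH]; constructor. Qed.

Lemma crel_of_allc_imp L L' (S : L -> L' -> Prop) (P : L -> Prop) (P' : L' -> Prop)
  (v : clo G L) (w : clo G L') :
  (forall a b, P a -> P' b -> S a b) ->
  erase v = erase w -> allc P v -> allc P' w -> crel S v w.
Proof.
move=> hS he hv hw; apply: crel_imp (crel_of_allc he hv hw) => a b [].
exact: hS.
Qed.

Lemma lev_nil q v : lev (q, v) [::] = 0.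
Proof. by rewrite /lev /=; case: v. Qed.

Lemma lev_read q g env f a cs : delta q g = Read f ->
  lev (q, Clo g tt env) (Some a :: cs) = lev (f a, Clo g tt env) cs.
Proof. by move=> E; rewrite /lev /= {1}/estep /= E. Qed.

Lemma estep_pop L q g l (env : seq (clo G L)) q1 j g1 l1 env1 :
  delta q g = Op q1 (Pop j) -> nth Base env (n - j) = Clo g1 l1 env1 ->
  estep (q, Clo g l env) None = Some (q1, Clo g1 l1 (take (n - j) env ++ env1)).
Proof. by move=> E E1; rewrite /estep /= E /= E1. Qed.

Lemma estep_push L q g l (env : seq (clo G L)) q1 j g1 :
  delta q g = Op q1 (Push j g1) ->
  estep (q, Clo g l env) None = Some (q1, Clo g1 l (pushenv j g l env)).
Proof. by move=> E; rewrite /estep /= E. Qed.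

Lemma lev_cons (S : nat -> nat -> Prop) q v a q1 g1 env1 w cs q' v' :
  estep (q, ereg v) a = Some (q1, w) -> crel S (ereg (Clo g1 tt env1)) w ->
  exec (q1, Clo g1 tt env1) cs = Some (q', v') ->
  S (lev (q1, Clo g1 tt env1) cs) (lev (q, v) (a :: cs)).
Proof.
move=> E1 hS E; have [g' [b [e' [H1 H2]]]] := lev_label hS E.
by rewrite {2}/lev /= E1 /= H1; move: H2; rewrite erase_id.
Qed.

(** Entering the closure at level j merges all levels up to j into j and leaves the higher ones
    alone, so the new level is the maximum of [j] and [a]. *)
Lemma lev_pop q g env q1 j g1 env1 cs q' v' :
  wfc n (Clo g tt env) ->
  delta q g = Op q1 (Pop j) -> nth Base env (n - j) = Clo g1 tt env1 ->
  exec (q1, Clo g1 tt (take (n - j) env ++ env1)) cs = Some (q', v') ->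
  let a := lev (q1, Clo g1 tt (take (n - j) env ++ env1)) cs in
  lev (q, Clo g tt env) (None :: cs) = if j < a then a else j.
Proof.
move=> hwf E E1 Ex; have hj := op_pop E.
have [hs _] := wfc_cloE hwf; have [hs1 _] := wfc_cloE (wfc_popped g1 tt hj hwf E1).
set S := fun a b => b = if j < a then a else j.
apply: (@lev_cons S) Ex; first by apply: estep_pop E _; rewrite nth_renv E1.
apply: crel_Clo; first by rewrite /S ltn0; lia.
split=> [|i].
  rewrite size_renv hs1 size_cat size_takel ?size_renv ?hs ?size_map; last lia.
  by move: hs1; rewrite size_cat size_takel ?hs; lia.
rewrite nth_renv !nth_takecat ?size_renv ?hs; try lia.
case: ifP => hi; first by rewrite nth_renv; apply: crel_const; rewrite /S; case: ifP; lia.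
by rewrite nth_cmap; apply: crel_const; rewrite /S; case: ifP; lia.
Qed.

Lemma allc_pushed_clo j g (env : seq (clo G unit)) : size env = n -> 1 <= j <= n ->
  allc (fun b => b <= j) (Clo g 0 (drop (n - j) (renv env))).
Proof.
move=> hs hj; constructor=> // i; rewrite nth_drop nth_renv.
by apply: allc_const; lia.
Qed.

(** Only the component at level j is new. It holds the old top and the old components of levels up
    to j, so a run ending there has level at most j; every other component keeps its level. *)
Lemma lev_push q g env q1 j g1 cs q' v' :
  wfc n (Clo g tt env) -> delta q g = Op q1 (Push j g1) ->
  exec (q1, Clo g1 tt (pushenv j g tt env)) cs = Some (q', v') ->
  let a := lev (q1, Clo g1 tt (pushenv j g tt env)) cs in
  let b := lev (q, Clo g tt env) (None :: cs) in
  if a == j then b <= j else b == a.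
Proof.
move=> hwf E Ex; have hj := op_push E.
have [hs _] := wfc_cloE hwf.
set S := fun a b => is_true (if a == j then b <= j else b == a).
apply: (@lev_cons S) Ex; first exact: estep_push E.
apply: crel_Clo; first by rewrite /S; case: ifP; lia.
split=> [|i]; first by rewrite size_renv !size_pushenv ?size_renv.
rewrite nth_renv !nth_pushenv ?size_renv //; case: eqP => hi; last first.
  case: (ltnP i n) => hin; last by rewrite nth_default ?nth_default ?size_renv ?hs //; constructor.
  by rewrite nth_renv; apply: crel_const; rewrite /S; case: ifP; lia.
apply: (@crel_of_allc_imp _ _ _ (fun a => a = j) (fun b => b <= j)).
- by move=> a b -> hb; rewrite /S eqxx.
- rewrite erase_cmap /erase /= !map_drop; congr (Clo g tt (drop _ _)).
  exact: esym (erase_renv env).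
- by apply: allc_const; lia.
- exact: allc_pushed_clo.
Qed.

(** Once the stored closure is exposed by a return of level j, the top and the components of levels
    up to j are the original ones with their original labels. A later level that is at most j is
    therefore exact. *)
Lemma lev_pushret q g env q1 j g1 c1 q2 e2 c2 q' v' :
  wfc n (Clo g tt env) -> delta q g = Op q1 (Push j g1) ->
  ret j q1 g1 (pushenv j g tt env) c1 q2 e2 ->
  exec (q2, Clo g tt (e2 ++ drop (n - j) env)) c2 = Some (q', v') ->
  lev (q2, Clo g tt (e2 ++ drop (n - j) env)) c2 <= j ->
  lev (q, Clo g tt env) (None :: c1 ++ c2) =
  lev (q2, Clo g tt (e2 ++ drop (n - j) env)) c2.
Proof.
move=> hwf E hret Ex hlev; have hj := op_push E.
have [hs _] := wfc_cloE hwf.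
have hwf1 := wfc_pushed g1 tt tt hj hwf.
have [_ hs2 _] := ret_wf hret hwf1.
have he : map (@erase G nat) (pushenv j g 0 (renv env)) = pushenv j g tt env.
  by rewrite map_erase_pushenv erase_renv map_erase_id.
have hn : nth Base (pushenv j g 0 (renv env)) (n - j) =
    Clo g 0 (drop (n - j) (renv env)).
  by rewrite nth_pushenv ?size_renv // eqxx.
have [e2' [H1 H2 _]] := ret_exec hret hwf1 0 he hn.
have hs2' : size e2' = n - j by rewrite -hs2 -H2 size_map.
set S := fun a b => a <= j -> b = a.
have hS : crel S (ereg (Clo g tt (e2 ++ drop (n - j) env)))
    (Clo g 0 (e2' ++ drop (n - j) (renv env))).
  apply: crel_Clo; first by [].
  split=> [|i]; first by rewrite size_renv !size_cat !size_drop size_renv; lia.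
  rewrite nth_renv !nth_cat hs2 hs2'; case: ifP => hi; last first.
    by rewrite !nth_drop nth_renv; apply: crel_const; rewrite /S; lia.
  apply: (@crel_of_allc_imp _ _ _ (fun a => a = n - i) (fun=> True)).
  - by move=> a b -> _; rewrite /S; lia.
  - by rewrite erase_cmap -H2 nth_cmap -/(erase _) erase_id.
  - exact: allc_const.
  - exact: allcT.
have [g' [b [e' [K1 K2]]]] := lev_label hS Ex.
move: K2; rewrite erase_id => /(_ hlev) def_b.
by rewrite {1}/lev /= (estep_push _ _ E) /= exec_cat H1 /= K1 /= def_b.
Qed.

(** The induction is on a bound [m] for the length, since after a push the remaining choices may be
    split at a return and the hypothesis is used again on the second part. *)
Lemma ret_split m cs q g env q' v' : size cs <= m ->
  wfc n (Clo g tt env) -> exec (q, Clo g tt env) cs = Some (q', v') ->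
  forall r, lev (q, Clo g tt env) cs = r -> 0 < r ->
  exists c1 c2 q1 e g1 env1,
    [/\ cs = c1 ++ c2, ret r q g env c1 q1 e,
        nth Base env (n - r) = Clo g1 tt env1,
        exec (q1, Clo g1 tt (e ++ env1)) c2 = Some (q', v') &
        lev (q1, Clo g1 tt (e ++ env1)) c2 <= r].
Proof.
elim: m cs q g env => [|m IH] [|a cs] q g env hm hwf //;
  try by move=> _ r <-; rewrite lev_nil.
rewrite [size _]/= in hm; have {}hm : size cs <= m by lia.
rewrite [exec _ _]/=; case Es : estep => [[q1 v1]|] //= Ex r.
move: Es; rewrite {1}/estep /=.
case E : (delta q g) => [f|q2 o]; case: a => [a|] //.
  case=> hq1 hv1; subst q1 v1; rewrite (lev_read _ _ _ E) => hr hr0.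
  have [c1 [c2 [q3 [e [g1 [env1 [-> h1 h2 h3 h4]]]]]]] := IH _ _ _ _ hm hwf Ex r hr hr0.
  exists (Some a :: c1), c2, q3, e, g1, env1; split=> //; exact: ret_read h1.
case: o E => [j|j g1] E /=.
  have hj := op_pop E.
  case E1 : (nth Base env (n - j)) => [|g1 [] env1] //= [hq1 hv1]; subst q1 v1.
  (* If the later level exceeds j, the return is still to come and the pop lies inside it; otherwise
     r = j and the pop is itself the return. *)
  rewrite (lev_pop hwf E E1 Ex); case: ifP => ha hr hr0.
    have hwf1 := wfc_popped g1 tt hj hwf E1.
    have [c1 [c2 [q3 [e [g2 [env2 [-> h1 h2 h3 h4]]]]]]] := IH _ _ _ _ hm hwf1 Ex r hr hr0.
    exists (None :: c1), c2, q3, e, g2, env2; split=> //.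
      by apply: ret_popc E _ E1 h1; rewrite -hr.
    have [hrn _ _] := ret_wf h1 hwf1.
    have [hs _] := wfc_cloE hwf.
    move: h2; rewrite nth_takecat ?hs; last lia.
    by rewrite (_ : n - r < n - j); last lia.
  exists [:: None], cs, q2, (take (n - j) env), g1, env1; rewrite -hr; split=> //.
    exact: ret_pop E.
  lia.
have hj := op_push E.
case=> hq1 hv1; subst q1 v1.
have hwf1 := wfc_pushed g1 tt tt hj hwf; have [hs _] := wfc_cloE hwf.
(* Level j after the push means that the stored closure gets exposed: the run is split there, and r
   is the level of the rest. Any other level is not affected by the push. *)
have /= := lev_push hwf E Ex; case: eqP => /= ha.
  have hj0 : 0 < j by lia.
  have [c1 [c2 [q3 [e [g2 [env2 [hcs h1 h2 h3 h4]]]]]]] := IH _ _ _ _ hm hwf1 Ex j ha hj0.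
  move: h2; rewrite nth_pushenv // eqxx => -[hg2 henv2]; subst g2 env2.
  have [_ hse hwe] := ret_wf h1 hwf1.
  rewrite hcs (lev_pushret hwf E h1 h3 h4) => hle hr hr0.
  have hwf2 : wfc n (Clo g tt (e ++ drop (n - j) env)).
    by apply: wfc_catdrop hwf _ _; lia || exact: hwe.
  have hm2 : size c2 <= m by move: hm; rewrite hcs size_cat; lia.
  have [c3 [c4 [q4 [e4 [g4 [env4 [hc k1 k2 k3 k4]]]]]]] := IH _ _ _ _ hm2 hwf2 h3 r hr hr0.
  exists (None :: c1 ++ c3), c4, q4, e4, g4, env4; split=> //.
  - by rewrite hc /= catA.
  - by apply: ret_pushb E _ h1 k1; rewrite -hr.
  - move: k2; rewrite nth_cat hse ifN; last lia.
    by rewrite nth_drop; move=> <-; congr nth; lia.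
move/eqP=> -> hr hr0.
have [c1 [c2 [q3 [e [g2 [env2 [-> h1 h2 h3 h4]]]]]]] := IH _ _ _ _ hm hwf1 Ex r hr hr0.
have [hrn _ _] := ret_wf h1 hwf1.
exists (None :: c1), c2, q3, e, g2, env2; split=> //.
  by apply: ret_pusha E _ h1; lia.
by move: h2; rewrite nth_pushenv // ifN //; apply/eqP; lia.
Qed.

(* The factors of the decomposition of k-upper runs into shortest k-upper
   suffixes; [piece_ret] is the only kind that may have more than one step. *)
Inductive piece (k : nat) : Q -> G -> seq (clo G unit) -> seq (option A) ->
    Q -> G -> seq (clo G unit) -> Prop :=
| piece_read q g env f a :
    delta q g = Read f -> piece k q g env [:: Some a] (f a) g env
| piece_pop q g env q1 j g1 env1 :
    delta q g = Op q1 (Pop j) -> j <= k ->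
    nth Base env (n - j) = Clo g1 tt env1 ->
    piece k q g env [:: None] q1 g1 (take (n - j) env ++ env1)
| piece_push q g env q1 j g1 :
    delta q g = Op q1 (Push j g1) ->
    piece k q g env [:: None] q1 g1 (pushenv j g tt env)
| piece_ret q g env q1 j g1 cs q2 e2 :
    delta q g = Op q1 (Push j g1) -> k < j ->
    ret j q1 g1 (pushenv j g tt env) cs q2 e2 ->
    piece k q g env (None :: cs) q2 g (e2 ++ drop (n - j) env).

Inductive up (k : nat) : Q -> G -> seq (clo G unit) -> seq (seq (option A)) ->
    Q -> G -> seq (clo G unit) -> Prop :=
| up_nil q g env : up k q g env [::] q g env
| up_cons q g env p q1 g1 env1 ps q2 g2 env2 :
    piece k q g env p q1 g1 env1 -> up k q1 g1 env1 ps q2 g2 env2 ->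
    up k q g env (p :: ps) q2 g2 env2.

(** Only a push of order j > k whose closure is exposed again starts a longer factor: the run after
    such a push has level j, so the cut has to wait for the return. In all other cases the first
    step is a factor by itself. *)
Lemma up_parse k m cs q g env q' g' env' : size cs <= m ->
  wfc n (Clo g tt env) ->
  exec (q, Clo g tt env) cs = Some (q', Clo g' tt env') ->
  lev (q, Clo g tt env) cs <= k ->
  exists2 ps, cs = flatten ps & up k q g env ps q' g' env'.
Proof.
elim: m cs q g env => [|m IH] [|a cs] q g env hm hwf //;
  try by case=> <- <- <- _; exists [::] => //; constructor.
rewrite [size _]/= in hm; have {}hm : size cs <= m by lia.
rewrite [exec _ _]/=; case Es : estep => [[q1 v1]|] //= Ex.
move: Es; rewrite {1}/estep /=.
case E : (delta q g) => [f|q2 o]; case: a => [a|] //.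
  case=> hq1 hv1; subst q1 v1; rewrite (lev_read _ _ _ E) => hr.
  have [ps -> h] := IH _ _ _ _ hm hwf Ex hr.
  exists ([:: Some a] :: ps) => //; exact: up_cons (piece_read _ _ _ E) h.
case: o E => [j|j g1] E /=.
  have hj := op_pop E.
  case E1 : (nth Base env (n - j)) => [|g1 [] env1] //= [hq1 hv1]; subst q1 v1.
  rewrite (lev_pop hwf E E1 Ex); set b := lev _ _ => hr.
  have hjk : j <= k by move: hr; case: ifP; lia.
  have hb : b <= k by move: hr; case: ifP; lia.
  have [ps -> h] := IH _ _ _ _ hm (wfc_popped g1 tt hj hwf E1) Ex hb.
  exists ([:: None] :: ps) => //; exact: up_cons (piece_pop E hjk E1) h.
have hj := op_push E.
case=> hq1 hv1; subst q1 v1.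
have hwf1 := wfc_pushed g1 tt tt hj hwf; have [hs _] := wfc_cloE hwf.
have := lev_push hwf E Ex => /=; set b := lev (q2, _) _.
have simple : b <= k -> exists2 ps, None :: cs = flatten ps & up k q g env ps q' g' env'.
  move=> hb; have [ps -> h] := IH _ _ _ _ hm hwf1 Ex hb.
  exists ([:: None] :: ps) => //; exact: up_cons (piece_push _ _ E) h.
case: eqP => hbj; last by move/eqP=> ->; exact: simple.
move=> _; case: (leqP j k) => hjk; first by move=> _; apply: simple; rewrite hbj.
have hj0 : 0 < j by lia.
have [c1 [c2 [q3 [e [g2 [env2 [hcs h1 h2 h3 h4]]]]]]] := ret_split hm hwf1 Ex hbj hj0.
move: h2; rewrite nth_pushenv // eqxx => -[hg2 henv2]; subst g2 env2.
have [_ hse hwe] := ret_wf h1 hwf1.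
rewrite hcs (lev_pushret hwf E h1 h3 h4) => hle.
have hwf2 : wfc n (Clo g tt (e ++ drop (n - j) env)).
  by apply: wfc_catdrop hwf _ _; lia || exact: hwe.
have hm2 : size c2 <= m by move: hm; rewrite hcs size_cat; lia.
have [ps -> h] := IH _ _ _ _ hm2 hwf2 h3 hle.
by exists ((None :: c1) :: ps) => //; exact: up_cons (piece_ret E hjk h1) h.
Qed.

(** * Factors are upper and cannot be cut *)

Lemma pushret_exec q g env q1 j g1 cs q2 e2 :
  wfc n (Clo g tt env) -> delta q g = Op q1 (Push j g1) ->
  ret j q1 g1 (pushenv j g tt env) cs q2 e2 ->
  exec (q1, Clo g1 tt (pushenv j g tt env)) cs =
    Some (q2, Clo g tt (e2 ++ drop (n - j) env)).
Proof.
move=> hwf E hret; have hj := op_push E.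
have [hs _] := wfc_cloE hwf.
have hn : nth Base (pushenv j g tt env) (n - j) = Clo g tt (drop (n - j) env).
  by rewrite nth_pushenv // eqxx.
have [e [h1 h2 _]] := ret_exec hret (wfc_pushed g1 tt tt hj hwf) tt
  (map_erase_id _) hn.
by rewrite h1 -h2 map_erase_id.
Qed.

Lemma piece_exec k q g env cs q1 g1 env1 : wfc n (Clo g tt env) ->
  piece k q g env cs q1 g1 env1 ->
  exec (q, Clo g tt env) cs = Some (q1, Clo g1 tt env1).
Proof.
move=> + h; case: h => {q g env cs q1 g1 env1}.
- by move=> q g env f a E _; rewrite /= {1}/estep /= E.
- by move=> q g env q1 j g1 env1 E _ E1 _; rewrite /= (estep_pop _ E E1).
- by move=> q g env q1 j g1 E _; rewrite /= (estep_push _ _ E).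
- move=> q g env q1 j g1 cs q2 e2 E _ h hwf; rewrite /= (estep_push _ _ E) /=.
  exact: pushret_exec hwf E h.
Qed.

Lemma piece_lev k q g env cs q1 g1 env1 : wfc n (Clo g tt env) ->
  piece k q g env cs q1 g1 env1 -> lev (q, Clo g tt env) cs <= k.
Proof.
move=> + h; case: h => {q g env cs q1 g1 env1}.
- by move=> q g env f a E _; rewrite (lev_read _ _ _ E) lev_nil.
- move=> q g env q1 j g1 env1 E hj E1 hwf.
  by rewrite (lev_pop (cs := [::]) hwf E E1 erefl) lev_nil.
- move=> q g env q1 j g1 E hwf.
  have hj := op_push E; have [hs _] := wfc_cloE hwf.
  have := lev_push (cs := [::]) hwf E erefl; rewrite /= lev_nil.
  by case: eqP => [|_ /eqP ->] //; lia.
- move=> q g env q1 j g1 cs q2 e2 E _ h hwf.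
  by have := lev_pushret (c2 := [::]) hwf E h erefl; rewrite cats0 lev_nil => ->.
Qed.

Lemma ret_exec_renv r q g env cs q' e g' env' : ret r q g env cs q' e ->
  wfc n (Clo g tt env) -> nth Base env (n - r) = Clo g' tt env' ->
  forall q2 g2 l2 env2,
  exec (q, ereg (Clo g tt env)) cs = Some (q2, Clo g2 l2 env2) ->
  r <= l2 /\ forall i, n - r <= i -> allc (leq r) (nth Base env2 i).
Proof.
move=> hret hwf hn q2 g2 l2 env2.
have [hr hs _] := ret_wf hret hwf.
have he : map (@erase G nat) (renv env) = env by rewrite erase_renv map_erase_id.
have := @ret_exec _ _ _ _ _ _ _ hret hwf nat 0 (renv env) he g'.
rewrite nth_renv hn /= => /(_ _ _ erefl) [e' [-> h _]] [_ _ <- <-].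
have hs' : size e' = n - r by rewrite -hs -h size_map.
split=> [|i hi]; first lia.
rewrite nth_cat hs' ifN ?nth_cmap; last lia.
by apply: allc_const; lia.
Qed.

(** When a return is resumed in its middle, the history of the final top still lies outside the
    topmost (r-1)-stack found there. The label can exceed r, since the middle may lie within a
    nested return of level j >= r. *)
Lemma ret_suffix r q g env cs q' e : ret r q g env cs q' e ->
  wfc n (Clo g tt env) ->
  forall g' env', nth Base env (n - r) = Clo g' tt env' ->
  forall c1 c2, cs = c1 ++ c2 -> c2 <> [::] ->
  forall q1 v1, exec (q, Clo g tt env) c1 = Some (q1, v1) ->
  forall q2 g2 l2 env2, exec (q1, ereg v1) c2 = Some (q2, Clo g2 l2 env2) ->
  r <= l2 /\ forall i, n - r <= i -> allc (leq r) (nth Base env2 i).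
Proof.
move=> hret hwf g' env' hn [|a c1] c2.
  move=> hc _ q1 v1 [<- <-]; rewrite -{}[c2]hc; exact: ret_exec_renv hret hwf hn.
elim: hret hwf g' env' hn a c1 c2 => {r q g env cs q' e}.
- by move=> r q g env q' E hwf g' env' hn a [|? ?] [|? ?].
- move=> r q g env f a cs q' e E hret IH hwf g' env' hn _ c1 c2 [<- hc] h2 q1 v1.
  rewrite /= {1}/estep /= E /=; case: c1 hc => [|b c1] hc.
    by case=> <- <-; rewrite -{}[c2]hc; exact: ret_exec_renv hret hwf hn.
  exact: IH hwf _ _ hn _ _ _ hc h2 _ _.
- move=> r q g env q1 j g1 env1 cs q' e E hj E1 hret IH hwf g' env' hn _ c1 c2 [<- hc] h2.
  move=> q3 v3; rewrite [exec _ _]/= (estep_pop _ E E1) /=.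
  have hjn := op_pop E; have hwf1 := wfc_popped g1 tt hjn hwf E1.
  have [hr _ _] := ret_wf hret hwf1; have [hs _] := wfc_cloE hwf.
  have hn1 : nth Base (take (n - j) env ++ env1) (n - r) = Clo g' tt env'.
    rewrite nth_takecat; last lia.
    by rewrite ifT //; lia.
  case: c1 hc => [|b c1] hc.
    by case=> <- <-; rewrite -{}[c2]hc; exact: ret_exec_renv hret hwf1 hn1.
  exact: IH hwf1 _ _ hn1 _ _ _ hc h2 _ _.
- move=> r q g env q1 j g1 cs q' e E hj hret IH hwf g' env' hn _ c1 c2 [<- hc] h2.
  move=> q3 v3; rewrite [exec _ _]/= (estep_push _ _ E) /=.
  have hjn := op_push E; have hwf1 := wfc_pushed g1 tt tt hjn hwf.
  have [hr _ _] := ret_wf hret hwf1; have [hs _] := wfc_cloE hwf.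
  have hn1 : nth Base (pushenv j g tt env) (n - r) = Clo g' tt env'.
    by rewrite nth_pushenv // ifN //; apply/eqP; lia.
  case: c1 hc => [|b c1] hc.
    by case=> <- <-; rewrite -{}[c2]hc; exact: ret_exec_renv hret hwf1 hn1.
  exact: IH hwf1 _ _ hn1 _ _ _ hc h2 _ _.
move=> r q g env q1 j g1 cs1 q2 e2 cs2 q' e E hj hret1 IH1 hret2 IH2.
move=> hwf g' env' hn _ c1 c2 [<- hc] h2 q3 v3.
rewrite [exec _ _]/= (estep_push _ _ E) /=.
have hjn := op_push E; have hwf1 := wfc_pushed g1 tt tt hjn hwf.
have [_ hs2 hwe2] := ret_wf hret1 hwf1.
have hwf2 : wfc n (Clo g tt (e2 ++ drop (n - j) env)).
  by apply: wfc_catdrop hwf _ _; lia || exact: hwe2.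
have [hr _ _] := ret_wf hret2 hwf2.
have [hs _] := wfc_cloE hwf.
have hnj : nth Base (pushenv j g tt env) (n - j) = Clo g tt (drop (n - j) env).
  by rewrite nth_pushenv // eqxx.
have hn2 : nth Base (e2 ++ drop (n - j) env) (n - r) = Clo g' tt env'.
  rewrite nth_cat hs2 ifN; last lia.
  by rewrite nth_drop -hn; congr nth; lia.
have Ex1 := pushret_exec hwf E hret1.
(* A cut in the second return is settled by its own hypothesis. A cut inside the first one leaves
   labels at least j on all levels up to j, among which the second return exposes level r. *)
case: (ltnP (size c1) (size cs1)) => hsz; last first.
  have hc1 : c1 = cs1 ++ drop (size cs1) c1.
    by rewrite -{1}(cat_take_drop (size cs1) c1) -[take _ c1](takel_cat c2) // -hc take_size_cat.
  have hcs2 : cs2 = drop (size cs1) c1 ++ c2.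
    by move: hc; rewrite {1}hc1 -catA => /eqP; rewrite eqseq_cat // eqxx /= => /eqP.
  rewrite hc1 exec_cat Ex1 /=; move: hcs2; case: (drop _ _) => [|b c3] hcs2.
    by case=> <- <-; rewrite -{}[c2]hcs2; exact: ret_exec_renv hret2 hwf2 hn2.
  exact: IH2 hwf2 _ _ hn2 _ _ _ hcs2 h2 _ _.
set A' := drop (size c1) cs1.
have hcs1 : cs1 = c1 ++ A'.
  by rewrite -{1}(cat_take_drop (size c1) cs1) -[take _ cs1](takel_cat cs2) 1?ltnW // hc take_size_cat.
have hA : A' <> [::] by move=> h0; move: hsz; rewrite hcs1 h0 cats0 ltnn.
have hc2 : c2 = A' ++ cs2.
  by move: hc; rewrite {1}hcs1 -catA => /eqP; rewrite eqseq_cat // eqxx /= => /eqP.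
move=> Ec1 q4 g4 l4 env4.
have Ex1' : exec (q3, v3) A' = Some (q2, Clo g tt (e2 ++ drop (n - j) env)).
  by move: Ex1; rewrite hcs1 exec_cat Ec1.
have [w Ew hw] := exec_erase (esym (erase_ereg v3)) Ex1'.
case: w Ew hw => [|gw lw envw] Ew hw; first by [].
have [hlw haw] : j <= lw /\ forall i, n - j <= i -> allc (leq j) (nth Base envw i).
  move: hcs1 Ec1; case: (c1) => [|b c3] hcs1 Ec1.
    case: Ec1 => hq hv; subst q3 v3; move: Ew; rewrite -[A']/([::] ++ A') -hcs1 => Ew.
    exact: ret_exec_renv hret1 hwf1 hnj _ _ _ _ Ew.
  exact: IH1 hwf1 _ _ hnj _ _ _ hcs1 hA _ _ Ec1 _ _ _ _ Ew.
move: hw; rewrite erase_id /erase /= => -[hg henv]; subst gw.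
rewrite hc2 exec_cat Ew /=.
move: hn2; rewrite -henv nth_cmap; case En : (nth Base envw (n - r)) => [|g5 l5 env5] //= _.
have [e5 [-> h5 _]] := ret_exec hret2 hwf2 lw henv En.
case=> _ _ <- <-.
have [|hl5 hall] := allc_cloE (v := Clo g5 l5 env5) (P := leq j).
  by rewrite -En; apply: haw; lia.
have [_ hse _] := ret_wf hret2 hwf2.
split=> [|i hi]; first lia.
rewrite nth_cat ifN; last by rewrite -[size e5](size_map (@erase G nat)) h5 hse; lia.
by apply: allc_imp (hall _) => b; lia.
Qed.

(** This is the minimality of factors: only [piece_ret] admits a proper cut, and there the rest is a
    nonempty suffix of a return of level j > k. *)
Lemma piece_suffix k q g env cs q1 g1 env1 c1 c2 q2 v2 : wfc n (Clo g tt env) ->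
  piece k q g env cs q1 g1 env1 ->
  cs = c1 ++ c2 -> c1 <> [::] -> c2 <> [::] ->
  exec (q, Clo g tt env) c1 = Some (q2, v2) -> k < lev (q2, v2) c2.
Proof.
move=> + h; case: h c1 => {q g env cs q1 g1 env1}.
- by move=> q g env f a E [|? [|? ?]] _; case: c2.
- by move=> q g env q1 j g1 env1 E _ E1 [|? [|? ?]] _; case: c2.
- by move=> q g env q1 j g1 E [|? [|? ?]] _; case: c2.
move=> q g env q1 j g1 cs q3 e2 E hk h [|b c1] hwf // [<- hc] _ h2.
rewrite [exec _ _]/= (estep_push _ _ E) /= => Ec1.
have hj := op_push E; have hwf1 := wfc_pushed g1 tt tt hj hwf.
have [hs _] := wfc_cloE hwf.
have hnj : nth Base (pushenv j g tt env) (n - j) = Clo g tt (drop (n - j) env).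
  by rewrite nth_pushenv // eqxx.
have := pushret_exec hwf E h; rewrite hc exec_cat Ec1 /= => Ec2.
have [[|gw lw ew] Ew hw] := exec_erase (esym (erase_ereg v2)) Ec2; first by [].
have [hl _] := ret_suffix h hwf1 hnj hc h2 Ec1 Ew.
by rewrite /lev /= Ew /=; lia.
Qed.

(* Going down an x-stack that has only grown, by elements labelled below [x],
   one has to expose the original x-stack [Clo g0 tt env0] before reaching a
   0-stack labelled [x]. *)
Lemma expose_ext x g0 env0 v : 1 <= x <= n ->
  ext (fun l => l < x) (cmap (fun=> x) (Clo g0 tt env0)) v ->
  forall q g l wenv cs q' g' env',
  nth Base wenv (n - x) = v -> l < x ->
  (forall i, n - x < i -> allc (fun l => l < x) (nth Base wenv i)) ->
  wfc n (Clo g tt (map (@erase G nat) wenv)) ->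
  exec (q, Clo g l wenv) cs = Some (q', Clo g' x env') ->
  lev (q, Clo g tt (map (@erase G nat) wenv)) cs <= x ->
  exists c1 c2 q1 h, [/\ cs = c1 ++ c2, size h = n - x,
    exec (q, Clo g tt (map (@erase G nat) wenv)) c1 =
      Some (q1, Clo g0 tt (h ++ env0)) &
    lev (q1, Clo g0 tt (h ++ env0)) c2 <= x].
Proof.
move=> hx hext; elim: hext => [|gv lv b rest _ IH hlv hrest];
  move=> q g l wenv cs q' g' env' hn hl hw hwf Ex hlev.
all: have [v' Ex'] : exists v', exec (q, Clo g tt (map (@erase G nat) wenv)) cs = Some (q', v')
  by have [w ? _] := exec_erase (esym (erase_id _)) Ex; exists w.
(* If the level were smaller than x, the comparison [S] of the two labellings would push the final
   label below x, although it is x. *)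
all: have hlevx : lev (q, Clo g tt (map (@erase G nat) wenv)) cs = x.
1,3: apply/eqP; rewrite eqn_leq hlev /= leqNgt; apply/negP => hlt.
1,2: pose S a b := a < x -> b < x.
1,2: have hS : crel S (ereg (Clo g tt (map (@erase G nat) wenv))) (Clo g l wenv).
1,3: apply: crel_Clo; [by []|split=> [|i]; first by rewrite size_renv size_map].
1,2: rewrite nth_renv nth_cmap -/(erase _); case: (ltnP (n - x) i) => hi.
1,3: apply: (@crel_of_allc_imp _ _ _ (fun=> True) (fun l => l < x));
  [by move=> a b' _ hb _|by rewrite !erase_cmap|exact: allcT|exact: hw].
1,2: apply: (@crel_of_allc_imp _ _ _ (fun a => a = n - i) (fun=> True));
  [by move=> a b' -> _; rewrite /S; lia|by rewrite !erase_cmap|exact: allc_const|exact: allcT].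
1,2: have [g2 [b2 [e2 [K1 K2]]]] := lev_label hS Ex';
  move: K1 K2; rewrite Ex erase_id => -[_ <- _] /(_ hlt); rewrite ltnn.
1,2: by [].
all: have hx0 : 0 < x by lia.
all: have [c1 [c2 [q1 [e [g1 [env1 [hcs h1 h2 h3 h4]]]]]]] :=
  ret_split (leqnn _) hwf Ex' hlevx hx0.
all: have [_ hse _] := ret_wf h1 hwf.
  move: h2; rewrite nth_cmap hn -/(erase _) erase_cmap erase_id => -[? ?]; subst g1 env1.
  exists c1, c2, q1, e; split=> //.
  have := ret_exec h1 hwf tt (map_erase_id _) (g' := g0) (l' := tt) (env' := env0).
  rewrite nth_cmap hn -/(erase _) erase_cmap erase_id => /(_ erefl) [e' [-> <- _]].
  by rewrite map_erase_id.
(* The return has exposed an added element. The x-stack underneath is [b], to which the induction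
   hypothesis applies from here. *)
move: h2; rewrite nth_cmap hn /= => -[? ?]; subst g1 env1.
have [e' [K1 K2 _]] := ret_exec h1 hwf l erefl hn.
have hse' : size e' = n - x by rewrite -hse -K2 size_map.
have heq : map (@erase G nat) (e' ++ b :: rest) = e ++ map (@erase G nat) (b :: rest).
  by rewrite map_cat K2.
have Ec1 : exec (q, Clo g tt (map (@erase G nat) wenv)) c1 =
    Some (q1, Clo gv tt (map (@erase G nat) (e' ++ b :: rest))).
  have := ret_exec h1 hwf tt (map_erase_id _) (g' := gv) (l' := tt)
    (env' := map (@erase G nat) (b :: rest)).
  rewrite nth_cmap hn => /(_ erefl) [e'' [-> hee _]].
  by rewrite heq -hee map_erase_id.
have hwf' : wfc n (Clo gv tt (map (@erase G nat) (e' ++ b :: rest))).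
  exact: exec_wf _ _ _ _ _ _ hwf Ec1.
have hnb : nth Base (e' ++ b :: rest) (n - x) = b.
  by rewrite nth_cat hse' ltnn subnn.
have hwb i : n - x < i -> allc (fun l => l < x) (nth Base (e' ++ b :: rest) i).
  move=> hi; rewrite nth_cat hse' ifN; last lia.
  by case hd : (i - (n - x)) => [|d] /=; [lia|exact: hrest].
have Ec2 : exec (q1, Clo gv lv (e' ++ b :: rest)) c2 = Some (q', Clo g' x env').
  by move: Ex; rewrite hcs exec_cat K1.
rewrite -heq in h4.
have [c3 [c4 [q3 [h [hc2 k2 k3 k4]]]]] := IH _ _ _ _ _ _ _ _ hnb hlv hwb hwf' Ec2 h4.
exists (c1 ++ c3), c4, q3, h; split=> //; first by rewrite hcs hc2 catA.
by rewrite exec_cat Ec1 /= k3.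
Qed.

(** * Uniform histories of topmost stacks *)

Definition homog (j : nat) (v : clo G nat) : Prop :=
  allc (fun l => l <= j) v \/ allc (fun l => j < l) v.

(* A k-stack has its whole history inside the initial topmost k-stack or
   entirely outside of it. *)
Inductive hom : nat -> clo G nat -> Prop :=
| hom_base k : hom k Base
| hom_clo k g l env :
    size env = k -> (forall i, i <= k -> homog (k - i) (Clo g l (drop i env))) ->
    (forall i, hom (k - i) (nth Base env i)) -> hom k (Clo g l env).

Lemma hom_cloE k v : hom k v ->
  if v is Clo g l env then
    [/\ size env = k, forall i, i <= k -> homog (k - i) (Clo g l (drop i env)) &
        forall i, hom (k - i) (nth Base env i)]
  else True.
Proof. by case. Qed.

Lemma allc_drop (P : nat -> Prop) g l (env : seq (clo G nat)) i :
  allc P (Clo g l env) -> allc P (Clo g l (drop i env)).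
Proof. by case/allc_cloE=> hl h; constructor=> // m; rewrite nth_drop. Qed.

Lemma hom_const L a k (v : clo G L) : wfc k v -> hom k (cmap (fun=> a) v).
Proof.
elim=> [j|j g l env hs hwf IH] /=; first by constructor.
constructor=> [|i hi|i]; first by rewrite size_map.
  have h (P : nat -> Prop) : P a -> allc P (Clo g a [seq cmap (fun=> a) x | x <- env]).
    by move=> hP; constructor=> // m; rewrite nth_cmap; exact: allc_const.
  by case: (leqP a (j - i)) => ha; [left|right]; apply: allc_drop; exact: h.
by rewrite nth_cmap.
Qed.

Lemma hom_ereg L (v : clo G L) : wfc n v -> hom n (ereg v).
Proof.
case: v => [|g l env] /=; first by constructor.
move=> /wfc_cloE [hs he]; constructor; first by rewrite size_renv.
  move=> i hi; left; constructor=> // m; rewrite nth_drop nth_renv.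
  by apply: allc_const; lia.
by move=> i; rewrite nth_renv; exact: hom_const.
Qed.

(** The new topmost stack of each level uses only labels of the old one of that level, except for
    levels up to j after a pop of order j, where it is a topmost stack of the entered closure. *)
Lemma hom_estep q v a q' v' : hom n v -> estep (q, v) a = Some (q', v') -> hom n v'.
Proof.
case: v => [|g l env] // /[dup] hv /hom_cloE [hs hh he]; rewrite /estep /=.
case E : (delta q g) => [f|q1 o]; case: a => [a|] //; first by case=> _ <-.
case: o E => [j|j g1] /(op_order ) hj /=.
  move: (he (n - j)); case En : (nth Base env (n - j)) => [|g2 l2 e2] //.
  case/hom_cloE=> [hs2 hh2 he2] /= [_ <-]; constructor.
  - by rewrite size_cat size_takel ?hs ?hs2; lia.
  - move=> i hi; case: (leqP (n - j) i) => hij.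
      rewrite drop_cat size_takel ?hs; last lia.
      rewrite ltnNge hij /= (_ : n - i = n - (n - j) - (i - (n - j))); last lia.
      by apply: hh2; lia.
    have imp (P : nat -> Prop) : allc P (Clo g l (drop i env)) ->
        allc P (Clo g2 l2 (drop i (take (n - j) env ++ e2))).
      move=> /allc_cloE [_ hP].
      have := hP (n - j - i); rewrite nth_drop subnKC ?En; last lia.
      move=> /allc_cloE [hl2 hP2]; constructor=> // m; rewrite nth_drop nth_takecat ?hs; last lia.
      by case: ifP => // _; move: (hP m); rewrite nth_drop.
    by case: (hh i hi) => /imp; [left|right].
  - move=> i; rewrite nth_takecat ?hs; last lia.
    by case: ifP => // hi; move: (he2 (i - (n - j))); congr hom; lia.
case=> _ <-; constructor; first by rewrite size_pushenv.
  move=> i hi.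
  have imp (P : nat -> Prop) : allc P (Clo g l (drop i env)) ->
      allc P (Clo g1 l (drop i (pushenv j g l env))).
    move=> /allc_cloE [hl hP]; constructor=> // m; rewrite nth_drop nth_pushenv //.
    case: eqP => him; last by move: (hP m); rewrite nth_drop.
    constructor=> // p; rewrite nth_drop -him.
    by move: (hP (m + p)); rewrite nth_drop addnA.
  by case: (hh i hi) => /imp; [left|right].
move=> i; rewrite nth_pushenv //; case: eqP => [->|_] //.
constructor; first by rewrite size_drop hs.
  move=> m hm; rewrite drop_drop (_ : n - (n - j) - m = n - (m + (n - j))); last lia.
  by apply: hh; lia.
by move=> m; rewrite nth_drop; move: (he (n - j + m)); congr hom; lia.
Qed.

Lemma hom_exec cs q v q' v' : hom n v -> exec (q, v) cs = Some (q', v') -> hom n v'.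
Proof.
elim: cs q v => [|a cs IH] q v h /=; first by case=> _ <-.
case E : estep => [[q1 v1]|] //=; apply: IH; exact: hom_estep E.
Qed.

(** Being k-upper concerns all 0-stacks of the final topmost k-stack, while the level is read off
    the topmost symbol alone; homogeneity leads from one to the other. *)
Lemma topk_homog L k q (v : clo G L) cs q' g l env : k <= n -> wfc n v ->
  exec (q, ereg v) cs = Some (q', Clo g l env) -> l <= k ->
  forall i, n - k <= i -> allc (fun l => l <= k) (nth Base env i).
Proof.
move=> hk hwf E hl i hi; have [_ h _] := hom_cloE (hom_exec (hom_ereg hwf) E).
have := h (n - k) ltac:(lia); rewrite /homog (_ : n - (n - k) = k); last lia.
case=> /allc_cloE [hl' hP]; last lia.
by move: (hP (i - (n - k))); rewrite nth_drop subnKC.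
Qed.

(** By [topk_homog] the first run leaves only labels at most k on its topmost k-stack, and the
    second one ends with a history in there; labels elsewhere are unconstrained. *)
Lemma lev_cat k q g env c1 q1 g1 env1 c2 q2 v2 : k <= n ->
  wfc n (Clo g tt env) -> exec (q, Clo g tt env) c1 = Some (q1, Clo g1 tt env1) ->
  exec (q1, Clo g1 tt env1) c2 = Some (q2, v2) ->
  lev (q, Clo g tt env) c1 <= k -> lev (q1, Clo g1 tt env1) c2 <= k ->
  lev (q, Clo g tt env) (c1 ++ c2) <= k.
Proof.
move=> hk hwf E1 E2.
have [w Ew hw] := exec_erase (esym (erase_ereg (Clo g tt env))) E1.
rewrite {1}/lev /= Ew; case: w Ew hw => [|gw lw ew] // Ew hw /= hl1 hl2.
have hall := topk_homog hk hwf Ew hl1.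
move: hw; rewrite /erase /= => -[hg he]; subst gw.
have hs := congr1 size he; rewrite !size_map in hs.
pose S a b := a <= k -> b <= k.
have hS : crel S (ereg (Clo g1 tt env1)) (Clo g1 lw ew).
  apply: crel_Clo; first by [].
  split=> [|i]; first by rewrite size_renv.
  have hei : erase (nth Base ew i) = erase (nth Base env1 i).
    by have := congr1 ((nth Base)^~ i) he; rewrite !nth_cmap.
  rewrite nth_renv; case: (ltnP i (n - k)) => hi.
    apply: (@crel_of_allc_imp _ _ _ (fun a => a = n - i) (fun=> True)).
    - by move=> a b -> _; rewrite /S; lia.
    - by rewrite erase_cmap.
    - exact: allc_const.
    - exact: allcT.
  apply: (@crel_of_allc_imp _ _ _ (fun=> True) (fun b => b <= k)).
  - by move=> a b _ hb _.
  - by rewrite erase_cmap.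
  - exact: allcT.
  - exact: hall.
have [g' [b [e' [K1 K2]]]] := lev_label hS E2.
by rewrite /lev /= exec_cat Ew /= K1 /=; apply: K2; rewrite erase_id.
Qed.

(** * Growth of the stack along 0-upper runs *)

Lemma piece_wf k q g env cs q1 g1 env1 : wfc n (Clo g tt env) ->
  piece k q g env cs q1 g1 env1 -> wfc n (Clo g1 tt env1).
Proof.
by move=> hwf h; apply: (exec_wf hwf (piece_exec hwf h)).
Qed.

(** A 0-upper factor is never a pop, since orders are positive. A push puts on the x-stack only
    material from below level x, and a push of order j completed by its return restores the levels
    up to j and extends the higher ones. *)
Lemma piece0_ext q g env cs q1 g1 env1 : piece 0 q g env cs q1 g1 env1 ->
  wfc n (Clo g tt env) ->
  forall L l (wenv : seq (clo G L)), map (@erase G L) wenv = env ->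
  exists l1 (wenv1 : seq (clo G L)),
    [/\ exec (q, Clo g l wenv) cs = Some (q1, Clo g1 l1 wenv1),
    map (@erase G L) wenv1 = env1 &
    forall (P : L -> Prop) x, 0 < x <= n -> P l ->
      (forall i, n - x < i -> allc P (nth Base wenv i)) ->
      [/\ P l1, forall i, n - x < i -> allc P (nth Base wenv1 i) &
      ext P (nth Base wenv (n - x)) (nth Base wenv1 (n - x))]].
Proof.
case=> {q g env cs q1 g1 env1}.
- move=> q g env f a E hwf L l wenv hw; exists l, wenv.
  by split=> //; [rewrite /= {1}/estep /= E|split=> //; constructor].
- by move=> q g env q1 j g1 env1 /(op_pop ) hj hj0; lia.
- move=> q g env q1 j g1 E hwf L l wenv hw; exists l, (pushenv j g l wenv).
  have hj := op_push E; have [hs _] := wfc_cloE hwf.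
  have hsw : size wenv = n by rewrite -hs -hw size_map.
  split; first by rewrite /= (estep_push _ _ E).
    by rewrite map_erase_pushenv hw.
  move=> P x hx hl hP; split=> // [i hi|].
    rewrite nth_pushenv //; case: eqP => [hij|_]; last exact: hP.
    by constructor=> // m; rewrite nth_drop; apply: hP; lia.
  rewrite nth_pushenv //; case: eqP => [hxj|_]; last by constructor.
  have hxj' : n - x < size wenv by lia.
  rewrite -hxj (drop_nth Base hxj'); constructor=> //; first by constructor.
  by move=> i; rewrite nth_drop; apply: hP; lia.
move=> q g env q1 j g1 cs q2 e2 E hj0 hret hwf L l wenv hw.
have hj := op_push E; have [hs _] := wfc_cloE hwf.
have hsw : size wenv = n by rewrite -hs -hw size_map.
have hwf1 := wfc_pushed g1 tt tt hj hwf.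
have hnj : nth Base (pushenv j g l wenv) (n - j) = Clo g l (drop (n - j) wenv).
  by rewrite nth_pushenv // eqxx.
have hew : map (@erase G L) (pushenv j g l wenv) = pushenv j g tt env.
  by rewrite map_erase_pushenv hw.
have [e2' [H1 H2 H3]] := ret_exec hret hwf1 l hew hnj.
have [_ hs2 _] := ret_wf hret hwf1.
have hse2' : size e2' = n - j by rewrite -hs2 -H2 size_map.
exists l, (e2' ++ drop (n - j) wenv); split.
- by rewrite /= (estep_push _ _ E).
- by rewrite map_cat map_drop H2 hw.
move=> P x hx hl hP.
have hnth i : n - j <= i ->
    nth Base (e2' ++ drop (n - j) wenv) i = nth Base wenv i.
  by move=> hi; rewrite nth_cat hse2' ifN ?nth_drop; [congr nth|]; lia.
have hP' i : n - x < i -> allc P (nth Base (pushenv j g l wenv) i).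
  move=> hi; rewrite nth_pushenv //; case: eqP => [hij|_]; last exact: hP.
  by constructor=> // m; rewrite nth_drop; apply: hP; lia.
case: (leqP x j) => hxj.
  split=> // [i hi|]; first by rewrite hnth; [exact: hP|lia].
  by rewrite hnth; [constructor|lia].
have hxn : j < x <= n by lia.
have [K1 K2] := H3 P x hxn hl hP'; split=> // [i hi|].
  case: (ltnP i (n - j)) => hij; last by rewrite hnth //; exact: hP.
  by rewrite nth_cat hse2' hij; apply: K1; lia.
rewrite nth_cat hse2' (_ : n - x < n - j); last lia.
by move: K2; rewrite nth_pushenv // ifN //; apply/eqP; lia.
Qed.

Lemma up0_ext q g env ps q1 g1 env1 : up 0 q g env ps q1 g1 env1 ->
  wfc n (Clo g tt env) ->
  forall L l (wenv : seq (clo G L)), map (@erase G L) wenv = env ->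
  exists l1 (wenv1 : seq (clo G L)),
    [/\ exec (q, Clo g l wenv) (flatten ps) = Some (q1, Clo g1 l1 wenv1),
    map (@erase G L) wenv1 = env1 &
    forall (P : L -> Prop) x, 0 < x <= n -> P l ->
      (forall i, n - x < i -> allc P (nth Base wenv i)) ->
      [/\ P l1, forall i, n - x < i -> allc P (nth Base wenv1 i) &
      ext P (nth Base wenv (n - x)) (nth Base wenv1 (n - x))]].
Proof.
elim=> {q g env ps q1 g1 env1} [q g env|q g env p q1 g1 env1 ps q2 g2 env2 hp _ IH].
  move=> _ L l wenv hw; exists l, wenv; split=> // P x hx hl hP; split=> //; constructor.
move=> hwf L l wenv hw.
have [l1 [w1 [H1 H2 H3]]] := piece0_ext hp hwf l hw.
have [l2 [w2 [K1 K2 K3]]] := IH (piece_wf hwf hp) L l1 w1 H2.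
exists l2, w2; split=> //; first by rewrite /= exec_cat H1.
move=> P x hx hl hP; have [h1 h2 h3] := H3 P x hx hl hP.
have [k1 k2 k3] := K3 P x hx h1 h2; split=> //; exact: ext_trans h3 k3.
Qed.

Lemma up_exec k q g env ps q1 g1 env1 : wfc n (Clo g tt env) ->
  up k q g env ps q1 g1 env1 ->
  exec (q, Clo g tt env) (flatten ps) = Some (q1, Clo g1 tt env1).
Proof.
move=> + h; elim: h => {q g env ps q1 g1 env1} // q g env p q1 g1 env1 ps q2 g2 env2.
move=> hp _ IH hwf; rewrite /= exec_cat (piece_exec hwf hp) /=.
exact: IH (piece_wf hwf hp).
Qed.

Lemma up_lev k q g env ps q1 g1 env1 : k <= n -> wfc n (Clo g tt env) ->
  up k q g env ps q1 g1 env1 -> lev (q, Clo g tt env) (flatten ps) <= k.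
Proof.
move=> hk + h; elim: h => {q g env ps q1 g1 env1} [q g env|q g env p q1 g1 env1 ps q2 g2 env2 hp hup IH] hwf.
  by rewrite lev_nil.
have hwf1 := piece_wf hwf hp.
apply: (lev_cat hk hwf (piece_exec hwf hp) (up_exec hwf1 hup)).
  exact: piece_lev hwf hp.
exact: IH.
Qed.

(* Between two milestone points in which the final history lies on the same
   level [x], nothing relevant has been put on the x-stack; so the run has to
   return to the x-stack of the earlier point. *)
Lemma same_level_expose x q g env c1 q1 g1 env1 cs q' v' : 1 <= x <= n ->
  wfc n (Clo g tt env) ->
  exec (q, Clo g tt env) c1 = Some (q1, Clo g1 tt env1) ->
  lev (q, Clo g tt env) c1 = 0 ->
  exec (q1, Clo g1 tt env1) cs = Some (q', v') ->
  lev (q1, Clo g1 tt env1) cs = x -> lev (q, Clo g tt env) (c1 ++ cs) = x ->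
  exists g0 env0 c2 c3 q2 h, [/\ nth Base env (n - x) = Clo g0 tt env0,
    cs = c2 ++ c3, size h = n - x,
    exec (q1, Clo g1 tt env1) c2 = Some (q2, Clo g0 tt (h ++ env0)) &
    lev (q2, Clo g0 tt (h ++ env0)) c3 <= x].
Proof.
move=> hx hwf E1 hlev1 E2 hlev2 hlev.
have [ps hps hup] : exists2 ps, c1 = flatten ps & up 0 q g env ps q1 g1 env1.
  by apply: (up_parse (leqnn (size c1)) hwf E1); rewrite hlev1.
have he : map (@erase G nat) (renv env) = env by rewrite erase_renv map_erase_id.
have [l1 [w1 [H1 H2 H3]]] := up0_ext hup hwf 0 he.
have E : exec (q, Clo g tt env) (c1 ++ cs) = Some (q', v') by rewrite exec_cat E1.
have hx0 : 0 < x by lia.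
(* Splitting the whole run shows that the x-stack is nonempty already at the earlier point; only
   this is kept from the splitting. *)
have [_ [_ [_ [_ [g0 [env0 [_ _ hn _ _]]]]]]] := ret_split (leqnn _) hwf E hlev hx0.
have hP i : n - x < i -> allc (fun l => l < x) (nth Base (renv env) i).
  by move=> hi; rewrite nth_renv; apply: allc_const; lia.
have [K1 K2 K3] := H3 (fun l => l < x) x hx hx0 hP.
rewrite nth_renv hn (_ : n - (n - x) = x) in K3; last lia.
have hwf1 := exec_wf hwf E1; rewrite -H2 in hwf1 E2 hlev2 *.
have [w Ew hw] := exec_erase (esym (erase_ereg (Clo g tt env))) E.
have [gw [lw [ew def_w]]] := exec_Clo Ew; subst w.
have hlw : lw = x by move: hlev; rewrite /lev /= Ew.
have Ew1 : exec (q1, Clo g1 l1 w1) cs = Some (q', Clo gw x ew).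
  by move: Ew; rewrite exec_cat hps H1 hlw.
have [|c2 [c3 [q2 [h [k1 k2 k3 k4]]]]] := expose_ext hx K3 (erefl _) K1 K2 hwf1 Ew1.
  by rewrite hlev2.
by exists g0, env0, c2, c3, q2, h.
Qed.

(** * Runs of the automaton *)

Local Notation config := (config Q G).
Local Notation valid := (@valid_config n Q G).
Local Notation step := (step n delta).
Local Notation lab := (lab n delta).
Local Notation histstep := (histstep n delta).
Local Notation hist := (hist n delta).
Local Notation is_run := (is_run n delta).
Local Notation word := (word n delta).
Local Notation upper := (upper n delta).
Local Notation kdecomp := (kdecomp n delta).

Section Traces.
Implicit Types (c d : config) (cs : seq (option A)) (ps : seq (seq (option A))).

Lemma valid_enc c : valid c -> exists g x env,
  [/\ enc c.2 = Clo g x env, canon n [::] c.2, wfc n (enc c.2), size x = n &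
      forall i, allc (below x i) (nth Base env i)].
Proof.
move=> [/valid_canon hc hne]; have [g [x [env [E _]]]] := enc_Clo hc hne.
exists g, x, env; have [h1 _ h2 h3] := enc_below hc E.
by split=> // i; exact: (h3 i).
Qed.

Lemma topsym_enc c g x env : valid c -> enc c.2 = Clo g x env ->
  topsym n c.2 = Some g.
Proof.
move=> [/valid_canon hc hne] E; rewrite /topsym.
have [h1 [p' [_ h2 _]]] := enc_topd hc E (leqnn n).
by move: h1 h2; rewrite subnn; case: (topd n c.2) => //= g' x' [<-].
Qed.

Lemma leafpos_topk c g x env k : valid c -> enc c.2 = Clo g x env -> k <= n ->
  leafpos (topk n k c.2) = clabels (Clo g x (drop (n - k) env)).
Proof.
move=> [/valid_canon hc hne] E hk; rewrite /topk.
have [h1 [p' [_ h2 _]]] := enc_topd hc E (leq_subr k n).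
by rewrite (leafpos_enc h2) h1.
Qed.

Lemma mem_topk c g x env k y : valid c -> enc c.2 = Clo g x env -> k <= n ->
  y \in leafpos (topk n k c.2) -> take (n - k) y = take (n - k) x.
Proof.
move=> hv E hk hy; have hv' := hv; case: hv' => /valid_canon hc hne.
have hx : x \in leafpos (topk n k c.2).
  rewrite (leafpos_topk hv E hk); apply/In_mem => /=; rewrite -cats1.
  by apply/List.in_app_iff; right; left.
have [_ [p' [h1 h2 _]]] := enc_topd hc E (leq_subr k n).
have [] := canon_leaf h2 hy; have [] := canon_leaf h2 hx.
by rewrite h1 add0n => -> _ -> _.
Qed.

Lemma cmap_id_allc L (f : L -> L) (v : clo G L) : allc (fun a => f a = a) v -> cmap f v = v.
Proof.
elim/clo_nested_ind: v => //= g a env IH /allc_cloE [-> h]; congr Clo.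
by apply: eq_env => [|i]; rewrite ?size_map // nth_cmap IH.
Qed.

Lemma allc_cmap L L' (P : L' -> Prop) (f : L -> L') (v : clo G L) :
  allc P (cmap f v) -> allc (fun a => P (f a)) v.
Proof.
elim/clo_nested_ind: v => [|g a env IH] /=; first by constructor.
by move=> /allc_cloE [ha h]; constructor=> // i; apply: IH; rewrite -nth_cmap.
Qed.

Lemma apply_op_enc c g x env q' o : valid c -> enc c.2 = Clo g x env ->
  delta c.1 g = Op q' o ->
  match apply_op n o c.2, eop o (enc c.2) with
  | Some s', Some v => valid (q', s') /\ v = cmap (histstep c (q', s')) (enc s')
  | None, None => True
  | _, _ => False
  end.
Proof.
move=> hv E Ed; have hts := topsym_enc hv E.
case: hv => /valid_canon hc hne.
have [hwf _ hsx _] := enc_below hc E; rewrite add0n in hsx.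
have [hs _] : size env = n /\ True by move: hwf; rewrite E => /wfc_cloE [].
have hm j : n = n - j + j -> canon n [::] c.2 -> canon (n - j + j) [::] c.2 by move=> <-.
case: o Ed => [[|k]|[|k] g'] Ed; have := op_order Ed => //= hk.
  have hnk : n = n - k.+1 + k.+1 by lia.
  have := modtop_pop (hm _ hnk hc) E; rewrite E /pop /epop -/(popf (G := G)) -hnk.
  case: (modtop _ _ c.2) => [s'|]; case: (nth Base env _) => [|g1 x1 env1] // [h1 h2 h3].
  split; first by split=> //; apply/valid_canon.
  rewrite h3 cmap_id_allc //; apply/allc_clabels => y _.
  by rewrite /Defs.histstep hts Ed.
have hnk : n = n - k.+1 + k.+1 by lia.
have [s' [h1 h2 h3 h4]] := modtop_push g' (hm _ hnk hc) E.
rewrite add0n -hnk in h1 h2 h3 h4; rewrite /push -/(pushf (n - k.+1) k.+1 g') h1 E /=.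
have hvs : valid (q', s') by split=> //; apply/valid_canon.
split=> //; have hk' : k <= n by lia.
have hnk1 : n - k = (n - k.+1).+1 by lia.
set x' := incr_at (n - k.+1) x in h4 *.
have hst y : histstep c (q', s') y =
    if y \in leafpos (topk n k s') then decr_at (n - k.+1) y else y.
  by rewrite /Defs.histstep hts Ed.
have hW : allc (fun y => y \in leafpos (topk n k s'))
    (Clo g' x' [seq cmap (incr_at (n - k.+1)) i | i <- drop (n - k.+1).+1 env]).
  apply/allc_clabels => y hy; apply/In_mem; rewrite (leafpos_topk hvs h4 hk').
  rewrite hnk1 drop_cat size_takel ?hs; last lia.
  by rewrite ltnNge leqnSn /= subSnn /= drop0.
have [hx' hW'] := allc_cloE hW.
have hdi z : size z = n -> decr_at (n - k.+1) (incr_at (n - k.+1) z) = z.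
  by move=> hz; apply: decr_incr; lia.
(* The order of the push is k + 1. Components up to index n - (k + 1) lie outside the topmost
   k-stack, since their positions differ from [x'] at a coordinate before n - k. *)
have lowc i : i <= n - k.+1 -> forall y, below x' i y -> histstep c (q', s') y = y.
  move=> hi y [_ hlt]; rewrite hst; case: ifP => // /(mem_topk hvs h4 hk') htk.
  have : nth 0 (take (n - k) y) i = nth 0 (take (n - k) x') i by rewrite htk.
  by rewrite !nth_take; lia.
have [_ _ _ hbel] := enc_below (proj1 (valid_canon n s') (proj1 hvs)) h4.
rewrite h4 /= hst hx' hdi //; congr Clo.
apply: eq_env => [|i].
  by rewrite size_pushenv // size_map size_cat /= size_map size_takel ?size_drop; lia.
rewrite nth_cmap.
case: (leqP i (n - k.+1)) => hi.
  have {}hbel := hbel i; rewrite /= add0n in hbel.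
  rewrite cmap_id_allc; last by apply: allc_imp hbel => y; exact: lowc.
  rewrite nth_pushenv // nth_takecat; last lia.
  case: eqP => [->|hne']; first by rewrite ltnn subnn.
  by rewrite ifT //; lia.
rewrite nth_pushenv // ifN; last by apply/eqP; lia.
rewrite nth_takecat; last lia.
rewrite ifN; last lia.
case hd : (i - (n - k.+1)) => [|d] /=; first lia.
rewrite nth_cmap nth_drop cmap_comp (_ : (n - k.+1).+1 + d = i); last lia.
have hsz : allc (fun y => size y = n) (nth Base env i).
  suff : allc (fun y => size y = n) (enc c.2) by rewrite E => /allc_cloE [].
  apply/allc_clabels => y; rewrite -(leafpos_enc hc) => /In_mem hy.
  by have [_ ->] := canon_leaf hc hy.
have := hW' d; rewrite nth_cmap nth_drop (_ : (n - k.+1).+1 + d = i); last lia.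
move=> /allc_cmap hmem; rewrite cmap_id_allc //.
apply/allc_clabels => y hy; rewrite /= hst.
have -> := proj1 (allc_clabels _ _) hmem y hy.
by apply: hdi; exact: (proj1 (allc_clabels _ _) hsz y hy).
Qed.

Definition cstep c (a : option A) : option config :=
  if topsym n c.2 is Some g then
    match delta c.1 g, a with
    | Read f, Some a => Some (f a, c.2)
    | Op q' o, None => omap (pair q') (apply_op n o c.2)
    | _, _ => None
    end
  else None.

Fixpoint cexec c cs : option config :=
  if cs is a :: cs' then obind (cexec^~ cs') (cstep c a) else Some c.

Fixpoint ctrace c cs : seq config :=
  c :: (if cs is a :: cs' then
          if cstep c a is Some c' then ctrace c' cs' else [::]
        else [::]).

Definition cst c : Q * clo G unit := (c.1, erase (enc c.2)).

Lemma cstepP c a : valid c ->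
  match cstep c a, estep (c.1, enc c.2) a with
  | Some c', Some (q, v) =>
      [/\ valid c', q = c'.1, v = cmap (histstep c c') (enc c'.2), step c c' & lab c c' = a]
  | None, None => True
  | _, _ => False
  end.
Proof.
move=> hv; have [g [x [env [E _ _ _ _]]]] := valid_enc hv.
have hts := topsym_enc hv E.
rewrite /cstep /estep /Defs.step /Defs.lab hts E /=.
case Ed : (delta c.1 g) => [f|q' o]; case: a => [a|] //=.
  split=> //; [|by split=> //; exists a|].
    rewrite -{1}E cmap_id_allc //; apply/allc_clabels => y _.
    by rewrite /Defs.histstep hts Ed.
  have hf : injective f by have := wf_delta c.1 g; rewrite Ed.
  by case: pickP => [b /eqP /hf -> //|/(_ a)]; rewrite eqxx.
have := apply_op_enc hv E Ed; rewrite E.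
by case: (apply_op n o c.2) => [s'|]; case: (eop o _) => [v|] //= [].
Qed.

Lemma step_cstep c c' : valid c -> step c c' -> exists a, cstep c a = Some c'.
Proof.
move=> hv; rewrite /Defs.step /cstep; case: (topsym n c.2) => // g.
case: c' => [q' s'] /=; case: (delta c.1 g) => [f [[a <-] ->]|q o [-> E]].
  by exists (Some a).
by exists None; rewrite E.
Qed.

Lemma cstep_lab c c' a : valid c -> cstep c a = Some c' ->
  [/\ valid c', step c c' & lab c c' = a].
Proof.
move=> hv E; have := cstepP a hv; rewrite E.
by case: (estep _ _) => [[q v]|] // [].
Qed.

Lemma size_ctrace cs c c' : cexec c cs = Some c' -> size (ctrace c cs) = (size cs).+1.
Proof. by elim: cs c => [|a cs IH] c //=; case: (cstep c a) => //= c1 /IH ->. Qed.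

Lemma cexec_cat c cs1 cs2 : cexec c (cs1 ++ cs2) = obind (cexec^~ cs2) (cexec c cs1).
Proof. by elim: cs1 c => //= a cs IH c; case: (cstep c a) => //=. Qed.

Lemma last_ctrace cs c c' d : cexec c cs = Some c' -> last d (ctrace c cs) = c'.
Proof.
elim: cs c d => [|a cs IH] c d /=; first by case.
by case: (cstep c a) => //= c1; exact: IH.
Qed.

Lemma ohead_ctrace c cs : ohead (ctrace c cs) = Some c.
Proof. by case: cs. Qed.

Lemma rlast_ctrace cs c c' : cexec c cs = Some c' -> rlast (ctrace c cs) = Some c'.
Proof.
move=> E; rewrite /rlast -(last_ctrace c E).
have : ctrace c cs <> [::] by case: (cs).
by case/lastP: (ctrace c cs) => // s y _; rewrite rev_rcons last_rcons.
Qed.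

Lemma rlen_ctrace cs c c' : cexec c cs = Some c' -> rlen (ctrace c cs) = size cs.
Proof. by rewrite /rlen => /size_ctrace ->. Qed.

Lemma drop_ctrace c cs1 d cs2 : cexec c cs1 = Some d ->
  drop (size cs1) (ctrace c (cs1 ++ cs2)) = ctrace d cs2.
Proof.
elim: cs1 c => [|a cs IH] c /=; first by case=> ->; rewrite drop0.
by case: (cstep c a) => //= c1; exact: IH.
Qed.

Lemma take_ctrace c cs1 d cs2 : cexec c cs1 = Some d ->
  take (size cs1).+1 (ctrace c (cs1 ++ cs2)) = ctrace c cs1.
Proof.
elim: cs1 c => [|a cs IH] c /=; first by case: cs2 => [|b cs2] _ /=; rewrite ?take0.
by case: (cstep c a) => //= c1 /IH ->.
Qed.

(** Started with positions as labels, the environment machine ends with every 0-stack labelled by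
    its history. *)
Lemma ctrace_run cs c c' : valid c -> cexec c cs = Some c' ->
  [/\ valid c', is_run (ctrace c cs), word (ctrace c cs) = pmap id cs &
   exec (c.1, enc c.2) cs = Some (c'.1, cmap (hist (ctrace c cs)) (enc c'.2))].
Proof.
elim: cs c => [|a cs IH] c hv /=.
  case=> <-; split=> //; first by split=> // d [<-|].
  by rewrite cmap_id_allc //; apply/allc_clabels.
have := cstepP a hv; case E : (cstep c a) => [c1|] //=.
case: (estep _ _) => [[q v]|] // [hv1 -> -> hst hlab] Ex.
have [h1 [h2 h3] h4 h5] := IH _ hv1 Ex.
have ec : exists l, ctrace c1 cs = c1 :: l by case: (cs) => [|b cs'] /=; eexists.
case: ec => l ec; split=> //.
- split; first by move=> d [<-|] //; exact: h2.
  by rewrite ec /=; split=> //; move: h3; rewrite ec.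
- by move: h4; rewrite ec /= hlab => <-; case: (a).
- by rewrite /= exec_cmap h5 /= cmap_comp ec.
Qed.

Lemma cexec_cst cs c c' : valid c -> cexec c cs = Some c' -> exec (cst c) cs = Some (cst c').
Proof.
move=> hv E; have [_ _ _ h] := ctrace_run hv E.
by rewrite /cst /erase exec_cmap h /= cmap_comp.
Qed.

Lemma exec_cexec cs c q v : valid c -> exec (cst c) cs = Some (q, v) ->
  exists2 c', cexec c cs = Some c' & cst c' = (q, v).
Proof.
rewrite /cst => hv E; suff [c' Ec'] : exists c', cexec c cs = Some c'.
  by exists c' => //; have := cexec_cst hv Ec'; rewrite /cst E => -[-> ->].
have [w Ew _] : exists2 w, exec (c.1, enc c.2) cs = Some (q, w) & erase w = erase v.
  exact: exec_erase (erase_cmap _ _) E.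
elim: cs c q v w hv {E} Ew => [|a cs IH] c q v w hv /=; first by exists c.
have := cstepP a hv; case: (cstep c a) => [c1|] //=; last first.
  by case: (estep _ _).
case: (estep _ _) => [[q1 v1]|] //= [hv1 -> -> _ _].
rewrite exec_cmap; case Ex : (exec (c1.1, enc c1.2) cs) => [[q2 v2]|] //= _.
exact: IH hv1 Ex.
Qed.

Lemma is_run_ctrace R c : is_run R -> ohead R = Some c ->
  exists cs c', R = ctrace c cs /\ cexec c cs = Some c'.
Proof.
case: R => // c0 R [hv hst] [E]; subst c0.
elim: R c hv hst => [|c1 R IH] c hv /=; first by exists [::], c.
case=> hst1 hst.
have hvc : valid c by apply: hv; left.
have [a Ea] := step_cstep hvc hst1.
have [|cs [c' [-> Ecs]]] := IH c1 _ hst; first by move=> d hd; apply: hv; right.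
by exists (a :: cs), c'; rewrite /= Ea.
Qed.

Lemma upper_lev c cs c' k : valid c -> cexec c cs = Some c' -> k <= n ->
  upper k (ctrace c cs) <-> lev (cst c) cs <= k.
Proof.
move=> hv Ec hk; have [hv' _ _ Ex] := ctrace_run hv Ec.
have [g [x [env [E hcan hwf hsx hbel]]]] := valid_enc hv.
have [g' [x' [env' [E' hcan' hwf' hsx' hbel']]]] := valid_enc hv'.
set h := hist (ctrace c cs) in Ex *.
have [hs _] : size env = n /\ True by move: hwf; rewrite E => /wfc_cloE [].
(* [S y l] says that [l] is the least j for which [y] agrees with the topmost position [x] on the n
   - j coordinates identifying the topmost j-stack. *)
pose S y (l : nat) := forall j, j <= n -> take (n - j) y = take (n - j) x <-> l <= j.
have hS : crel S (enc c.2) (ereg (erase (enc c.2))).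
  rewrite E /=; apply: crel_Clo; first by [].
  split=> [|i]; first by rewrite size_renv size_map.
  rewrite nth_renv nth_cmap cmap_comp.
  case: (ltnP i n) => hi; last first.
    by rewrite nth_default ?hs //; constructor.
  apply: (@crel_of_allc_imp _ _ _ (below x i) (fun l => l = n - i)).
  - move=> y l [hy1 hy2] -> j hj; split=> [htk|hij].
      rewrite leqNgt; apply/negP => hlt.
      have : nth 0 (take (n - j) y) i = nth 0 (take (n - j) x) i by rewrite htk.
      by rewrite !nth_take; lia.
    have hle : n - j <= i by lia.
    by rewrite -(take_takel y hle) hy1 take_takel.
  - by rewrite erase_cmap.
  - exact: hbel.
  - exact: allc_const.
have [w Ew hw] := exec_crel hS Ex.
rewrite E' /= in hw; have [l' [ew [def_w hl' hsz hcr]]] := crel_cloE hw; subst w.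
have hlev : lev (cst c) cs = l' by rewrite /lev /= Ew.
have hupd : upper k (ctrace c cs) <->
    (forall y, y \in leafpos (topk n k c'.2) -> h y \in leafpos (topk n k c.2)).
  have := last_ctrace c Ec; rewrite /h; case: (cs) => [|a cs'] /=; first by move=> ->.
  by move=> ->.
(* One direction needs only the topmost 0-stack. The converse needs that all labels in the final
   topmost k-stack are at most k, by [topk_homog], and that histories are positions of the initial
   stack. *)
rewrite hupd hlev; split=> [hu|hle y hy].
  apply/(hl' k hk); apply: (mem_topk hv E hk); apply: hu.
  rewrite (leafpos_topk hv' E' hk); apply/In_mem; rewrite /= -cats1.
  by apply/List.in_app_iff; right; left.
have hw2 : wfc n (ereg (erase (enc c.2))).
  by apply: wfc_erase hwf; rewrite erase_ereg erase_cmap.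
have hwe : wfc n (erase (enc c.2)) by exact: wfc_cmap.
have hall := topk_homog hk hwe Ew hle.
have hPy : take (n - k) (h y) = take (n - k) x.
  have hcr2 : crel (fun z l => S (h z) l) (Clo g' x' (drop (n - k) env'))
      (Clo g' l' (drop (n - k) ew)).
    have cr_cmap (v : clo G (seq nat)) (u : clo G nat) :
        crel S (cmap h v) u -> crel (fun z l => S (h z) l) v u.
      elim/clo_nested_ind: v u => [|g1 a e IH] u /crel_cloE /=.
        by move=> ->; constructor.
      case=> [l1 [e1 [-> ha hs1 he1]]]; constructor=> //; first by rewrite -hs1 size_map.
      by move=> i; apply: IH; rewrite -nth_cmap.
    apply: crel_Clo => //; apply: crels_drop; split; first by rewrite -hsz size_map.
    by move=> i; apply: cr_cmap; rewrite -nth_cmap.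
  have hle2 : allc (fun l => l <= k) (Clo g' l' (drop (n - k) ew)).
    by constructor=> // i; rewrite nth_drop; apply: hall; lia.
  have allc_l (v : clo G (seq nat)) (u : clo G nat) : crel (fun z l => S (h z) l) v u ->
      allc (fun l => l <= k) u -> allc (fun z => take (n - k) (h z) = take (n - k) x) v.
    elim=> [|g1 a b e e1 hab hs1 _ IH] hu; first by constructor.
    have [hb he1] := allc_cloE hu; constructor; first by apply/(hab k hk).
    by move=> i; apply: IH.
  apply: (proj1 (allc_clabels _ _) (allc_l _ _ hcr2 hle2)).
  by rewrite -(leafpos_topk hv' E' hk); apply/In_mem.
have hin : List.In (h y) (clabels (enc c.2)).
  have : allc (fun z => List.In z (clabels (enc c.2))) (enc c.2) by apply/allc_clabels.
  move=> hall0; have := exec_allc hall0 Ex; rewrite E' => /allc_cmap /allc_clabels; apply.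
  have : y \in leafpos c'.2.
    have := hy; rewrite (leafpos_topk hv' E' hk) (leafpos_enc hcan') E' /= !mem_rcons !inE.
    case/orP=> [->//|/In_mem /In_flatten_nth [i hi]]; apply/orP; right; apply/In_mem.
    apply/In_flatten_nth; exists (n - k + i); move: hi.
    by rewrite map_drop nth_drop.
  by rewrite (leafpos_enc hcan') E' => /In_mem.
rewrite (leafpos_topk hv E hk); apply/In_mem.
move: hin; rewrite E /= -!cats1 => /List.in_app_iff [|hin]; last by apply/List.in_app_iff; right.
move=> /In_flatten_nth [i]; have -> : nth [::] [seq clabels z | z <- env] i = clabels (nth Base env i).
  case: (ltnP i (size env)) => hi; first by rewrite (nth_map Base).
  by rewrite !nth_default ?size_map.
move=> hin; have [hb1 hb2] := proj1 (allc_clabels _ _) (hbel i) _ hin.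
apply/List.in_app_iff; left; apply/In_flatten_nth; exists (i - (n - k)).
case: (ltnP i (n - k)) => hi.
  have : nth 0 (take (n - k) (h y)) i = nth 0 (take (n - k) x) i by rewrite hPy.
  by rewrite !nth_take //; lia.
rewrite map_drop nth_drop subnKC //.
case: (ltnP i (size env)) => hi2; first by rewrite (nth_map Base).
by move: hin; rewrite nth_default.
Qed.

(** * Decomposition into shortest upper suffixes *)

Fixpoint segments c ps : seq (seq config) :=
  if ps is p :: ps' then
    ctrace c p :: (if cexec c p is Some c' then segments c' ps' else [::])
  else [::].

Lemma cst_wf c : valid c -> wfc n (cst c).2.
Proof.
move=> hv; have [g [x [env [_ _ hw _ _]]]] := valid_enc hv.
exact: wfc_cmap.
Qed.

Lemma cst_Clo c : valid c -> exists g env, cst c = (c.1, Clo g tt env).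
Proof.
move=> hv; have [g [x [env [E _ _ _ _]]]] := valid_enc hv.
by exists g, (map (@erase G _) env); rewrite /cst E.
Qed.

(** The last factor is k-upper by [piece_lev], and [piece_suffix] excludes every shorter k-upper
    suffix. *)
Lemma kdecomp_piece k c0 cs0 c parts0 q g env p q1 g1 env1 : k <= n ->
  valid c0 -> cexec c0 cs0 = Some c -> cst c = (q, Clo g tt env) ->
  piece k q g env p q1 g1 env1 ->
  kdecomp k (ctrace c0 cs0) parts0 ->
  kdecomp k (ctrace c0 (cs0 ++ p)) (rcons parts0 (ctrace c p)).
Proof.
move=> hk hv E0 Ec hp hd.
have [hvc _ _ _] := ctrace_run hv E0.
have hwf : wfc n (Clo g tt env) by have := cst_wf hvc; rewrite Ec.
have Ep := piece_exec hwf hp.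
have [c1 Ec1 _] : exists2 c1, cexec c p = Some c1 & cst c1 = (q1, Clo g1 tt env1).
  by apply: (exec_cexec hvc); rewrite Ec.
have E01 : cexec c0 (cs0 ++ p) = Some c1 by rewrite cexec_cat E0.
have hlen := rlen_ctrace E01.
have hp0 : 0 < size p by case: hp.
have hsubj p1 p2 d : p = p1 ++ p2 -> cexec c p1 = Some d ->
    sub (ctrace c0 (cs0 ++ p)) (size cs0 + size p1) (rlen (ctrace c0 (cs0 ++ p))) = ctrace d p2.
  move=> ep Ed; rewrite hlen /sub ep catA -size_cat (drop_ctrace (d := d)); last first.
    by rewrite cexec_cat E0.
  rewrite take_oversize //.
  have Ed2 : cexec d p2 = Some c1 by move: Ec1; rewrite ep cexec_cat Ed.
  by rewrite (size_ctrace Ed2) !size_cat; lia.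
have hsub : sub (ctrace c0 (cs0 ++ p)) (size cs0) (rlen (ctrace c0 (cs0 ++ p))) = ctrace c p.
  by rewrite -(hsubj [::] p c) // addn0.
rewrite -hsub; apply: kd_snoc.
- by rewrite hlen size_cat; lia.
- by rewrite hsub; apply/(upper_lev hvc Ec1 hk); rewrite Ec; exact: piece_lev hwf hp.
- move=> j; rewrite hlen size_cat => hj.
  have ep : p = take (j - size cs0) p ++ drop (j - size cs0) p by rewrite cat_take_drop.
  have [d Ed] : exists d, cexec c (take (j - size cs0) p) = Some d.
    by move: Ec1; rewrite {1}ep cexec_cat; case: (cexec c _) => // d _; exists d.
  have hst : size (take (j - size cs0) p) = j - size cs0 by rewrite size_takel; lia.
  have hj' : j = size cs0 + size (take (j - size cs0) p) by lia.
  have [hvd _ _ _] := ctrace_run hvc Ed.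
  have Ed2 : cexec d (drop (j - size cs0) p) = Some c1.
    by move: Ec1; rewrite {1}ep cexec_cat Ed.
  rewrite -size_cat -(rlen_ctrace E01) hj' (hsubj _ _ _ ep Ed).
  move/(upper_lev hvd Ed2 hk); apply/negP; rewrite -ltnNge.
  have [gd [ed Ecd]] := cst_Clo hvd.
  have := cexec_cst hvc Ed; rewrite Ec Ecd => Ed3.
  apply: (piece_suffix hwf hp ep) Ed3.
    by move=> h0; move: hst; rewrite h0 /=; lia.
  by move=> h0; have := size_drop (j - size cs0) p; rewrite h0 /=; lia.
- suff -> : sub (ctrace c0 (cs0 ++ p)) 0 (size cs0) = ctrace c0 cs0 by [].
  by rewrite /sub drop0 subn0 (take_ctrace _ E0).
Qed.

(** [up] is built from the front while [kdecomp] cuts from the back, so the prefix [cs0] that is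
    already decomposed is carried as an accumulator. *)
Lemma kdecomp_up k q g env ps q1 g1 env1 : k <= n ->
  up k q g env ps q1 g1 env1 ->
  forall c0 cs0 c parts0, valid c0 -> cexec c0 cs0 = Some c ->
  cst c = (q, Clo g tt env) -> kdecomp k (ctrace c0 cs0) parts0 ->
  kdecomp k (ctrace c0 (cs0 ++ flatten ps)) (parts0 ++ segments c ps).
Proof.
move=> hk; elim=> {q g env ps q1 g1 env1} [q g env|q g env p q1 g1 env1 ps q2 g2 env2 hp _ IH]
  c0 cs0 c parts0 hv E0 Ec hd; first by rewrite !cats0.
have [hvc _ _ _] := ctrace_run hv E0.
have hwf : wfc n (Clo g tt env) by have := cst_wf hvc; rewrite Ec.
have Ep := piece_exec hwf hp.
have [c1 Ec1 Ecc] : exists2 c1, cexec c p = Some c1 & cst c1 = (q1, Clo g1 tt env1).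
  by apply: (exec_cexec hvc); rewrite Ec.
rewrite /= catA Ec1 -cat_rcons; apply: IH Ecc _ => //; first by rewrite cexec_cat E0.
exact: kdecomp_piece hp _.
Qed.

Lemma size_segments c ps c' : cexec c (flatten ps) = Some c' ->
  size (segments c ps) = size ps.
Proof.
elim: ps c => //= p ps IH c; rewrite cexec_cat; case: (cexec c p) => //= c1 /IH ->.
by [].
Qed.

Lemma nth_segments c ps c' i : cexec c (flatten ps) = Some c' -> i < size ps ->
  exists d d', [/\ cexec c (flatten (take i ps)) = Some d,
    cexec d (nth [::] ps i) = Some d' &
    nth [::] (segments c ps) i = ctrace d (nth [::] ps i)].
Proof.
elim: ps c i => //= p ps IH c [|i]; rewrite cexec_cat; case E : (cexec c p) => [c1|] //= Ec hi.
  by exists c, c1.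
by have [d [d' [h1 h2 h3]]] := IH _ i Ec hi; exists d, d'; rewrite cexec_cat E.
Qed.

End Traces.

(** * Types of stacks *)

Section Types.
Variables (M : finType) (mul : M -> M -> M) (one : M) (phi : seq A -> M).
Hypothesis phi_nil : phi [::] = one.
Hypothesis phi_cat : forall u v, phi (u ++ v) = mul (phi u) (phi v).

Definition val_of (cs : seq (option A)) : M := phi (pmap id cs).

Lemma val_cat cs1 cs2 : val_of (cs1 ++ cs2) = mul (val_of cs1) (val_of cs2).
Proof. by rewrite /val_of pmap_cat phi_cat. Qed.

Lemma val_None cs : val_of (None :: cs) = val_of cs.
Proof. by []. Qed.

Lemma val_Some a cs : val_of (Some a :: cs) = mul (phi [:: a]) (val_of cs).
Proof. by rewrite /val_of /= -phi_cat. Qed.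

(* [Desc q X m r q' F], as a type of a k-stack s^k, says: from the state [q]
   and a stack s^n:...:s^k whose upper components have the types listed in
   [X], some [ret]-run of level [r] and value [m] leads to the state [q'] with
   the components n,...,r+1 having the types listed in [F]. *)
Inductive desc : Type :=
  Desc of Q & seq (seq desc) & M & nat & Q & seq (seq desc).

Fixpoint sat (d : desc) (v : clo G unit) {struct d} : Prop :=
  match d with
  | Desc q X m r q' F =>
      if v is Clo g _ env then
        forall us, all2P (fun x u => allP (fun d' => sat d' u) x) X us ->
        exists cs e, [/\ ret r q g (us ++ env) cs q' e, val_of cs = m &
          all2P (fun x u => allP (fun d' => sat d' u) x) F e]
      else False
  end.

Definition sats (x : seq desc) (v : clo G unit) : Prop := allP (sat^~ v) x.

Definition satl (X : seq (seq desc)) (us : seq (clo G unit)) : Prop :=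
  size X = size us /\ forall i, sats (nth [::] X i) (nth Base us i).

Lemma satlP X us :
  all2P (fun x u => allP (fun d' => sat d' u) x) X us <-> satl X us.
Proof. exact: all2P_nth. Qed.

Lemma satl_cat X X' us us' : satl X us -> satl X' us' -> satl (X ++ X') (us ++ us').
Proof.
move=> [s1 h1] [s2 h2]; split=> [|i]; first by rewrite !size_cat s1 s2.
by rewrite !nth_cat s1; case: ifP.
Qed.

Lemma satl_take j X us : satl X us -> satl (take j X) (take j us).
Proof.
move=> [s h]; split=> [|i]; first by rewrite !size_take_min s.
case: (ltnP i j) => hi; first by rewrite !nth_take.
by rewrite nth_default // size_take_min; lia.
Qed.

Lemma satl_drop j X us : satl X us -> satl (drop j X) (drop j us).
Proof.
move=> [s h]; split=> [|i]; first by rewrite !size_drop s.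
by rewrite !nth_drop.
Qed.

Lemma satl_cons x X u us : sats x u -> satl X us -> satl (x :: X) (u :: us).
Proof. by move=> h [s hs]; split=> [|[|i]] //=; rewrite s. Qed.

Definition pushtp j (Th : seq desc) (Psi : seq (seq desc)) :=
  take (n - j) Psi ++ Th :: drop (n - j).+1 Psi.

(* The rules mirror those of [ret]; a component created by a push receives a
   finite set [Th] of types that have been derived for it. *)
Inductive der : Q -> G -> seq (seq desc) -> M -> nat -> Q -> seq (seq desc) -> Prop :=
| der_pop q g Psi r q' :
    delta q g = Op q' (Pop r) -> der q g Psi one r q' (take (n - r) Psi)
| der_read q g Psi f a m r q' Phi :
    delta q g = Read f -> der (f a) g Psi m r q' Phi ->
    der q g Psi (mul (phi [:: a]) m) r q' Phi
| der_popc q g Psi q1 j m r q' Phi :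
    delta q g = Op q1 (Pop j) -> j < r ->
    List.In (Desc q1 (take (n - j) Psi) m r q' Phi) (nth [::] Psi (n - j)) ->
    der q g Psi m r q' Phi
| der_pusha q g Psi q1 j g1 Th m r q' Phi :
    delta q g = Op q1 (Push j g1) -> j <> r ->
    (forall q2 X m2 r2 q3 F, List.In (Desc q2 X m2 r2 q3 F) Th ->
       der q2 g (X ++ drop (n - j) Psi) m2 r2 q3 F) ->
    der q1 g1 (pushtp j Th Psi) m r q' Phi ->
    der q g Psi m r q' Phi
| der_pushb q g Psi q1 j g1 Th m1 q4 X4 m r q' Phi :
    delta q g = Op q1 (Push j g1) -> r <= j ->
    (forall q2 X m2 r2 q3 F, List.In (Desc q2 X m2 r2 q3 F) Th ->
       der q2 g (X ++ drop (n - j) Psi) m2 r2 q3 F) ->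
    der q1 g1 (pushtp j Th Psi) m1 j q4 X4 ->
    der q4 g (X4 ++ drop (n - j) Psi) m r q' Phi ->
    der q g Psi (mul m1 m) r q' Phi.

(** The types in [Th] have been derived for the closure stored by a push, so by their own induction
    hypotheses they hold of it, and the environment after the push satisfies [pushtp j Th Psi]. *)
Lemma der_sound q g Psi m r q' Phi : der q g Psi m r q' Phi ->
  forall env, satl Psi env ->
  exists cs e, [/\ ret r q g env cs q' e, val_of cs = m & satl Phi e].
Proof.
have th_sats j g1 Th Psi1 env :
    (forall q2 X m2 r2 q3 F, List.In (Desc q2 X m2 r2 q3 F) Th ->
      forall us, satl (X ++ drop (n - j) Psi1) us ->
      exists cs e, [/\ ret r2 q2 g1 us cs q3 e, val_of cs = m2 & satl F e]) ->
    satl Psi1 env -> sats Th (Clo g1 tt (drop (n - j) env)).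
  move=> hTh henv; apply/allP_In => -[q2 X m2 r2 q3 F] /hTh {}hTh us /satlP hus.
  have [cs [e [h1 h2 h3]]] := hTh _ (satl_cat hus (satl_drop (n - j) henv)).
  by exists cs, e; split=> //; apply/satlP.
have pushed j g1 Th Psi1 env : sats Th (Clo g1 tt (drop (n - j) env)) ->
    satl Psi1 env -> satl (pushtp j Th Psi1) (pushenv j g1 tt env).
  move=> hTh h; apply: satl_cat; first exact: satl_take.
  by apply: satl_cons => //; exact: satl_drop.
elim=> {q g Psi m r q' Phi}.
- move=> q g Psi r q' E env h; exists [:: None], (take (n - r) env).
  split; [exact: ret_pop|exact: phi_nil|exact: satl_take].
- move=> q g Psi f a m r q' Phi E _ IH env /IH [cs [e [h1 h2 h3]]].
  by exists (Some a :: cs), e; split=> //; [exact: ret_read h1|rewrite val_Some h2].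
- move=> q g Psi q1 j m r q' Phi E hj hin env henv.
  have := (proj1 (allP_In _ _)) (henv.2 (n - j)) _ hin.
  case En : (nth Base env (n - j)) => [|g1 [] env1] //=.
  move=> /(_ (take (n - j) env)) [|cs [e [h1 h2 /satlP h3]]].
    by apply/satlP; exact: satl_take.
  exists (None :: cs), e; split=> //; exact: ret_popc E hj En h1.
- move=> q g Psi q1 j g1 Th m r q' Phi E hj _ hTh _ IH env henv.
  have [cs [e [h1 h2 h3]]] := IH _ (pushed _ _ _ _ _ (th_sats _ _ _ _ _ hTh henv) henv).
  exists (None :: cs), e; split=> //; exact: ret_pusha E hj h1.
move=> q g Psi q1 j g1 Th m1 q4 X4 m r q' Phi E hj _ hTh _ IH1 _ IH2 env henv.
have [c1 [e1 [h1 h2 h3]]] := IH1 _ (pushed _ _ _ _ _ (th_sats _ _ _ _ _ hTh henv) henv).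
have [c2 [e2 [k1 k2 k3]]] := IH2 _ (satl_cat h3 (satl_drop (n - j) henv)).
exists (None :: c1 ++ c2), e2; split=> //; first exact: ret_pushb E hj h1 k1.
by rewrite val_None val_cat h2 k2.
Qed.

(** * Finiteness and completeness of types *)

(** A type of a stack refers only to types of stacks of higher level, whose possible sets are built
    from [us]; hence all types can be listed from level n downwards. *)
Definition mkdescs (us : seq (seq desc)) : seq desc :=
  List.flat_map (fun q => List.flat_map (fun X => List.flat_map (fun m =>
  List.flat_map (fun r => List.flat_map (fun q' =>
    map (Desc q X m r q') (prods (map (@powl _) (take (n - r) us))))
  (enum Q)) (iota 0 n.+1)) (enum M)) (prods (map (@powl _) us))) (enum Q).

(* The i-th entry of [univ j], i < j, lists all types of (n-i)-stacks. *)
Fixpoint univ (j : nat) : seq (seq desc) :=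
  if j is j'.+1 then rcons (univ j') (mkdescs (univ j')) else [::].

Definition okdesc (g : G) (Psi : seq (seq desc)) (d : desc) : Prop :=
  let: Desc q X m r q' F := d in der q g (X ++ Psi) m r q' F.

(** Keeping the derivable types makes this finite set a function of the symbol and of the sets [tp]
    of the components. *)
Fixpoint tp (v : clo G unit) : seq desc :=
  if v is Clo g _ env then
    List.filter (fun d => decb (okdesc g (map tp env) d))
                (mkdescs (univ (n - size env)))
  else [::].

Lemma size_univ j : size (univ j) = j.
Proof. by elim: j => //= j IH; rewrite size_rcons IH. Qed.

Lemma nth_univ j i : i < j -> nth [::] (univ j) i = mkdescs (univ i).
Proof.
elim: j => //= j IH hi; rewrite nth_rcons size_univ.
by case: ltngtP => [/IH|hji|->] //; exfalso; lia.
Qed.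

Lemma take_univ j i : i <= j -> take i (univ j) = univ i.
Proof.
move=> hi; apply: (eq_from_nth (x0 := [::])).
  by rewrite size_takel !size_univ.
move=> m; rewrite size_takel ?size_univ // => hm.
by rewrite nth_take // !nth_univ //; lia.
Qed.

Lemma nth_tp (env : seq (clo G unit)) i :
  nth [::] (map tp env) i = tp (nth Base env i).
Proof.
case: (ltnP i (size env)) => h; first by rewrite (nth_map Base).
by rewrite !nth_default ?size_map.
Qed.

Lemma tp_univ k v : wfc k v -> List.In (tp v) (powl (mkdescs (univ (n - k)))).
Proof.
case: v => [|g l env] h; first exact: In_powl_nil.
by have [<- _] := wfc_cloE h; exact: In_powl_filter.
Qed.

Lemma tps_univ j e : j <= n -> size e = j ->
  (forall i, wfc (n - i) (nth Base e i)) ->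
  List.In (map tp e) (prods (map (@powl _) (univ j))).
Proof.
move=> hj hs hw; apply: (@In_prods _ [::]); first by rewrite !size_map size_univ.
move=> i; rewrite size_map size_univ => hi.
rewrite (nth_map [::]) ?size_univ // nth_univ // nth_tp.
by move: (tp_univ (hw i)); rewrite subKn //; lia.
Qed.

Lemma In_tp g env d : List.In d (tp (Clo g tt env)) -> okdesc g (map tp env) d.
Proof. by move=> /List.filter_In [_ /decbP]. Qed.

Lemma map_tp_pushenv j g env :
  map tp (pushenv j g tt env) = pushtp j (tp (Clo g tt (drop (n - j) env))) (map tp env).
Proof. by rewrite /pushenv /pushtp map_cat map_take map_cons map_drop. Qed.

(** A push uses for [Th] the whole [tp] of the stored closure. For a pop inside the return, the type
    describing the rest of the run is in [tp] of the entered closure: it is derivable by induction,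
    and its entries come from the finite lists. *)
Lemma der_complete r q g env cs q' e : ret r q g env cs q' e ->
  wfc n (Clo g tt env) -> der q g (map tp env) (val_of cs) r q' (map tp e).
Proof.
have hth g1 j env1 : forall q2 X m2 r2 q3 F,
    List.In (Desc q2 X m2 r2 q3 F) (tp (Clo g1 tt (drop (n - j) env1))) ->
    der q2 g1 (X ++ drop (n - j) (map tp env1)) m2 r2 q3 F.
  by move=> q2 X m2 r2 q3 F /In_tp; rewrite -map_drop.
elim=> {r q g env cs q' e}.
- move=> r q g env q' E _.
  rewrite map_take (_ : val_of _ = one); first exact: der_pop.
  exact: phi_nil.
- move=> r q g env f a cs q' e E _ IH hwf.
  by rewrite val_Some; apply: der_read E (IH hwf).
- move=> r q g env q1 j g1 env1 cs q' e E hj E1 hret IH hwf.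
  have hjn := op_pop E; have hwf1 := wfc_popped g1 tt hjn hwf E1.
  have [hr hse hwe] := ret_wf hret hwf1.
  have [hs hw] := wfc_cloE hwf.
  have := hw (n - j); rewrite E1 => /wfc_cloE [hs1 _].
  apply: (der_popc E hj); rewrite nth_tp E1; apply/List.filter_In; split; last first.
    by apply/decbP; move: (IH hwf1); rewrite /= map_cat map_take.
  rewrite hs1 (_ : n - (n - (n - j)) = n - j); last lia.
  apply/List.in_flat_map; exists q1; split; first by apply/In_mem; rewrite mem_enum.
  apply/List.in_flat_map; exists (take (n - j) (map tp env)); split.
    rewrite -map_take; apply: tps_univ; [lia|by rewrite size_takel; lia|].
    by move=> i; rewrite nth_take_base; case: ifP => // _; constructor.
  apply/List.in_flat_map; exists (val_of cs); split; first by apply/In_mem; rewrite mem_enum.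
  apply/List.in_flat_map; exists r; split; first by apply/In_mem; rewrite mem_iota; lia.
  apply/List.in_flat_map; exists q'; split; first by apply/In_mem; rewrite mem_enum.
  apply: (List.in_map (Desc q1 _ _ r q')); rewrite take_univ; last lia.
  by apply: tps_univ => //; lia.
- move=> r q g env q1 j g1 cs q' e E hj hret IH hwf.
  have hjn := op_push E; have hwf1 := wfc_pushed g1 tt tt hjn hwf.
  apply: (der_pusha E hj) (hth _ _ _) _.
  by rewrite -map_tp_pushenv; exact: IH.
move=> r q g env q1 j g1 cs1 q2 e2 cs2 q' e E hj hret1 IH1 hret2 IH2 hwf.
have hjn := op_push E; have hwf1 := wfc_pushed g1 tt tt hjn hwf.
have [_ hs2 hwe2] := ret_wf hret1 hwf1.
have hwf2 : wfc n (Clo g tt (e2 ++ drop (n - j) env)).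
  by apply: wfc_catdrop hwf _ _; lia || exact: hwe2.
rewrite val_None val_cat; apply: (der_pushb E hj) (hth _ _ _) _ _.
  by rewrite -map_tp_pushenv; exact: IH1.
by have := IH2 hwf2; rewrite map_cat map_drop.
Qed.

(* Soundness holds for [sat] and completeness for [tp], so simulation relates
   them asymmetrically. *)
Definition dominated (u v : clo G unit) : Prop := sats (tp u) v.

(** A type in [tp] is derived from the sets [tp] of the components of [e]. As these hold of the
    components of [e'], soundness yields the type for the stack over [e']. *)
Lemma dominated_Clo g e e' : size e = size e' ->
  (forall i, dominated (nth Base e i) (nth Base e' i)) ->
  dominated (Clo g tt e) (Clo g tt e').
Proof.
move=> hs h; apply/allP_In => -[q X m r q' F] /In_tp hd us /satlP hus.
have he : satl (map tp e) e' by split=> [|i]; rewrite ?size_map ?nth_tp //; exact: h.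
have [cs [e2 [h1 h2 h3]]] := der_sound hd (satl_cat hus he).
by exists cs, e2; split=> //; apply/satlP.
Qed.

Lemma dominated_refl v : dominated v v.
Proof.
by elim/clo_nested_ind: v => [|g [] env IH] //; exact: dominated_Clo.
Qed.

Lemma satl_dominated e e' : size e = size e' ->
  (forall i, dominated (nth Base e i) (nth Base e' i)) -> satl (map tp e) e'.
Proof. by move=> hs h; split=> [|i]; rewrite ?size_map ?nth_tp //; exact: h. Qed.

Lemma dominated_eq_tp u v : tp u = tp v -> dominated u v.
Proof. by rewrite /dominated => ->; exact: dominated_refl. Qed.

(** * Simulation of upper runs *)

Definition sim (k : nat) (e e' : seq (clo G unit)) : Prop :=
  [/\ size e = size e', forall i, dominated (nth Base e i) (nth Base e' i) &
      forall i, n - k <= i -> nth Base e i = nth Base e' i].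

Lemma sim_drop k j e e' : j <= k -> sim k e e' -> drop (n - j) e = drop (n - j) e'.
Proof.
move=> hj [hs _ h]; apply: eq_env; first by rewrite !size_drop hs.
by move=> i; rewrite !nth_drop; apply: h; lia.
Qed.

Lemma sim_weak k j e e' : j <= k -> sim k e e' -> sim j e e'.
Proof. by move=> hj [hs h1 h2]; split=> // i hi; apply: h2; lia. Qed.

Lemma sim_push k j g e e' : 1 <= j <= n -> size e = n -> sim k e e' ->
  sim k (pushenv j g tt e) (pushenv j g tt e').
Proof.
move=> hj hs /[dup] hsim [hs' h1 h2]; split.
- by rewrite !size_pushenv -?hs'.
- move=> i; rewrite !nth_pushenv -?hs' //; case: eqP => // _.
  by apply: dominated_Clo => [|m]; rewrite ?size_drop -?hs' // !nth_drop; exact: h1.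
- move=> i hi; rewrite !nth_pushenv -?hs' //; case: eqP => [hij|_]; last exact: h2.
  congr Clo; apply: eq_env => [|m]; first by rewrite !size_drop hs'.
  by rewrite !nth_drop; apply: h2; lia.
Qed.

(** One-step factors act alike on both sides, as a pop of order at most k enters a shared component.
    A return may explore components above level k: completeness turns it into a derivation, and
    soundness finds a return of the same value over the other environment. *)
Lemma piece_sim k q g env p q1 g1 env1 env' : piece k q g env p q1 g1 env1 ->
  wfc n (Clo g tt env) -> sim k env env' ->
  exists p' env1', [/\ piece k q g env' p' q1 g1 env1', val_of p' = val_of p &
    sim k env1 env1'].
Proof.
move=> hp; case: hp env' => {q g env p q1 g1 env1}.
- move=> q g env f a E env' hwf hsim; exists [:: Some a], env'; split=> //.
  exact: piece_read.
- move=> q g env q1 j g1 env1 E hj E1 env' hwf [hs h1 h2].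
  have hjn := op_pop E; have [hsn _] := wfc_cloE hwf.
  exists [:: None], (take (n - j) env' ++ env1); split=> //.
    by apply: (piece_pop E hj); rewrite -h2 //; lia.
  split; first by rewrite !size_cat !size_take_min hs.
    move=> i; rewrite !nth_takecat -?hs; try lia.
    by case: ifP => _; [exact: h1|exact: dominated_refl].
  move=> i hi; rewrite !nth_takecat -?hs; try lia.
  by case: ifP => _ //; exact: h2.
- move=> q g env q1 j g1 E env' hwf hsim; exists [:: None], (pushenv j g tt env').
  have [hsn _] := wfc_cloE hwf.
  split=> //; first exact: piece_push.
  by apply: sim_push => //; exact: (op_push E).
move=> q g env q1 j g1 cs q2 e2 E hj hret env' hwf hsim.
have hjn := op_push E; have [hsn _] := wfc_cloE hwf.
have hwf1 := wfc_pushed g1 tt tt hjn hwf.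
have [_ hse _] := ret_wf hret hwf1.
have [hps hpd _] := sim_push g hjn hsn hsim.
have [cs' [e2' [h1 h2 [h3 h4]]]] :=
  der_sound (der_complete hret hwf1) (satl_dominated hps hpd).
rewrite size_map in h3.
case: hsim => hs k1 k2.
exists (None :: cs'), (e2' ++ drop (n - j) env'); split=> //.
  exact: piece_ret E hj h1.
split; first by rewrite !size_cat !size_drop h3 hs.
  move=> i; rewrite !nth_cat -h3; case: ifP => _.
    by move: (h4 i); rewrite nth_tp.
  by rewrite !nth_drop; exact: k1.
move=> i hi; rewrite !nth_cat -h3 hse ifN; last lia.
by rewrite ifN ?nth_drop; [apply: k2|]; lia.
Qed.

(** The last conjunct follows the configurations between the factors, whose topmost k-stacks have to
    be compared for [parallel]. *)
Lemma up_sim k q g env ps q1 g1 env1 : up k q g env ps q1 g1 env1 ->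
  forall env', wfc n (Clo g tt env) -> wfc n (Clo g tt env') -> sim k env env' ->
  exists ps' env1', [/\ up k q g env' ps' q1 g1 env1', map val_of ps' = map val_of ps,
    sim k env1 env1' &
    forall i, exists q2 g2 e2 e2',
      [/\ exec (q, Clo g tt env) (flatten (take i ps)) = Some (q2, Clo g2 tt e2),
      exec (q, Clo g tt env') (flatten (take i ps')) = Some (q2, Clo g2 tt e2') &
      sim k e2 e2']].
Proof.
elim=> {q g env ps q1 g1 env1} [q g env|q g env p q1 g1 env1 ps q2 g2 env2 hp _ IH] env' hwf hwf' hsim.
  exists [::], env'; split=> //; first exact: up_nil.
  by move=> i; exists q, g, env, env'.
have [p' [env1' [h1 h2 h3]]] := piece_sim hp hwf hsim.
have hwf1 := piece_wf hwf hp; have hwf1' := piece_wf hwf' h1.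
have [ps' [env2' [k1 k2 k3 k4]]] := IH _ hwf1 hwf1' h3.
exists (p' :: ps'), env2'; split=> //.
- exact: up_cons h1 k1.
- by rewrite /= h2 k2.
case=> [|i]; first by exists q, g, env, env'.
have [q3 [g3 [e3 [e3' [l1 l2 l3]]]]] := k4 i; exists q3, g3, e3, e3'.
by rewrite /= !exec_cat (piece_exec hwf hp) (piece_exec hwf' h1).
Qed.

Lemma val_flatten_eq ps ps' : map val_of ps' = map val_of ps ->
  val_of (flatten ps') = val_of (flatten ps).
Proof.
elim: ps ps' => [|p ps IH] [|p' ps'] //= [h1 /IH h2].
by rewrite !val_cat h1 h2.
Qed.

Lemma sim_posdown k c c' q g e e' : valid c -> valid c' -> k <= n ->
  cst c = (q, Clo g tt e) -> cst c' = (q, Clo g tt e') ->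
  drop (n - k) e = drop (n - k) e' ->
  posdown (topk n k c.2) = posdown (topk n k c'.2).
Proof.
move=> hv hv' hk Ec Ec' hd.
have [g1 [x1 [e1 [E1 hc1 _ _ _]]]] := valid_enc hv.
have [g2 [x2 [e2 [E2 hc2 _ _ _]]]] := valid_enc hv'.
have [h1 [p1 [_ k1 _]]] := enc_topd hc1 E1 (leq_subr k n).
have [h2 [p2 [_ k2 _]]] := enc_topd hc2 E2 (leq_subr k n).
apply: (posdown_enc k1 k2); rewrite h1 h2 /erase /=.
move: Ec Ec'; rewrite /cst E1 E2 /erase /= => -[_ -> he1] [_ -> he2].
by rewrite !map_drop he1 he2 hd.
Qed.

Lemma parallel_sim k c c' cs d q g e e' : k <= n -> valid c -> valid c' ->
  cst c = (q, Clo g tt e) -> cst c' = (q, Clo g tt e') -> sim k e e' ->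
  cexec c cs = Some d -> upper k (ctrace c cs) ->
  exists cs' d', cexec c' cs' = Some d' /\
    parallel n delta phi k (ctrace c' cs') (ctrace c cs).
Proof.
move=> hk hv hv' Ec Ec' hsim Ed hu.
have hlev := proj1 (upper_lev hv Ed hk) hu.
have hwf : wfc n (Clo g tt e) by have := cst_wf hv; rewrite Ec.
have hwf' : wfc n (Clo g tt e') by have := cst_wf hv'; rewrite Ec'.
have [hvd _ _ _] := ctrace_run hv Ed.
have [gd [ed Ecd]] := cst_Clo hvd.
have Ex : exec (q, Clo g tt e) cs = Some (d.1, Clo gd tt ed).
  by rewrite -Ec -Ecd; exact: cexec_cst.
rewrite Ec in hlev.
have [ps eps hup] := up_parse (leqnn _) hwf Ex hlev.
have [ps' [ed' [hup' hval hsim' hmid]]] :=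
  up_sim hup hwf hwf' hsim.
have Ex' := up_exec hwf' hup'.
rewrite -Ec' in Ex'.
have [d' Ed' Ecd'] := exec_cexec hv' Ex'.
have [hvd' _ _ _] := ctrace_run hv' Ed'.
exists (flatten ps'), d'; split=> //; rewrite eps in Ed hu *.
split; last split=> //.
  apply/(upper_lev hv' Ed' hk); rewrite Ec'.
  exact: up_lev hwf' hup'.
have hsz : size ps' = size ps by rewrite -[LHS](size_map val_of) hval size_map.
exists (segments c' ps'), (segments c ps); split.
  by have := kdecomp_up hk hup' hv' (cs0 := [::]) erefl Ec' (kd_nil _ _ _ _); apply.
split; first by have := kdecomp_up hk hup hv (cs0 := [::]) erefl Ec (kd_nil _ _ _ _); apply.
rewrite (size_segments Ed') (size_segments Ed); split=> //; split=> [i hi|].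
  have hi' : i < size ps by rewrite -hsz.
  have [d1 [d2 [h1 h2 h3]]] := nth_segments Ed hi'.
  have [d1' [d2' [h1' h2' h3']]] := nth_segments Ed' hi.
  have [hv1 _ _ _] := ctrace_run hv h1.
  have [hv1' _ _ _] := ctrace_run hv' h1'.
  have [_ _ hw _] := ctrace_run hv1 h2.
  have [_ _ hw' _] := ctrace_run hv1' h2'.
  rewrite h3 h3' hw hw' !ohead_ctrace; split.
    have := congr1 (fun s => nth one s i) hval.
    by rewrite !(nth_map [::]) // ?hsz.
  have [q2 [g2 [e2 [e2' [k1 k2 k3]]]]] := hmid i.
  have E1 : cst d1 = (q2, Clo g2 tt e2).
    by apply: Some_inj; rewrite -(cexec_cst hv h1) Ec.
  have E1' : cst d1' = (q2, Clo g2 tt e2').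
    by apply: Some_inj; rewrite -(cexec_cst hv' h1') Ec'.
  rewrite /=; congr Some; apply: (sim_posdown hv1' hv1 hk E1' E1).
  by apply: esym; apply: sim_drop k3.
rewrite (rlast_ctrace Ed) (rlast_ctrace Ed') /=; congr Some.
apply: (sim_posdown hvd' hvd hk Ecd' Ecd).
by apply: esym; apply: sim_drop hsim'.
Qed.

Lemma lev_le cs q g env q' v' : wfc n (Clo g tt env) ->
  exec (q, Clo g tt env) cs = Some (q', v') -> lev (q, Clo g tt env) cs <= n.
Proof.
move=> hwf E; pose S (a b : nat) := a = b /\ b <= n.
have hS : crel S (ereg (Clo g tt env)) (ereg (Clo g tt env)).
  apply: (@crel_refl _ _ _ (fun a => a <= n)) => //.
  by constructor=> // i; rewrite nth_renv; apply: allc_const; lia.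
have [g' [b [e' [_ [h1 h2]]]]] := lev_label hS E.
by move: h1; rewrite erase_id => ->.
Qed.

Lemma lev_cexec_le c cs c' : valid c -> cexec c cs = Some c' -> lev (cst c) cs <= n.
Proof.
move=> hv Ec; have [g [e E]] := cst_Clo hv.
have hwf := cst_wf hv; have := cexec_cst hv Ec; rewrite E in hwf *.
by case: (cst c') => q' v'; exact: lev_le.
Qed.

(** * Pumping along the milestone run *)

(* Observations: [(m, q', x, g', F)] holds in [c] with respect to the
   components [eb] of a fixed stack if a run of value [m] from [c] leads to
   [q'] and to the topmost x-stack of [eb] (any symbol [g'] for x = 0), under
   components n,...,x+1 of types [F]. *)
Definition obs := (M * Q * nat * G * seq (seq (desc)))%type.

Definition target (eb : seq (clo G unit)) (x : nat) (g : G) (e : seq (clo G unit)) : Prop :=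
  (x = 0 /\ e = [::]) \/ (0 < x /\ nth Base eb (n - x) = Clo g tt e).

Definition observes (eb : seq (clo G unit)) (c : config) (o : obs) : Prop :=
  let: (m, q', x, g', F) := o in
  exists cs h e, [/\ exec (cst c) cs = Some (q', Clo g' tt (h ++ e)), val_of cs = m,
    map tp h = F, size h = n - x & target eb x g' e].

Lemma target_inj eb x g e e' : target eb x g e -> target eb x g e' -> e = e'.
Proof.
case=> [[h1 ->]|[h1 h2]] [[h3 h4]|[h3 h4]] //; try lia.
by move: h2; rewrite h4 => -[].
Qed.

Definition all_obs : seq obs :=
  List.flat_map (fun m => List.flat_map (fun q => List.flat_map (fun x =>
  List.flat_map (fun g => map (pair (m, q, x, g))
    (prods (map (@powl _) (univ (n - x))))) (enum G)) (iota 0 n.+1))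
    (enum Q)) (enum M).

Lemma In_all_obs m (q : Q) x (g : G) h : x <= n -> size h = n - x ->
  (forall i, wfc (n - i) (nth Base h i)) ->
  List.In (m, q, x, g, map tp h) all_obs.
Proof.
move=> hx hs hw.
apply/List.in_flat_map; exists m; split; first by apply/In_mem; rewrite mem_enum.
apply/List.in_flat_map; exists q; split; first by apply/In_mem; rewrite mem_enum.
apply/List.in_flat_map; exists x; split; first by apply/In_mem; rewrite mem_iota; lia.
apply/List.in_flat_map; exists g; split; first by apply/In_mem; rewrite mem_enum.
apply: (List.in_map (pair (m, q, x, g))); apply: tps_univ => //; lia.
Qed.

Section Milestone.
Variables (star : A) (rho : nat -> config) (I : nat -> Prop).
Hypothesis rho_valid : forall i, valid (rho i).
Hypothesis rho_step : forall i, step (rho i) (rho i.+1).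
Hypothesis rho_star : forall i,
  lab (rho i) (rho i.+1) = None \/ lab (rho i) (rho i.+1) = Some star.
Hypothesis I0 : I 0.
Hypothesis I_inf : forall m, exists i, m <= i /\ I i.
Hypothesis I_upper : forall i j, I i -> I j -> i <= j ->
  upper 0 (mkseq (fun t => rho (i + t)) (j - i).+1).

Definition choice (i : nat) : option A := lab (rho i) (rho i.+1).
Definition seg (i m : nat) : seq (option A) := mkseq (fun t => choice (i + t)) m.
Definition stars (i : nat) : nat := size (pmap id (seg 0 i)).

Lemma rho_cstep i : cstep (rho i) (choice i) = Some (rho i.+1).
Proof.
have [a Ea] := step_cstep (rho_valid i) (rho_step i).
by have [_ _] := cstep_lab (rho_valid i) Ea; rewrite /choice => ->.
Qed.

Lemma segS i m : seg i m.+1 = choice i :: seg i.+1 m.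
Proof.
have h1 : iota 1 m = map S (iota 0 m) by rewrite -(iotaDl 1 0).
rewrite /seg /mkseq /= addn0 h1 -map_comp; congr cons.
by apply: eq_map => t /=; rewrite addSnnS.
Qed.

Lemma rho_cexec i m : cexec (rho i) (seg i m) = Some (rho (i + m)).
Proof.
elim: m i => [|m IH] i; first by rewrite addn0.
by rewrite segS /= rho_cstep /= IH addSnnS.
Qed.

Lemma rho_ctrace i m : ctrace (rho i) (seg i m) = mkseq (fun t => rho (i + t)) m.+1.
Proof.
elim: m i => [|m IH] i; first by rewrite /mkseq /= addn0.
have h1 : iota 1 m.+1 = map S (iota 0 m.+1) by rewrite -(iotaDl 1 0).
rewrite segS [LHS]/= rho_cstep IH /mkseq [iota 0 m.+2]/= -/(iota 1 m.+1) h1 map_cons addn0.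
by rewrite -map_comp; congr cons; apply: eq_map => t /=; rewrite addSnnS.
Qed.

Lemma seg_cat i m p : seg i (m + p) = seg i m ++ seg (i + m) p.
Proof.
elim: m i => [|m IH] i; first by rewrite addn0.
by rewrite addSn !segS IH addSnnS.
Qed.

Lemma seg_lev0 i j : I i -> I j -> i <= j -> lev (cst (rho i)) (seg i (j - i)) = 0.
Proof.
move=> hi hj hij; apply/eqP; rewrite -leqn0.
apply/(upper_lev (rho_valid i) (rho_cexec i _) (leq0n n)).
by rewrite rho_ctrace; exact: I_upper.
Qed.

Lemma word_seg i m : exists s, pmap id (seg i m) = nseq s star.
Proof.
elim: m i => [|m IH] i; first by exists 0.
have [s hs] := IH i.+1; rewrite segS /= hs.
case: (rho_star i); rewrite /choice => ->; first by exists s.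
by exists s.+1.
Qed.

Lemma stars_le i j : i <= j -> stars i <= stars j.
Proof. by move=> h; rewrite /stars -(subnKC h) seg_cat pmap_cat size_cat leq_addr. Qed.

(** The only freedom of a run is the letter it reads. While fewer than [pb] stars have been read,
    its next letter is a star, as on [rho]. *)
Lemma run_follows pb cs c' N : cexec (rho 0) cs = Some c' ->
  prefix (nseq pb star) (pmap id cs) -> stars N < pb ->
  exists cs2, cs = seg 0 N ++ cs2.
Proof.
move=> Ec /prefixP [w hw]; elim: N => [|N IH] hN; first by exists cs.
have hN' : stars N < pb by apply: leq_ltn_trans hN; apply: stars_le; lia.
have [cs2 hcs2] := IH hN'.
(* A run ending here would have read only [stars N] letters, fewer than [pb]. *)
case: cs2 hcs2 => [|a cs2] hcs2.
  have := congr1 size hw; rewrite size_cat size_nseq hcs2 cats0 -/(stars N); lia.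
exists cs2; rewrite -addn1 seg_cat hcs2 -catA; congr cat.
rewrite segS /= add0n; congr cons.
move: Ec; rewrite hcs2 cexec_cat rho_cexec /= add0n.
have := rho_cstep N; rewrite /cstep; case: (topsym _ _) => // g.
case: (delta _ g) => [f|q o]; case Ech : (choice N) => [b|] //; case: a hcs2 => [a|] // hcs2 _ _.
have hb : b = star by case: (rho_star N); rewrite -/(choice N) Ech // => -[].
congr Some; rewrite hb.
have := congr1 (fun s => nth a s (stars N)) hw.
rewrite hcs2 pmap_cat /= nth_cat ltnn subnn /= => ->.
by rewrite nth_cat size_nseq hN' nth_nseq hN'.
Qed.

Definition env_of (c : config) : seq (clo G unit) :=
  if (cst c).2 is Clo _ _ e then e else [::].

(** The value of the prefix is included so that prefixes of [rho] with the same fingerprint can be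
    exchanged without changing the value of the whole run. *)
Definition fingerprint (b i : nat) : M * seq obs :=
  (val_of (seg 0 i),
   List.filter (fun o => decb (observes (env_of (rho b)) (rho i) o)) all_obs).

Lemma fingerprint_finite b i :
  List.In (fingerprint b i)
    (List.flat_map (fun m => map (pair m) (powl all_obs)) (enum M)).
Proof.
apply/List.in_flat_map; exists (val_of (seg 0 i)).
split; first by apply/In_mem; rewrite mem_enum.
apply: (List.in_map (pair _)); exact: In_powl_filter.
Qed.

Definition recurs (b i : nat) : Prop :=
  [/\ b <= i, I i &
   forall m, exists j, [/\ m <= j, I j & fingerprint b j = fingerprint b i]].

Lemma recurs_ex b : exists i, recurs b i.
Proof. by apply: (recurrent_value b) I_inf => i _; exact: fingerprint_finite. Qed.

Definition next_pivot (b : nat) : nat :=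
  proj1_sig (constructive_indefinite_description _ (recurs_ex b)).
Definition pivot (a : nat) : nat := iter a next_pivot 0.

Lemma pivot_recurs a : recurs (pivot a) (pivot a.+1).
Proof. exact: (proj2_sig (constructive_indefinite_description _ (recurs_ex (pivot a)))). Qed.

Lemma pivot_I a : I (pivot a).
Proof. by case: a => // a; have [] := pivot_recurs a. Qed.

Lemma pivot_le a : pivot a <= pivot a.+1.
Proof. by have [] := pivot_recurs a. Qed.

Lemma pivot_mono a b : a <= b -> pivot a <= pivot b.
Proof.
move=> h; rewrite -(subnKC h); elim: (b - a) => [|m IH]; first by rewrite addn0.
by rewrite addnS; apply: leq_trans IH (pivot_le _).
Qed.

Lemma fingerprint_transfer b i j o : fingerprint b j = fingerprint b i ->
  List.In o all_obs -> observes (env_of (rho b)) (rho i) o ->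
  observes (env_of (rho b)) (rho j) o.
Proof.
case=> _ hf ho hob; apply/decbP.
have : List.In o (fingerprint b i).2 by apply/List.filter_In; split=> //; apply/decbP.
by rewrite /= -hf => /List.filter_In [].
Qed.

(* Some point [pivot a.+1] of the run sees the x-stack that was on the x-th level
   at [pivot a], and the remaining part of the run is x-upper. *)
Lemma expose_between k cs c' : k <= n ->
  cexec (rho 0) (seg 0 (pivot n.+1) ++ cs) = Some c' ->
  (0 < k -> k <= lev (cst (rho 0)) (seg 0 (pivot n.+1) ++ cs)) ->
  exists a x (c1 c2 : seq (option A)) q g h e,
  [/\ k <= x <= n,
      seg 0 (pivot n.+1) ++ cs = seg 0 (pivot a.+1) ++ c1 ++ c2,
      exec (cst (rho (pivot a.+1))) c1 = Some (q, Clo g tt (h ++ e)),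
      size h = n - x /\ target (env_of (rho (pivot a))) x g e &
      exec (q, Clo g tt (h ++ e)) c2 = Some (cst c') /\
      lev (q, Clo g tt (h ++ e)) c2 <= x].
Proof.
move=> hk E hlev.
(* [rest a] is the run from p_a on and [z a] is its level. Segments of [rho] between pivots have
   level 0, so [z] is nondecreasing; its n + 2 values are at most n, so two consecutive ones
   agree. *)
pose rest a := seg (pivot a) (pivot n.+1 - pivot a) ++ cs.
pose z a := lev (cst (rho (pivot a))) (rest a).
have hrest a : a <= n.+1 -> seg 0 (pivot n.+1) ++ cs = seg 0 (pivot a) ++ rest a.
  move=> ha; have hs := seg_cat 0 (pivot a) (pivot n.+1 - pivot a); rewrite add0n in hs.
  by rewrite /rest catA -hs subnKC //; exact: pivot_mono.
have hrestS a : a <= n -> rest a = seg (pivot a) (pivot a.+1 - pivot a) ++ rest a.+1.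
  move=> ha; rewrite /rest catA; congr cat.
  have h1 := pivot_le a; have h2 : pivot a.+1 <= pivot n.+1 by apply: pivot_mono.
  have hs := seg_cat (pivot a) (pivot a.+1 - pivot a) (pivot n.+1 - pivot a.+1).
  rewrite subnKC // in hs; rewrite -hs; congr seg; lia.
have Erest a : a <= n.+1 -> cexec (rho (pivot a)) (rest a) = Some c'.
  by move=> /hrest hc; move: E; rewrite hc cexec_cat rho_cexec.
have hzn a : a <= n.+1 -> z a <= n.
  by move=> ha; exact: lev_cexec_le (rho_valid _) (Erest a ha).
have hseg0 a : lev (cst (rho (pivot a))) (seg (pivot a) (pivot a.+1 - pivot a)) = 0.
  by apply: seg_lev0; [exact: pivot_I|exact: pivot_I|exact: pivot_le].
have Eseg a : exec (cst (rho (pivot a))) (seg (pivot a) (pivot a.+1 - pivot a)) =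
    Some (cst (rho (pivot a.+1))).
  have := rho_cexec (pivot a) (pivot a.+1 - pivot a); rewrite subnKC; last exact: pivot_le.
  by move/(cexec_cst (rho_valid _)).
have hmono a : a <= n -> z a <= z a.+1.
  move=> ha; rewrite {1}/z hrestS //.
  have [g [e Ee]] := cst_Clo (rho_valid (pivot a)).
  have [g' [e' Ee']] := cst_Clo (rho_valid (pivot a.+1)).
  have hwf := cst_wf (rho_valid (pivot a)).
  have := cexec_cst (rho_valid _) (Erest a.+1 ha); case: (cst c') => q2 v2 E2.
  have := hseg0 a; have := Eseg a; rewrite Ee Ee' in hwf E2 *; move=> E1 h0.
  apply: (lev_cat (hzn a.+1 ha) hwf E1 E2); first by rewrite h0.
  by rewrite /z Ee'.
have [a ha hza] := nondecreasing_repeats (hzn n.+1 (leqnn _)) hmono.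
have hkz : k <= z a.
  have hz0 : z 0 <= z a.
    elim: (a) ha => // b IH hb; apply: leq_trans (IH _) (hmono _ _); lia.
  case: (posnP k) => [->//|hk0]; apply: leq_trans hz0.
  by have := hlev hk0; rewrite (hrest 0).
have [g [e Ee]] := cst_Clo (rho_valid (pivot a)).
have [g' [e' Ee']] := cst_Clo (rho_valid (pivot a.+1)).
have hwf := cst_wf (rho_valid (pivot a)).
have Er := cexec_cst (rho_valid _) (Erest a.+1 ha).
(* At level 0 nothing has to be exposed: the whole rest is observed, with empty [e] and nothing left
   to simulate. *)
exists a, (z a); case: (posnP (z a)) => hz0.
  have hvc' : valid c' by have [] := ctrace_run (rho_valid 0) E.
  have [g1 [e1 E1]] := cst_Clo hvc'.
  have [hs _] : size e1 = n /\ True.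
    by have := cst_wf hvc'; rewrite E1 => /wfc_cloE [].
  exists (rest a.+1), [::], c'.1, g1, e1, [::]; rewrite !cats0 hz0 subn0; split=> //.
  - by rewrite -hz0 hkz /=; lia.
  - exact: hrest.
  - by rewrite Er E1.
  - by split=> //; left.
  - by rewrite /= -E1 lev_nil.
have hzx : 1 <= z a <= n by have := hzn a ltac:(lia); lia.
have := hseg0 a; have := Eseg a; rewrite Ee Ee' in hwf *; move=> Es h0.
case Ec' : (cst c') => [q2 v2]; rewrite Ee' Ec' in Er.
have h1 : lev ((rho (pivot a.+1)).1, Clo g' tt e') (rest a.+1) = z a.
  by rewrite hza /z Ee'.
have h2 : lev ((rho (pivot a)).1, Clo g tt e) (seg (pivot a) (pivot a.+1 - pivot a) ++ rest a.+1) = z a.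
  by rewrite -hrestS // /z Ee.
have [g0 [e0 [c1 [c2 [q1 [h [k1 k2 k3 k4 k5]]]]]]] :=
  same_level_expose hzx hwf Es h0 Er h1 h2.
exists c1, c2, q1, g0, h, e0; split=> //.
- by rewrite hkz; lia.
- by rewrite (hrest a.+1) // k2.
- by split=> //; right; split=> //; rewrite /env_of Ee.
- by split=> //; move: Er; rewrite k2 exec_cat k4.
Qed.

(** The observation made at p_(a+1) is repeated from a time [j] with the same fingerprint, late
    enough for l stars. Then [c2] is simulated at level x, and the second run at level k, which is
    possible because k <= x. *)
Lemma unbounded_case : (forall l, exists N, l <= stars N) ->
  forall k cs c' csR' cR', k <= n ->
  cexec (rho 0) (seg 0 (pivot n.+1) ++ cs) = Some c' ->
  (0 < k -> k <= lev (cst (rho 0)) (seg 0 (pivot n.+1) ++ cs)) ->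
  cexec c' csR' = Some cR' -> upper k (ctrace c' csR') ->
  forall l, exists csS cS csS' cS',
    [/\ cexec (rho 0) csS = Some cS, cexec cS csS' = Some cS',
     val_of csS = val_of (seg 0 (pivot n.+1) ++ cs),
     prefix (nseq l star) (pmap id csS) &
     parallel n delta phi k (ctrace cS csS') (ctrace c' csR')].
Proof.
move=> hinf k cs c' csR' cR' hk E hlev ER' hup l.
have [a [x [c1 [c2 [q [g [h [e [hx hcs E1 [hsh htg] [E2 hlev2]]]]]]]]]] :=
  expose_between hk E hlev.
have hvc' : valid c' by have [] := ctrace_run (rho_valid 0) E.
have hwf1 : wfc n (Clo g tt (h ++ e)).
  have := E1; case Ei : (cst _) => [qi vi] E1'.
  by apply: (exec_wf ) E1'; have := cst_wf (rho_valid (pivot a.+1)); rewrite Ei.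
have [hse hwe] := wfc_cloE hwf1.
have hwh i : wfc (n - i) (nth Base h i).
  case: (ltnP i (size h)) => hi; last by rewrite nth_default //; constructor.
  by have := hwe i; rewrite nth_cat hi.
have hxn : x <= n by lia.
have hob := In_all_obs (val_of c1) q g hxn hsh hwh.
have hobs : observes (env_of (rho (pivot a))) (rho (pivot a.+1)) (val_of c1, q, x, g, map tp h).
  by exists c1, h, e.
have [N hN] := hinf l.
have [_ _ /(_ N) [j [hNj hIj hfp]]] := pivot_recurs a.
have [c1' [h' [e' [E1' hval1 htp hsh' htg']]]] := fingerprint_transfer hfp hob hobs.
have ee := target_inj htg htg'; subst e'.
(* The components up to level x are literally the same by [target_inj]; of those above, only the
   types agree. *)
have hsim : sim x (h ++ e) (h' ++ e).
  split; first by rewrite !size_cat hsh hsh'.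
    move=> i; rewrite !nth_cat hsh hsh'; case: ifP => hi; last exact: dominated_refl.
    apply: (dominated_eq_tp).
    by have := congr1 (fun s => nth [::] s i) htp; rewrite !nth_tp => ->.
  by move=> i hi; rewrite !nth_cat hsh hsh' ltnNge hi.
have hwf1' : wfc n (Clo g tt (h' ++ e)).
  have := E1'; case Ei : (cst _) => [qi vi] E1''.
  by apply: (exec_wf ) E1''; have := cst_wf (rho_valid j); rewrite Ei.
have [gc [ec Ec']] := cst_Clo hvc'; rewrite Ec' in E2.
have [ps eps hups] := up_parse (leqnn _) hwf1 E2 hlev2.
have [ps' [ec' [hups' hvals hsim' _]]] :=
  up_sim hups hwf1 hwf1' hsim.
have Eps' := up_exec hwf1' hups'.
pose csS := seg 0 j ++ c1' ++ flatten ps'.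
have EcS : exec (cst (rho 0)) csS = Some (c'.1, Clo gc tt ec').
  rewrite /csS exec_cat (cexec_cst (rho_valid 0) (rho_cexec 0 j)) /= add0n.
  by rewrite exec_cat E1' /=.
have [cS EcS' hcS] := exec_cexec (rho_valid 0) EcS.
have [hvS _ _ _] := ctrace_run (rho_valid 0) EcS'.
have hsimk : sim k ec ec' by apply: sim_weak hsim'; lia.
have [csS' [cS' [h1 h2]]] :=
  parallel_sim hk hvc' hvS Ec' hcS hsimk ER' hup.
exists csS, cS, csS', cS'; split=> //.
  rewrite hcs /csS !val_cat hval1 eps (val_flatten_eq hvals).
  by case: hfp => -> _.
rewrite /csS pmap_cat; have [s hs] := word_seg 0 j.
have hls : l <= s.
  have <- : stars j = s by rewrite /stars hs size_nseq.
  exact: leq_trans hN (stars_le hNj).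
rewrite hs -(subnKC hls) nseqD -catA; exact: prefix_prefix.
Qed.

End Milestone.

End Types.

End Machine.

Theorem mainTheorem18
  (n : nat) (Q A G : finType) (delta : Q -> G -> trans Q A G) (star : A)
  (M : finType) (mul : M -> M -> M) (one : M)
  (mulA : associative mul) (mul1m : left_id one mul) (mulm1 : right_id one mul)
  (phi : seq A -> M)
  (phi_nil : phi [::] = one)
  (phi_cat : forall u v, phi (u ++ v) = mul (phi u) (phi v)) :
  1 <= n ->
  dpda_wf n delta ->
  forall c : config Q G, valid_config n c -> milestone n delta star c ->
  exists pb : nat,
    forall (k : nat) (R R' : seq (config Q G)),
      k <= n ->
      is_run n delta R -> is_run n delta R' ->
      ohead R = Some c -> rlast R = ohead R' ->
      ~ upper_pred n delta k R ->
      prefix (nseq pb star) (word n delta R) ->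
      upper n delta k R' ->
      forall l : nat,
        exists S S' : seq (config Q G),
          is_run n delta S /\ is_run n delta S' /\
          ohead S = Some c /\ rlast S = ohead S' /\
          phi (word n delta S) = phi (word n delta R) /\
          prefix (nseq l star) (word n delta S) /\
          parallel n delta phi k S' R'.
Proof.
move=> _ wf_delta c hv [rho [<- [rv [rs [rl [I [I0 [Iinf Iup]]]]]]]] {c hv}.
have hv := rv 0.
have follow pb R N : is_run n delta R -> ohead R = Some (rho 0) ->
    prefix (nseq pb star) (word n delta R) -> stars n delta rho N < pb ->
    exists cs c', R = ctrace n delta (rho 0) (seg n delta rho 0 N ++ cs) /\
      cexec n delta (rho 0) (seg n delta rho 0 N ++ cs) = Some c'.
  move=> hR hoR; have [cs [c' [-> Ec]]] := is_run_ctrace hR hoR.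
  have [_ _ -> _] := ctrace_run wf_delta hv Ec => hpre hN.
  have [cs2 hcs] := run_follows wf_delta rv rs rl Ec hpre hN.
  by exists cs2, c'; rewrite -hcs.
(* If the number of stars on [rho] stays below l0, the bound l0 makes the claim vacuous: a run
   beginning with that many stars would follow [rho] beyond its own length. *)
case: (classic (forall l, exists N, l <= stars n delta rho N)) => hinf; last first.
  have [l0 hl0] := not_all_ex_not _ _ hinf.
  exists l0 => k R R' _ hR _ hoR _ _ hpre.
  have hN : stars n delta rho (size R) < l0.
    by rewrite ltnNge; apply/negP => h; apply: hl0; exists (size R).
  have [cs [c' [eR Ec]]] := follow _ _ _ hR hoR hpre hN.
  have := congr1 size eR; rewrite (size_ctrace Ec) size_cat /seg size_mkseq; lia.
set P := pivot n delta mul one phi rho Iinf n.+1.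
(* One star more than [rho] reads up to p_(n+1) forces the run to follow [rho] at least to that
   point. *)
exists (stars n delta rho P).+1 => k R R' hk hR hR' hoR hRR' hnup hpre hup l.
have [cs [c' [eR Ec]]] := follow _ _ _ hR hoR hpre (ltnSn _).
have [hvc' _ hwR _] := ctrace_run wf_delta hv Ec.
have hoR' : ohead R' = Some c' by rewrite -hRR' eR (rlast_ctrace Ec).
have [csR' [cR' [eR' EcR']]] := is_run_ctrace hR' hoR'.
rewrite eR' in hup *.
(* Not being (k-1)-upper means having level at least k; for k = 0 the convention gives no
   information. *)
have hlev : 0 < k -> k <= lev n delta (cst (rho 0)) (seg n delta rho 0 P ++ cs).
  case: k hk hnup {hup} => // k hk hnup _; rewrite ltnNge; apply/negP => hle.
  by apply: hnup; rewrite eR /=; apply/(upper_lev wf_delta hv Ec (ltnW hk)).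
have [csS [cS [csS' [cS' [h1 h2 h3 h4 h5]]]]] :=
  unbounded_case wf_delta phi_nil phi_cat rv rs rl I0 Iup hinf hk Ec hlev EcR' hup l.
have [hvS hrS hwS _] := ctrace_run wf_delta hv h1.
have [_ hrS' _ _] := ctrace_run wf_delta hvS h2.
exists (ctrace n delta (rho 0) csS), (ctrace n delta cS csS').
do 2![split=> //]; rewrite !ohead_ctrace (rlast_ctrace h1) hwS eR hwR.
by do 4![split=> //].
Qed.
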